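(* Let $\{\varepsilon_k, k\in\mathbb{Z}\}$ be an i.i.d. sequence of real random variables and let $c,g:\mathbb{R}\to\mathbb{R}$ be measurable. Assume that for every $k\in\mathbb{Z}$ the series $$X_k=\sum_{i=1}^{\infty} g(\varepsilon_{k-i})\prod_{1\le j<i}c(\varepsilon_{k-j})$$ converges almost surely. Let $\Lambda(x)=\log x$, let $\sigma_k> 0$ be defined by $\Lambda(\sigma_k^2)=X_k$ (i.e. $\sigma_k^2=e^{X_k}$), and let $y_k=\sigma_k\varepsilon_k$. Assume that there are constants $c_*<1$ and $\mu>0$ with $$|c(\varepsilon_0)|\le c_*\ \text{ a.s.}\qquad\text{and}\qquad \mathbb{E}e^{\mu|g(\varepsilon_0)|}<\infty .$$ Let $\nu>0$ with $\mu>3\nu/2$, let $f$ be one of the functions $f(x)=|x|^{\nu}$ or $f(x)=\operatorname{sign}(x)\cdot|x|^{\nu}$, and assume $\mathbb{E}|f(y_0)|^3<\infty$. Put $$S_n=f(y_1)+\cdots+f(y_n)-n\mathbb{E}f(y_1),\qquad B_n^2=\operatorname{Var}S_n,\qquad \beta_n^2=B_n^2/n$$ with $B_n,\beta_n\ge 0$. Then $\beta:=\lim_{n\to\infty}\beta_n$ exists, and if $\beta>0$, there is some $C>0$ (which may depend on $f$, $\Lambda$, $c$, $g$ and the law of $\varepsilon_0$) such that $$|P\{S_n<xB_n\}-\Phi(x)|\le C\,\frac{(\log n)^2}{\sqrt n}\qquad\text{for all } n\ge 2 \text{ and } x\in\mathbb{R}.$$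
   Context: The empty product (for $i=1$) equals $1$. $\Phi$ is the standard normal distribution function. Equivalently $\beta_n^2=\operatorname{Var}f(y_0)+2\sum_{j=1}^{n-1}(1-j/n)\operatorname{Cov}(f(y_1),f(y_{j+1}))$. The process $(y_k)$ is the exponential augmented GARCH(1,1) process. *)

(* Defs.v *)
From HB Require Import structures.
From mathcomp Require Import all_boot all_order all_algebra finmap.
From mathcomp Require Import all_classical all_reals all_analysis.

Set Implicit Arguments.
Unset Strict Implicit.
Unset Printing Implicit Defensive.

Import Order.TTheory GRing.Theory Num.Theory.
Import numFieldNormedType.Exports.

Local Open Scope classical_set_scope.
Local Open Scope ring_scope.

Section iid.
Context {d : measure_display} {T : measurableType d} {R : realType}.
Context {P : probability T R}.

Definition mutually_independent (eps : int -> {RV P >-> R}) : Prop :=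
  forall (J : {fset int}) (A : int -> set R),
    (forall k, k \in J -> measurable (A k)) ->
    P (\bigcap_(k in [set` J]) (eps k @^-1` A k)) =
    (\prod_(k <- J) P (eps k @^-1` A k))%E.

(* Only measurable sets are tested: [distribution] is a total set function,
   unspecified outside the sigma-algebra. *)
Definition identically_distributed (eps : int -> {RV P >-> R}) : Prop :=
  forall (k : int) (A : set R), measurable A ->
    distribution P (eps k) A = distribution P (eps 0) A.

Definition iid (eps : int -> {RV P >-> R}) : Prop :=
  mutually_independent eps /\ identically_distributed eps.

End iid.

Section exponential_garch.
Context {T : Type} {R : realType}.
Variables (c g : R -> R) (eps : int -> T -> R).

Definition garch_partial (k : int) (w : T) (n : nat) : R :=
  \sum_(1 <= i < n.+1)
     g (eps (k - i%:Z) w) * \prod_(1 <= j < i) c (eps (k - j%:Z) w).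

(* Where the series diverges, [limn] returns a fixed default value; this only
   concerns a null set when the series converges almost surely. *)
Definition garch_X (k : int) (w : T) : R := limn (garch_partial k w).

Definition garch_sigma (k : int) (w : T) : R := Num.sqrt (expR (garch_X k w)).

Definition garch_y (k : int) (w : T) : R := garch_sigma k w * eps k w.

Lemma garch_sigma_gt0 (k : int) (w : T) : 0 < garch_sigma k w.
Proof. by rewrite sqrtr_gt0 expR_gt0. Qed.

Lemma ln_garch_sigma2 (k : int) (w : T) :
  ln (garch_sigma k w ^+ 2) = garch_X k w.
Proof. by rewrite sqr_sqrtr ?expR_ge0// expRK. Qed.

End exponential_garch.

Definition abs_power {R : realType} (nu x : R) : R := `|x| `^ nu.

Definition signed_power {R : realType} (nu x : R) : R := Num.sg x * `|x| `^ nu.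

Section centered_sums.
Context {d : measure_display} {T : measurableType d} {R : realType}.
Variables (P : probability T R) (f : R -> R) (y : int -> T -> R).

Definition centered_sum (n : nat) (w : T) : R :=
  \sum_(1 <= k < n.+1) f (y k%:Z w) -
  n%:R * fine 'E_P[fun w' => (f (y 1 w'))%R]%E.

Definition sum_sd (n : nat) : R := Num.sqrt (fine 'V_P[centered_sum n]%E).

Definition normalized_sd (n : nat) : R := Num.sqrt (sum_sd n ^+ 2 / n%:R).

End centered_sums.

Definition Phi {R : realType} (x : R) : R :=
  fine (normal_prob (0 : R) 1 `]-oo, x]).

(* Main.v *)
Require Import Defs.
From HB Require Import structures.
From mathcomp Require Import all_boot all_order all_algebra finmap.
From mathcomp Require Import all_classical all_reals all_analysis.
From mathcomp Require Import measurable_realfun ring lra zify.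

Import Order.TTheory GRing.Theory Num.Theory.
Import numFieldNormedType.Exports.

Local Open Scope classical_set_scope.
Local Open Scope ring_scope.

(** Since [|c|] stays below a constant smaller than one, the volatility forgets
    the distant past geometrically fast.  Let [f (y_k^(m))] be computed from the
    first [m] terms of the series [X_k].  As [f (s * e) = s^nu * f e] for
    [s > 0], the variable [f (y_k)] is [f (eps_k)] times [exp (nu * X_k / 2)],
    and both the exponent and the tails of the series are dominated by the
    geometric sum [A = sum_i rho^i |g (eps_{k-i-1})|].  Convexity of the
    exponential bounds [E exp (mu * A)] by a product that converges
    ([exp_envelope]).  Hence, because [3 nu / 2 < mu], the truncated variables
    have bounded third moments ([fy_m_third]), and they approach [f (y_k)] in
    mean square at a geometric rate ([fy_close]).  The noise being i.i.d., [y]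
    is stationary ([fy_centered_stat]).

    What remains concerns any stationary centered sequence [Z] with such
    approximations ([berry_esseen_process]).  The covariances decay
    geometrically, so the variance of the sum of [n] terms divided by [n]
    converges, as a Cesaro mean.  If the limit is positive, truncate at [m] of
    order [log n]: this changes the sum by [O (n^-2)] in quadratic mean,
    and the truncated sequence is [m]-dependent.  The theorem therefore follows from
    a Berry-Esseen bound for [m]-dependent sequences with error
    [O (m^2 / sqrt n)], uniform in [m] ([berry_esseen_m_dependent]).

    That bound is proved by Stein's method.  Replace the indicator of the
    half-line by a ramp of width [L / B], where [L] is of order [m^2] and [B]
    is the normalization, and let [u] be the corresponding solution of Stein's
    equation.  Expanding [E (S u (S / B))] term by term, the sum near an index
    being separated from the rest, leaves increments of [u'].  Apart from a
    Lipschitz part they are increments of the ramp, small unless the sum falls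
    in a window of length [O (L)] ([stein_one_term]).  The probability of
    this is controlled by a concentration inequality ([conc_all]): for a
    weight and a shift that depend only on other coordinates, the weighted mass
    that a block sum of [n] terms puts near a point at scale [L] is
    [O (L / sqrt n)].  Its proof is an induction on the length of the block.
    Testing the sum against the bounded primitive of a peaked function bounds
    from above, by Cauchy-Schwarz, a quantity that [m]-dependence shows to be
    the variance times the wanted mass, up to errors of the same kind for
    shorter blocks ([interior_term], [conc_step]). *)

(** * Expectations of real random variables *)

Section expectation_toolkit.
Set Implicit Arguments.
Context {d : measure_display} {T : measurableType d} {R : realType}.
Variable P : probability T R.
Implicit Types X Y Z : T -> R.

Definition L1 X : Prop := P.-integrable [set: T] (EFin \o X).

(** Real valued, so that it can be handled by linear arithmetic; [fine] makes it
    0 when the integral is infinite, hence the integrability hypotheses below. *)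
Definition Ex X : R := fine 'E_P[X].

Lemma ExE X : Ex X = (\int[P]_w X w)%R.
Proof. by rewrite /Ex unlock. Qed.

Lemma L1_meas X : L1 X -> measurable_fun [set: T] X.
Proof. by move/integrableP => [/measurable_EFinP]. Qed.

Lemma L1_le X Y : measurable_fun [set: T] X -> (forall w, `|X w| <= Y w) ->
  L1 Y -> L1 X.
Proof.
move=> mX XY; apply: le_integrable => //; first exact/measurable_EFinP.
move=> w _ /=; rewrite lee_fin (le_trans (XY w))//.
by rewrite ler_norm.
Qed.

Lemma L1D X Y : L1 X -> L1 Y -> L1 (fun w => X w + Y w).
Proof. exact: integrableD. Qed.

Lemma L1B X Y : L1 X -> L1 Y -> L1 (fun w => X w - Y w).
Proof. exact: integrableB. Qed.

Lemma L1Z r X : L1 X -> L1 (fun w => r * X w).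
Proof. exact: integrableZl. Qed.

Lemma L1Zr r X : L1 X -> L1 (fun w => X w * r).
Proof. by move=> /(L1Z r); apply: eq_integrable => // w _ /=; rewrite mulrC. Qed.

Lemma L1_abs X : L1 X -> L1 (fun w => `|X w|).
Proof. by move=> /integrable_norm. Qed.

Lemma L1_cst r : L1 (fun _ => r).
Proof. exact: finite_measure_integrable_cst. Qed.

Lemma L1_sum {I : Type} (s : seq I) (p : pred I) (X : I -> T -> R) :
  (forall i, p i -> L1 (X i)) -> L1 (fun w => \sum_(i <- s | p i) X i w).
Proof.
move=> h; elim: s => [|i s IH].
  have -> : (fun w => \sum_(i <- [::] | p i) X i w) = fun=> 0.
    by apply/funext => w; rewrite big_nil.
  exact: L1_cst.
have -> : (fun w => \sum_(j <- i :: s | p j) X j w) =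
    fun w => (if p i then X i w else 0) + \sum_(j <- s | p j) X j w.
  by apply/funext => w; rewrite big_cons; case: ifP => //; rewrite add0r.
by apply: L1D => //; case: (p i) (h i) => [/(_ isT)//|_]; exact: L1_cst.
Qed.

Lemma L1_bounded X r : measurable_fun [set: T] X ->
  (forall w, `|X w| <= r) -> L1 X.
Proof. by move=> mX Xr; apply: (L1_le mX Xr); exact: L1_cst. Qed.

Lemma L1_Mbounded X Y r : L1 X -> measurable_fun [set: T] Y ->
  (forall w, `|Y w| <= r) -> L1 (fun w => X w * Y w).
Proof.
move=> iX mY Yr; apply: (@L1_le _ (fun w => `|X w| * r)).
- by apply: measurable_funM => //; exact: L1_meas.
- by move=> w; rewrite normrM ler_wpM2l.
- by apply: L1Zr; exact: L1_abs.
Qed.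

Lemma ExD X Y : L1 X -> L1 Y -> Ex (fun w => X w + Y w) = Ex X + Ex Y.
Proof. by move=> iX iY; rewrite !ExE RintegralD. Qed.

Lemma ExB X Y : L1 X -> L1 Y -> Ex (fun w => X w - Y w) = Ex X - Ex Y.
Proof. by move=> iX iY; rewrite !ExE RintegralB. Qed.

Lemma ExZ r X : L1 X -> Ex (fun w => r * X w) = r * Ex X.
Proof. by move=> iX; rewrite !ExE RintegralZl. Qed.

Lemma ExZr r X : L1 X -> Ex (fun w => X w * r) = Ex X * r.
Proof. by move=> iX; rewrite !ExE RintegralZr. Qed.

Lemma Ex_cst r : Ex (fun _ => r) = r.
Proof. by rewrite /Ex expectation_cst. Qed.

Lemma Ex_sum {I : Type} (s : seq I) (p : pred I) (X : I -> T -> R) :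
  (forall i, p i -> L1 (X i)) ->
  Ex (fun w => \sum_(i <- s | p i) X i w) = \sum_(i <- s | p i) Ex (X i).
Proof.
move=> h; elim: s => [|i s IH].
  rewrite big_nil -[RHS](Ex_cst 0); congr Ex.
  by apply/funext => w; rewrite big_nil.
rewrite big_cons; case: ifP => pi.
  rewrite -IH -ExD; [|exact: h|exact: L1_sum].
  by congr Ex; apply/funext => w; rewrite big_cons pi.
by rewrite -IH; congr Ex; apply/funext => w; rewrite big_cons pi.
Qed.

Lemma Ex_le X Y : L1 X -> L1 Y -> (forall w, X w <= Y w) -> Ex X <= Ex Y.
Proof. by move=> iX iY XY; rewrite !ExE; apply: le_Rintegral => // w _. Qed.

Lemma Ex_ge0 X : (forall w, 0 <= X w) -> 0 <= Ex X.
Proof. by move=> X0; rewrite ExE; exact: Rintegral_ge0. Qed.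

Lemma Ex_abs X : L1 X -> `|Ex X| <= Ex (fun w => `|X w|).
Proof. by move=> iX; rewrite !ExE; exact: le_normr_Rintegral. Qed.

Lemma Ex_abs_le X Y : L1 X -> L1 Y -> (forall w, `|X w| <= Y w) ->
  `|Ex X| <= Ex Y.
Proof.
move=> iX iY XY; apply: le_trans (Ex_abs iX) _.
by apply: Ex_le => //; exact: L1_abs.
Qed.

Lemma EFin_Ex X : L1 X -> (Ex X)%:E = (\int[P]_w (X w)%:E)%E.
Proof.
move=> iX; rewrite ExE /Rintegral fineK//.
exact: integrable_fin_num.
Qed.

(** The inequality of Cauchy and Schwarz against the constant 1, from the mean of
    [2 * s * `|x| <= x ^+ 2 + s ^+ 2]. *)
Lemma Ex_abs_le_sqr X (s : R) : 0 < s -> measurable_fun [set: T] X ->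
  L1 (fun w => X w ^+ 2) -> Ex (fun w => X w ^+ 2) <= s ^+ 2 ->
  L1 X /\ Ex (fun w => `|X w|) <= s.
Proof.
move=> s0 mX iX hX.
have ptw w : `|X w| <= (s^-1 / 2) * X w ^+ 2 + s / 2.
  rewrite -[X w ^+ 2]ger0_norm ?sqr_ge0// normrX.
  rewrite -subr_ge0.
  have -> : s^-1 / 2 * `|X w| ^+ 2 + s / 2 - `|X w| =
      (`|X w| - s) ^+ 2 / (2 * s) by field; lra.
  by rewrite divr_ge0 ?sqr_ge0// mulr_ge0// ltW.
have iL : L1 X.
  by apply: (L1_le mX ptw); apply: L1D; [exact: L1Z|exact: L1_cst].
split=> //.
have := Ex_le (L1_abs iL) (L1D (L1Z (s^-1 / 2) iX) (L1_cst (s / 2))) ptw.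
rewrite ExD; [rewrite ExZ// Ex_cst|exact: L1Z|exact: L1_cst].
move=> /le_trans; apply.
have : s^-1 / 2 * Ex (fun w => X w ^+ 2) <= s^-1 / 2 * s ^+ 2.
  by rewrite ler_wpM2l// divr_ge0// invr_ge0 ltW.
have -> : s^-1 / 2 * s ^+ 2 = s / 2 by field; lra.
lra.
Qed.

End expectation_toolkit.

(** * Independence of functions of disjoint coordinates *)

Section independence.
Set Implicit Arguments.
Context {d : measure_display} {T : measurableType d} {R : realType}.
Context {P : probability T R}.
Variable eps : int -> {RV P >-> R}.

Definition coord_sets (J : set int) : set (set T) :=
  [set A | exists k B, [/\ J k, measurable B & A = eps k @^-1` B]].

(** Two variables adapted to disjoint index sets are independent, so that all
    independence in the sequel is read off index sets. *)
Definition adapted (J : set int) (U : T -> R) : Prop :=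
  measurable_fun [set: g_sigma_algebraType (coord_sets J)]
    (U : g_sigma_algebraType (coord_sets J) -> R).

Lemma coord_setsS (J K : set int) : J `<=` K ->
  <<s coord_sets J >> `<=` <<s coord_sets K >>.
Proof.
move=> JK; apply: smallest_sub; first exact: smallest_sigma_algebra.
move=> A [k [B [Jk mB ->]]]; apply: sub_sigma_algebra.
by exists k, B; split => //; exact: JK.
Qed.

Lemma sigma_coord_measurable J : <<s coord_sets J >> `<=` @measurable _ T.
Proof.
apply: smallest_sub; first exact: sigma_algebra_measurable.
move=> A [k [B [_ mB ->]]]; rewrite -[X in measurable X]setTI.
exact: (@measurable_funP _ _ _ _ _ (eps k)).
Qed.

Lemma adaptedS (J K : set int) U : J `<=` K -> adapted J U -> adapted K U.
Proof.
move=> JK aU mD A mA; apply: (coord_setsS JK).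
exact: (aU measurableT A mA).
Qed.

Lemma adapted_measurable J U : adapted J U -> measurable_fun [set: T] U.
Proof.
move=> aU mD A mA; apply: (@sigma_coord_measurable J).
exact: (aU measurableT A mA).
Qed.

Lemma adapted_preimage J U B : adapted J U -> measurable B ->
  <<s coord_sets J >> (U @^-1` B).
Proof. by move=> aU mB; rewrite -[X in _ X]setTI; exact: (aU measurableT). Qed.

Lemma adapted_eps (J : set int) k : J k -> adapted J (eps k).
Proof.
move=> Jk mD A mA; rewrite setTI; apply: sub_sigma_algebra.
by exists k, A.
Qed.

Lemma adapted_cst J r : adapted J (fun=> r).
Proof. exact: measurable_cst. Qed.

Lemma adapted_comp J U (h : R -> R) : measurable_fun [set: R] h ->
  adapted J U -> adapted J (fun w => h (U w)).
Proof. by move=> mh aU; exact: measurableT_comp. Qed.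

Lemma adaptedD J U V : adapted J U -> adapted J V ->
  adapted J (fun w => U w + V w).
Proof. by move=> aU aV; exact: measurable_funD. Qed.

Lemma adaptedB J U V : adapted J U -> adapted J V ->
  adapted J (fun w => U w - V w).
Proof. by move=> aU aV; exact: measurable_funB. Qed.

Lemma adaptedM J U V : adapted J U -> adapted J V ->
  adapted J (fun w => U w * V w).
Proof. by move=> aU aV; exact: measurable_funM. Qed.

Lemma adapted_abs J U : adapted J U -> adapted J (fun w => `|U w|).
Proof. by apply: adapted_comp; exact: normr_measurable. Qed.

Lemma adapted_sum J (I : Type) (s : seq I) (p : pred I) (U : I -> T -> R) :
  (forall i, p i -> adapted J (U i)) ->
  adapted J (fun w => \sum_(i <- s | p i) U i w).
Proof.
move=> h; elim: s => [|i s IH].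
  have -> : (fun w => \sum_(i <- [::] | p i) U i w) = fun=> 0.
    by apply/funext => w; rewrite big_nil.
  exact: adapted_cst.
have -> : (fun w => \sum_(j <- i :: s | p j) U j w) =
    fun w => (if p i then U i w else 0) + \sum_(j <- s | p j) U j w.
  by apply/funext => w; rewrite big_cons; case: ifP => //; rewrite add0r.
by apply: adaptedD => //; case: (p i) (h i) => [/(_ isT)//|_]; exact: adapted_cst.
Qed.

Hypothesis eps_indep : mutually_independent eps.

(** The finite cylinders: stable by intersection, and the sets for which mutual
    independence is assumed. *)
Definition cylinders (J : set int) : set (set T) :=
  [set A | exists (F : {fset int}) (B : int -> set R),
    [/\ forall k, k \in F -> J k, forall k, k \in F -> measurable (B k) &
        A = \bigcap_(k in [set` F]) eps k @^-1` B k]].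

Lemma cylinders_setI J : setI_closed (cylinders J).
Proof.
move=> _ _ [F1 [B1 [J1 m1 ->]]] [F2 [B2 [J2 m2 ->]]].
exists (F1 `|` F2)%fset, (fun k => (if k \in F1 then B1 k else setT) `&`
  (if k \in F2 then B2 k else setT)); split.
- by move=> k; rewrite in_fsetU => /orP[/J1|/J2].
- by move=> k _; apply: measurableI; case: ifPn => // h; [exact: m1|exact: m2].
- apply/seteqP; split => w /=.
    move=> [h1 h2] k /=; rewrite in_fsetU => _; split; case: ifPn => // kF.
      exact: h1.
    exact: h2.
  move=> h; split => k /= kF; have := h k; rewrite /= in_fsetU kF ?orbT.
    by move=> /(_ isT)[].
  by move=> /(_ isT)[].
Qed.

Lemma coord_sets_cylinders J : coord_sets J `<=` cylinders J.
Proof.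
move=> A [k [B [Jk mB ->]]]; exists [fset k]%fset, (fun=> B); split => //.
- by move=> k'; rewrite in_fset1 => /eqP ->.
- apply/seteqP; split => w /= h; last by apply: h => /=; rewrite in_fset1.
  by move=> k' /=; rewrite in_fset1 => /eqP ->.
Qed.

Lemma cylinders_measurable J : cylinders J `<=` @measurable _ T.
Proof.
move=> _ [F [B [_ mB ->]]]; apply: fin_bigcap_measurable.
  exact: finite_fset.
move=> k kF; rewrite -[X in measurable X]setTI.
by apply: (@measurable_funP _ _ _ _ _ (eps k)) => //; exact: mB.
Qed.

Lemma cylinders_indep (J K : set int) A B : J `&` K = set0 ->
  cylinders J A -> cylinders K B -> P (A `&` B) = (P A * P B)%E.
Proof.
move=> JK [F1 [B1 [J1 m1 ->]]] [F2 [B2 [J2 m2 ->]]].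
have dis k : k \in F1 -> k \in F2 -> False.
  by move=> /J1 Jk /J2 Kk; have : (J `&` K) k by []; rewrite JK.
have -> : \bigcap_(k in [set` F1]) eps k @^-1` B1 k `&`
    \bigcap_(k in [set` F2]) eps k @^-1` B2 k =
    \bigcap_(k in [set` (F1 `|` F2)%fset])
      eps k @^-1` (if k \in F1 then B1 k else B2 k).
  apply/seteqP; split => w /=.
    move=> [h1 h2] k /=; rewrite in_fsetU => /orP[] kF.
      by rewrite kF; exact: h1.
    by case: ifPn => kF1; [exact: h1|exact: h2].
  move=> h; split => k /= kF; have := h k; rewrite /= in_fsetU kF ?orbT.
    exact.
  by case: ifPn => [/dis/(_ kF)//|_]; exact.
rewrite eps_indep; last first.
  move=> k; rewrite in_fsetU => /orP[] kF.
    by rewrite kF; exact: m1.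
  by case: ifPn => kF1; [exact: m1|exact: m2].
rewrite eps_indep// eps_indep//.
have pe : perm_eq (F1 `|` F2)%fset (enum_fset F1 ++ enum_fset F2).
  apply: uniq_perm; first exact: fset_uniq.
    rewrite cat_uniq !fset_uniq andbT/=; apply/hasPn => k kF2.
    by apply/negP => kF1; exact: (dis k).
  by move=> k; rewrite mem_cat in_fsetU.
rewrite (perm_big _ pe) big_cat/=; congr (_ * _)%E.
  by apply: eq_big_seq => k kF; rewrite kF.
by apply: eq_big_seq => k kF; case: ifPn => // /dis/(_ kF).
Qed.

(** Finite measures that agree on the cylinders agree on the sigma-algebra that
    they generate. *)
Lemma sigma_extend J (m1 m2 : {measure set T -> \bar R}) :
  (m1 setT < +oo)%E -> (forall A, cylinders J A -> m1 A = m2 A) ->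
  forall A, <<s coord_sets J >> A -> m1 A = m2 A.
Proof.
move=> m1oo m12 A sA.
have cT : cylinders J setT.
  exists fset0, (fun=> setT); split => //.
  by apply/seteqP; split => // w _ k /=; rewrite in_fset0.
have E : [set X | cylinders J X /\ X `<=` setT] = cylinders J.
  by apply/seteqP; split => X; [case|split].
apply: (@g_sigma_algebra_measure_unique_trace _ _ _ (cylinders J) setT) => //.
- by rewrite E; exact: cylinders_measurable.
- by rewrite E; exact: cylinders_setI.
- exact: m12.
- by rewrite E.
- rewrite E; move: A sA; apply: smallest_sub.
    exact: smallest_sigma_algebra.
  by move=> A /coord_sets_cylinders cA; exact: sub_sigma_algebra.
Qed.

(** Both sides are finite measures in each of the two sets, so the product formula
    is extended from cylinders in one set at a time. *)
Lemma sigma_indep (J K : set int) A B : J `&` K = set0 ->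
  <<s coord_sets J >> A -> <<s coord_sets K >> B ->
  P (A `&` B) = (P A * P B)%E.
Proof.
move=> JK sA sB.
have step1 (C : set T) : cylinders K C -> P (A `&` C) = (P A * P C)%E.
  move=> cC; have mC := cylinders_measurable cC.
  have Pr : 0 <= fine (P C) by exact: fine_ge0.
  have PE : P C = (fine (P C))%:E by rewrite fineK// fin_num_measure.
  rewrite [RHS]muleC PE.
  apply: (@sigma_extend J (mrestr P mC) (mscale (NngNum Pr) P) _ _ A sA).
    rewrite /= /mrestr setTI.
    by exact: le_lt_trans (probability_le1 P mC) (ltry _).
  move=> D cD; rewrite /= /mrestr (cylinders_indep JK cD cC) muleC.
  by rewrite {1}PE.
have mA := sigma_coord_measurable sA.
have Pr : 0 <= fine (P A) by exact: fine_ge0.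
have PE : P A = (fine (P A))%:E by rewrite fineK// fin_num_measure.
rewrite setIC PE.
apply: (@sigma_extend K (mrestr P mA) (mscale (NngNum Pr) P) _ _ B sB).
  rewrite /= /mrestr setTI.
  by exact: le_lt_trans (probability_le1 P mA) (ltry _).
by move=> D cD; rewrite /= /mrestr setIC step1// {1}PE.
Qed.

Local Open Scope ereal_scope.

(** The joint law is the product of the marginal laws, and Tonelli's theorem
    applies to the product of the absolute values of the two coordinates, which
    is nonnegative on the whole plane and agrees with [U * V]. *)
Lemma ge0_integral_indepM (J K : set int) (U V : T -> R) : J `&` K = set0 ->
  adapted J U -> adapted K V -> (forall w, 0 <= U w)%R ->
  (forall w, 0 <= V w)%R ->
  \int[P]_w (U w * V w)%:E = \int[P]_w (U w)%:E * \int[P]_w (V w)%:E.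
Proof.
move=> JK aU aV U0 V0.
have mU := adapted_measurable aU; have mV := adapted_measurable aV.
pose U' : {mfun T >-> R} := HB.pack U (isMeasurableFun.Build _ _ _ _ U mU).
pose V' : {mfun T >-> R} := HB.pack V (isMeasurableFun.Build _ _ _ _ V mV).
have mUV : measurable_fun [set: T] (fun w => (U w, V w)).
  exact: measurable_fun_pair.
pose UV : {mfun T >-> (R * R)%type} :=
  HB.pack (fun w => (U w, V w)) (isMeasurableFun.Build _ _ _ _ _ mUV).
pose mu1 := distribution P U'; pose mu2 := distribution P V'.
pose mu := distribution P UV.
have muE X : measurable X -> (mu1 \x mu2) X = mu X.
  apply: product_measure_unique => A B mA mB.
  exact: (sigma_indep JK (adapted_preimage aU mA) (adapted_preimage aV mB)).
pose f (z : R * R) := (`|z.1| * `|z.2|)%:E.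
have mf : measurable_fun [set: R * R] f.
  apply/measurable_EFinP/measurable_funM => //.
    by apply: measurableT_comp => //; exact: measurable_fst.
  by apply: measurableT_comp => //; exact: measurable_snd.
have f0 z : 0 <= f z by rewrite lee_fin.
transitivity (\int[mu]_z f z).
  rewrite ge0_integral_distribution//; apply: eq_integral => w _ /=.
  by rewrite /f/= !ger0_norm.
transitivity (\int[mu1 \x mu2]_z f z).
  by apply: eq_measure_integral => A mA _; apply: esym; exact: muE.
rewrite fubini_tonelli1// /fubini_F/=.
transitivity (\int[mu1]_x (`|x|%:E * \int[P]_w (V w)%:E)).
  apply: eq_integral => x _; rewrite /f/=.
  under eq_integral do rewrite EFinM.
  rewrite ge0_integralZl//; last first.
    by apply/measurable_EFinP; exact: normr_measurable.
  congr (_ * _); rewrite ge0_integral_distribution//; last first.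
    by apply/measurable_EFinP; exact: normr_measurable.
  by apply: eq_integral => w _ /=; rewrite ger0_norm.
rewrite ge0_integralZr//; last 2 first.
- by apply/measurable_EFinP; exact: normr_measurable.
- by apply: integral_ge0 => w _; rewrite lee_fin.
congr (_ * _); rewrite ge0_integral_distribution//; last first.
  by apply/measurable_EFinP; exact: normr_measurable.
by apply: eq_integral => w _ /=; rewrite ger0_norm.
Qed.

Local Close Scope ereal_scope.

Lemma L1_indepM (J K : set int) (U V : T -> R) : J `&` K = set0 ->
  adapted J U -> adapted K V -> L1 P U -> L1 P V ->
  L1 P (fun w => U w * V w).
Proof.
move=> JK aU aV iU iV; apply/integrableP; split.
  by apply/measurable_EFinP/measurable_funM; [exact: (L1_meas iU)|exact: (L1_meas iV)].
rewrite /=; under eq_integral do rewrite normrM.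
rewrite (ge0_integral_indepM JK (adapted_abs aU) (adapted_abs aV))//.
by rewrite -(EFin_Ex (L1_abs iU)) -(EFin_Ex (L1_abs iV)) -EFinM ltry.
Qed.

(** Each factor is the difference of [`|U|] and [`|U| - U], which reduces the
    statement to nonnegative factors. *)
Lemma Ex_indepM (J K : set int) (U V : T -> R) : J `&` K = set0 ->
  adapted J U -> adapted K V -> L1 P U -> L1 P V ->
  Ex P (fun w => U w * V w) = Ex P U * Ex P V.
Proof.
move=> JK.
have pos (U' V' : T -> R) : adapted J U' -> adapted K V' -> L1 P U' ->
    L1 P V' -> (forall w, 0 <= U' w) -> (forall w, 0 <= V' w) ->
    Ex P (fun w => U' w * V' w) = Ex P U' * Ex P V'.
  move=> aU aV iU iV U0 V0; apply: EFin_inj.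
  rewrite EFinM !EFin_Ex//; last exact: (L1_indepM JK aU aV).
  exact: (ge0_integral_indepM JK aU aV).
have sgn (U' V' : T -> R) : adapted J U' -> adapted K V' -> L1 P U' ->
    L1 P V' -> (forall w, 0 <= U' w) ->
    Ex P (fun w => U' w * V' w) = Ex P U' * Ex P V'.
  move=> aU aV iU iV U0.
  have aA := adapted_abs aV; have iA := L1_abs iV.
  have aB := adaptedB aA aV; have iB := L1B iA iV.
  have B0 w : 0 <= `|V' w| - V' w by rewrite subr_ge0 ler_norm.
  have hB := pos _ _ aU aB iU iB U0 B0.
  have hA := pos _ _ aU aA iU iA U0 (fun w => normr_ge0 (V' w)).
  have E : Ex P (fun w => U' w * V' w) = Ex P (fun w => U' w * `|V' w|) -
      Ex P (fun w => U' w * (`|V' w| - V' w)).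
    rewrite -ExB; [|exact: (L1_indepM JK aU aA)|exact: (L1_indepM JK aU aB)].
    by congr Ex; apply/funext => w; rewrite mulrBr opprB addrC subrK.
  by rewrite E hA hB ExB// mulrBr opprB addrC subrK.
move=> aU aV iU iV.
have aA := adapted_abs aU; have iA := L1_abs iU.
have aB := adaptedB aA aU; have iB := L1B iA iU.
have B0 w : 0 <= `|U w| - U w by rewrite subr_ge0 ler_norm.
have hB := sgn _ _ aB aV iB iV B0.
have hA := sgn _ _ aA aV iA iV (fun w => normr_ge0 (U w)).
have E : Ex P (fun w => U w * V w) = Ex P (fun w => `|U w| * V w) -
    Ex P (fun w => (`|U w| - U w) * V w).
  rewrite -ExB; [|exact: (L1_indepM JK aA aV)|exact: (L1_indepM JK aB aV)].
  by congr Ex; apply/funext => w; rewrite mulrBl opprB addrC subrK.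
by rewrite E hA hB ExB// mulrBl opprB addrC subrK.
Qed.

End independence.

(** * A peak, its primitive and a ramp *)

Section test_functions.
Set Implicit Arguments.
Unset Strict Implicit.
Context {R : realType}.
Implicit Types x w v : R.

(** The derivative of [softsign].  It decreases so slowly that its increments are
    controlled by its own values ([kap_lip]); an indicator has no such property,
    and this is what lets concentration estimates be proved by induction. *)
Definition kap x : R := ((1 + `|x|) ^+ 2)^-1.

(** The bounded primitive of [kap], the test function of the concentration
    inequality. *)
Definition softsign x : R := x / (1 + `|x|).

(** A Lipschitz substitute for the indicator of the negative half-line. *)
Definition ramp x : R := Num.min 1 (Num.max 0 (1 - x)).

Lemma kap_gt0 x : 0 < kap x.
Proof. by rewrite invr_gt0 exprn_gt0// ltr_pwDl. Qed.

Lemma kap_ge0 x : 0 <= kap x.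
Proof. exact/ltW/kap_gt0. Qed.

Lemma kap_le1 x : kap x <= 1.
Proof. by rewrite invf_le1 ?exprn_ege1 ?exprn_gt0 ?ltr_pwDl// lerDl. Qed.

Lemma normr_kap_le1 x : `|kap x| <= 1.
Proof. by rewrite ger0_norm ?kap_ge0 ?kap_le1. Qed.

Lemma kap_lip x w : `|kap x - kap w| <= `|x - w| * (kap x + kap w).
Proof.
have px : 0 < 1 + `|x| by rewrite ltr_pwDl.
have pw : 0 < 1 + `|w| by rewrite ltr_pwDl.
set p := 1 + `|x| in px; set q := 1 + `|w| in pw.
have -> : kap x - kap w = (q - p) * (p + q) * (p ^- 2 * q ^- 2).
  by rewrite /kap -/p -/q; field; rewrite !gt_eqF.
have c0 : 0 <= p ^- 2 * q ^- 2 by rewrite mulr_ge0// invr_ge0 exprn_ge0// ltW.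
have pq0 : 0 < p + q by rewrite addr_gt0.
rewrite normrM (ger0_norm c0) normrM (gtr0_norm pq0) -mulrA.
have -> : kap x + kap w = (p ^+ 2 + q ^+ 2) * (p ^- 2 * q ^- 2).
  by rewrite /kap -/p -/q; field; rewrite !gt_eqF.
have qp : `|q - p| <= `|x - w|.
  have -> : q - p = `|w| - `|x| by rewrite /p /q; ring.
  by rewrite (distrC x) ler_dist_dist.
apply: ler_pM => //; first by rewrite mulr_ge0// ltW.
apply: ler_wpM2r => //.
have p1 : 1 <= p by rewrite lerDl.
have q1 : 1 <= q by rewrite lerDl.
by rewrite lerD// expr2 ler_peMl// ltW.
Qed.

Lemma softsign_le1 x : `|softsign x| <= 1.
Proof.
rewrite normrM normfV (@ger0_norm _ (1 + `|x|))// ?addr_ge0//.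
by rewrite ler_pdivrMr ?ltr_pwDl// mul1r lerDr.
Qed.

Lemma softsignN x : softsign (- x) = - softsign x.
Proof. by rewrite /softsign normrN mulNr. Qed.

Lemma kapN x : kap (- x) = kap x.
Proof. by rewrite /kap normrN. Qed.

(** A Taylor formula whose error is proportional to [kap x]: evaluated at the full
    sum, the error is again a concentration quantity. *)
Lemma softsign_taylor x w :
  `|softsign x - softsign w - (x - w) * kap x| <= 2 * (x - w) ^+ 2 * kap x.
Proof.
wlog x0 : x w / 0 <= x.
  move=> H; have [/H//|x0] := leP 0 x.
  have := H (- x) (- w); rewrite oppr_ge0 (ltW x0) => /(_ isT).
  rewrite !softsignN kapN -[in X in X <= _]normrN.
  have -> : - (- softsign x - - softsign w - (- x - - w) * kap x) =
    softsign x - softsign w - (x - w) * kap x by ring.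
  by have -> : (- x - - w) ^+ 2 = (x - w) ^+ 2 by ring.
have px : 0 < 1 + x by rewrite ltr_pwDl.
rewrite /softsign /kap (ger0_norm x0).
have [w0|w0] := leP 0 w.
  rewrite (ger0_norm w0); have pw : 0 < 1 + w by rewrite ltr_pwDl.
  have -> : x / (1 + x) - w / (1 + w) - (x - w) / (1 + x) ^+ 2 =
    (x - w) ^+ 2 * (1 + x) ^- 2 * (1 + w)^-1.
    by field; rewrite !gt_eqF.
  have A0 : 0 <= (x - w) ^+ 2 * (1 + x) ^- 2.
    by rewrite mulr_ge0 ?sqr_ge0// invr_ge0 sqr_ge0.
  have w1 : (1 + w)^-1 <= 1 by rewrite invf_le1// lerDl.
  have w1' : 0 <= (1 + w)^-1 by rewrite invr_ge0 ltW.
  have N0 : 0 <= (x - w) ^+ 2 * (1 + x) ^- 2 * (1 + w)^-1 by rewrite mulr_ge0.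
  rewrite (ger0_norm N0).
  apply: (@le_trans _ _ ((x - w) ^+ 2 * (1 + x) ^- 2)); first by rewrite ler_piMr.
  by rewrite -mulrA mulr_natl mulr2n lerDl.
rewrite (ltr0_norm w0).
have [s ws] : exists s, w = - s by exists (- w); rewrite opprK.
rewrite ws oppr_lt0 in w0 *; rename w0 into s0; rewrite [in 1 + - - s]opprK.
have ps : 0 < 1 + s by rewrite addr_gt0.
have -> : x / (1 + x) - - s / (1 + s) - (x - - s) / (1 + x) ^+ 2 =
  (x ^+ 2 + 2 * x * s - s ^+ 2 + 2 * s * x ^+ 2) * ((1 + x) ^- 2 * (1 + s)^-1).
  by field; rewrite !gt_eqF.
have -> : 2 * (x - - s) ^+ 2 / (1 + x) ^+ 2 =
   (2 * (x + s) ^+ 2 * (1 + s)) * ((1 + x) ^- 2 * (1 + s)^-1).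
  by field; rewrite !gt_eqF.
have A0 : 0 <= (1 + x) ^- 2 * (1 + s)^-1.
  by rewrite mulr_ge0// invr_ge0 ?sqr_ge0// ltW.
rewrite normrM (ger0_norm A0) ler_wpM2r//.
have xs : 0 <= x * s by rewrite mulr_ge0// ltW.
have sx2 : 0 <= s * x ^+ 2 by rewrite mulr_ge0 ?sqr_ge0// ltW.
have s3 : 0 <= s ^+ 3 by rewrite exprn_ge0// ltW.
have xs2 : 0 <= x * s ^+ 2 by rewrite mulr_ge0 ?sqr_ge0.
have x2 := sqr_ge0 x; have s2 := sqr_ge0 s.
have -> : 2 * (x + s) ^+ 2 * (1 + s) = 2 * x ^+ 2 + 4 * (x * s) + 2 * s ^+ 2 +
  2 * (s * x ^+ 2) + 4 * (x * s ^+ 2) + 2 * s ^+ 3 by ring.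
have -> : x ^+ 2 + 2 * x * s - s ^+ 2 + 2 * s * x ^+ 2 =
   x ^+ 2 + 2 * (x * s) - s ^+ 2 + 2 * (s * x ^+ 2) by ring.
rewrite ler_norml; apply/andP; split; lra.
Qed.

Lemma ramp_ge0 x : 0 <= ramp x.
Proof. by rewrite /ramp le_min ler01 le_max lexx. Qed.

Lemma ramp_le1 x : ramp x <= 1.
Proof. by rewrite /ramp ge_min lexx. Qed.

Lemma ramp1 x : x <= 0 -> ramp x = 1.
Proof.
by move=> x0; apply/min_idPl; rewrite le_max; apply/orP; right; lra.
Qed.

Lemma ramp0 x : 1 <= x -> ramp x = 0.
Proof.
move=> x1; rewrite /ramp (_ : Num.max 0 (1 - x) = 0); last by apply/max_idPl; lra.
by apply/min_idPr; lra.
Qed.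

Lemma ramp_mid x : 0 <= x <= 1 -> ramp x = 1 - x.
Proof.
move=> /andP[x0 x1]; rewrite /ramp (_ : Num.max 0 (1 - x) = 1 - x).
  by apply/min_idPr; lra.
by apply/max_idPr; lra.
Qed.

Lemma ramp_nincr x w : x <= w -> ramp w <= ramp x.
Proof.
move=> xw.
have [x0|x0] := leP x 0; first by rewrite (ramp1 x0) ramp_le1.
have [w1|w1] := leP 1 w; first by rewrite (ramp0 w1) ramp_ge0.
rewrite !ramp_mid; [lra|lra|lra].
Qed.

Lemma ramp_lip x w : `|ramp x - ramp w| <= `|x - w|.
Proof.
wlog xw : x w / x <= w.
  move=> H; have [/H//|/ltW/H] := leP x w.
  by rewrite distrC (distrC x).
have h := ramp_nincr xw.
rewrite ger0_norm ?subr_ge0// distrC ger0_norm ?subr_ge0//.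
have [x0|x0] := leP x 0; have [w1|w1] := leP 1 w.
- rewrite (ramp1 x0) (ramp0 w1); lra.
- rewrite (ramp1 x0); have [w0|w0] := leP w 0; first by rewrite ramp1//; lra.
  rewrite ramp_mid; lra.
- rewrite (ramp0 w1); have [x1|x1] := leP 1 x; first by rewrite ramp0//; lra.
  rewrite ramp_mid; lra.
- rewrite !ramp_mid; lra.
Qed.

Lemma continuous_ramp : continuous ramp.
Proof.
move=> x; apply/cvgrPdist_le => e e0; near=> y.
apply: le_trans (ramp_lip x y) _.
by near: y; apply: cvgr_dist_le => //; exact: cvg_id.
Unshelve. all: by end_near. Qed.

(** Away from infinity the peak is bounded below, so it dominates any bounded
    function with bounded support; this gives [ramp_step] and [ramp_indic]. *)
Lemma kap_lb x r : 0 <= r -> `|x| <= r -> ((1 + r) ^+ 2)^-1 <= kap x.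
Proof.
move=> r0 xr; rewrite lef_pV2 ?posrE ?exprn_gt0 ?ltr_pwDl//.
by rewrite ler_pXn2r ?nnegrE ?addr_ge0// lerD2l.
Qed.

Lemma ramp_step x v : `|v| <= 1 ->
  `|ramp (x + v) - ramp x| <= 9 * (`|v| * kap x).
Proof.
move=> v1; have [x2|x2] := leP `|x| 2.
  apply: le_trans (ramp_lip _ _) _.
  have -> : x + v - x = v by ring.
  have := kap_lb (ler0n R 2) x2.
  have -> : (1 + 2 : R) ^+ 2 = 9 by ring.
  have := normr_ge0 v => v0 h.
  have : `|v| * 9^-1 <= `|v| * kap x by rewrite ler_wpM2l.
  lra.
suff -> : ramp (x + v) = ramp x.
  by rewrite subrr normr0 !mulr_ge0 ?kap_ge0.
move: v1 x2; rewrite ler_norml => /andP[va vb].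
have [x0|x0] := leP 0 x.
  by rewrite ger0_norm// => x2; rewrite !ramp0//; lra.
by rewrite ltr0_norm// => x2; rewrite !ramp1//; lra.
Qed.

Lemma ramp_indic x : `|(x < 0)%R%:R - ramp x| <= 4 * kap x.
Proof.
have k4 : 0 <= 4 * kap x by rewrite mulr_ge0 ?kap_ge0.
have [x0|x0] := ltP x 0.
  by rewrite (ramp1 (ltW x0)) subrr normr0.
have [x1|x1] := leP 1 x; first by rewrite (ramp0 x1) subrr normr0.
rewrite sub0r normrN ger0_norm ?ramp_ge0//.
have := @kap_lb x 1 ler01; rewrite ger0_norm// => /(_ (ltW x1)).
have -> : (1 + 1 : R) ^+ 2 = 4 by ring.
have := ramp_le1 x; lra.
Qed.

Lemma continuous_kap : continuous kap.
Proof.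
move=> x; apply: cvgV; first by rewrite expf_neq0// gt_eqF// ltr_pwDl.
apply: (@cvg_comp _ _ _ (fun y : R => 1 + `|y|) (fun y : R => y ^+ 2)).
  apply: cvgD; [exact: cvg_cst|exact: (@norm_continuous _ R^o)].
exact: exprn_continuous.
Qed.

Lemma continuous_softsign : continuous softsign.
Proof.
move=> x; apply: cvgM; first exact: cvg_id.
apply: cvgV; first by rewrite gt_eqF// ltr_pwDl.
apply: cvgD; [exact: cvg_cst|exact: (@norm_continuous _ R^o)].
Qed.

Lemma measurable_kap : measurable_fun [set: R] kap.
Proof. exact: continuous_measurable_fun continuous_kap. Qed.

Lemma measurable_softsign : measurable_fun [set: R] softsign.
Proof. exact: continuous_measurable_fun continuous_softsign. Qed.

Lemma measurable_ramp : measurable_fun [set: R] ramp.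
Proof. exact: continuous_measurable_fun continuous_ramp. Qed.

End test_functions.

Section ramp_increment.
Set Implicit Arguments.
Unset Strict Implicit.
Context {d : measure_display} {T : measurableType d} {R : realType}.
Variable P : probability T R.

(** Cut the increment [u] in [N] pieces of length at most one, to which [ramp_step]
    applies; when [N < `|u|] the last term exceeds 1, which bounds any increment
    of the ramp. *)
Lemma ramp_telescope (z u : R) (N : nat) : (0 < N)%N ->
  `|ramp (z + u) - ramp z| <=
  9 / N%:R * (\sum_(0 <= k < N) `|u| * kap (z + k%:R / N%:R * u)) +
  `|u| / N%:R.
Proof.
move=> N0; have N0' : (0 : R) < N%:R by rewrite ltr0n.
have sum0 : 0 <= \sum_(0 <= k < N) `|u| * kap (z + k%:R / N%:R * u).
  by apply: sumr_ge0 => k _; rewrite mulr_ge0 ?kap_ge0.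
have [uN|uN] := leP `|u| N%:R; last first.
  apply: (@le_trans _ _ 1).
    have := ramp_ge0 z; have := ramp_ge0 (z + u).
    have := ramp_le1 z; have := ramp_le1 (z + u).
    by rewrite ler_norml => *; apply/andP; split; lra.
  apply: (@le_trans _ _ (`|u| / N%:R)); first by rewrite ler_pdivlMr ?mul1r ?ltW.
  by rewrite lerDr mulr_ge0// divr_ge0.
apply: (@le_trans _ _ (9 / N%:R *
    \sum_(0 <= k < N) `|u| * kap (z + k%:R / N%:R * u))); last first.
  by rewrite lerDl divr_ge0.
have -> : ramp (z + u) - ramp z =
    \sum_(0 <= k < N) (ramp (z + k.+1%:R / N%:R * u) - ramp (z + k%:R / N%:R * u)).
  rewrite (telescope_sumr (fun k => ramp (z + k%:R / N%:R * u)))//.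
  by rewrite divff ?gt_eqF// mul1r mul0r mul0r addr0.
rewrite mulr_sumr; apply: le_trans (ler_norm_sum _ _ _) _.
apply: ler_sum => k _.
have -> : z + k.+1%:R / N%:R * u = z + k%:R / N%:R * u + u / N%:R.
  by rewrite -(addn1 k) natrD; ring.
have v1 : `|u / N%:R| <= 1.
  by rewrite normrM normfV (@ger0_norm _ N%:R)// ler_pdivrMr// mul1r.
apply: le_trans (ramp_step _ v1) _.
rewrite normrM normfV (@ger0_norm _ N%:R)//.
by rewrite le_eqVlt; apply/orP; left; apply/eqP; ring.
Qed.

(** An increment of the ramp is at most [9 * `|u|] times the mean of the peak along
    the segment from [z] to [z + u].  The mean is over [N] equally spaced points,
    with [N] going to infinity, which takes the place of an integral over [th]. *)
Lemma Ex_ramp_increment (om z u : T -> R) (K : R) :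
  (forall w, 0 <= om w) -> L1 P om ->
  measurable_fun [set: T] z -> measurable_fun [set: T] u ->
  L1 P (fun w => om w * `|u w|) ->
  (forall th, Ex P (fun w => om w * `|u w| * kap (z w + th * u w)) <= K) ->
  Ex P (fun w => om w * `|ramp (z w + u w) - ramp (z w)|) <= 9 * K.
Proof.
move=> om0 iom mz mu iu hK.
have iD : L1 P (fun w => om w * `|ramp (z w + u w) - ramp (z w)|).
  apply: (@L1_Mbounded _ _ _ _ _ _ 1) => //.
    apply: measurableT_comp => //; apply: measurable_funB.
      apply: (measurableT_comp measurable_ramp); exact: measurable_funD.
    exact: (measurableT_comp measurable_ramp).
  move=> w; rewrite normr_id.
  have := ramp_ge0 (z w); have := ramp_ge0 (z w + u w).
  have := ramp_le1 (z w); have := ramp_le1 (z w + u w).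
  by rewrite ler_norml => *; apply/andP; split; lra.
have ik th : L1 P (fun w => om w * `|u w| * kap (z w + th * u w)).
  apply: (@L1_Mbounded _ _ _ _ _ _ 1) => //; last by move=> w; exact: normr_kap_le1.
  apply: (measurableT_comp measurable_kap); apply: measurable_funD => //.
  exact: measurable_funM.
have main N : (0 < N)%N -> Ex P (fun w => om w * `|ramp (z w + u w) - ramp (z w)|)
    <= 9 * K + Ex P (fun w => om w * `|u w|) / N%:R.
  move=> N0; have N0' : (0 : R) < N%:R by rewrite ltr0n.
  pose f w := 9 / N%:R * (\sum_(0 <= k < N)
    om w * `|u w| * kap (z w + k%:R / N%:R * u w)) + om w * `|u w| / N%:R.
  have isum : L1 P (fun w => \sum_(0 <= k < N)
    om w * `|u w| * kap (z w + k%:R / N%:R * u w)) by exact: L1_sum.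
  have if_ : L1 P f by apply: L1D; [exact: L1Z|exact: L1Zr].
  apply: (@le_trans _ _ (Ex P f)).
    apply: Ex_le => // w; rewrite /f.
    have := ler_wpM2l (om0 w) (ramp_telescope (z w) (u w) N0).
    move=> /le_trans; apply; rewrite le_eqVlt; apply/orP; left; apply/eqP.
    rewrite mulrDr mulrA (mulrC (om w)) -!mulrA; congr (_ + _).
    congr (_ * (_ * _)); rewrite mulr_sumr; apply: eq_bigr => k _.
    by rewrite !mulrA.
  rewrite ExD; [|exact: L1Z|exact: L1Zr].
  rewrite ExZ// ExZr// Ex_sum// lerD2r.
  apply: (@le_trans _ _ (9 / N%:R * \sum_(0 <= k < N) K)).
    by rewrite ler_wpM2l ?divr_ge0//; apply: ler_sum.
  rewrite sumr_const_nat subn0 -mulr_natr.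
  by rewrite le_eqVlt; apply/orP; left; apply/eqP; field; rewrite gt_eqF.
apply/ler_addgt0Pr => e e0.
set c := Ex P (fun w => om w * `|u w|) in main.
have c0 : 0 <= c by apply: Ex_ge0 => w; rewrite mulr_ge0.
pose N := (Num.truncn (c / e)).+1.
apply: le_trans (main N _) _ => //; rewrite lerD2l ler_pdivrMr ?ltr0n//.
have : c / e < N%:R by exact: truncnS_gt.
by rewrite ltr_pdivrMr// mulrC => /ltW.
Qed.

End ramp_increment.

(** * Block sums of windowed variables *)

Section windows.
Set Implicit Arguments.
Unset Strict Implicit.
Context {d : measure_display} {T : measurableType d} {R : realType}.
Context {P : probability T R}.
Variables (eps : int -> {RV P >-> R}) (pos : nat -> int).
Hypothesis eps_indep : mutually_independent eps.
Hypothesis pos_inj : injective pos.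

(** Adaptedness in terms of labels in [nat], the noise with label [k] being
    [eps (pos k)]: index computations then involve natural numbers only. *)
Definition ad (A : set nat) (U : T -> R) : Prop := adapted eps (pos @` A) U.

Lemma adS (A B : set nat) U : (forall k, A k -> B k) -> ad A U -> ad B U.
Proof. by move=> AB; apply: adaptedS; exact: image_subset. Qed.

Lemma ad_meas A U : ad A U -> measurable_fun [set: T] U.
Proof. exact: adapted_measurable. Qed.

Lemma ad_sum_nat A a b (U : nat -> T -> R) :
  (forall j, (a <= j < b)%N -> ad A (U j)) ->
  ad A (fun w => \sum_(a <= j < b) U j w).
Proof.
move=> h; have -> : (fun w => \sum_(a <= j < b) U j w) =
    fun w => \sum_(a <= j < b | (a <= j < b)%N) U j w.
  by apply/funext => w; rewrite big_nat.
exact: adapted_sum.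
Qed.

Lemma ad_disjoint (A B : set nat) : (forall k, A k -> B k -> False) ->
  pos @` A `&` pos @` B = set0.
Proof.
move=> AB; apply/seteqP; split => // _ [[i Ai <-] [j Bj /pos_inj ji]].
by apply: (AB i) => //; rewrite -ji.
Qed.

Lemma L1_adM (A B : set nat) U V : (forall k, A k -> B k -> False) ->
  ad A U -> ad B V -> L1 P U -> L1 P V -> L1 P (fun w => U w * V w).
Proof. by move=> /ad_disjoint; exact: L1_indepM. Qed.

Lemma Ex_adM (A B : set nat) U V : (forall k, A k -> B k -> False) ->
  ad A U -> ad B V -> L1 P U -> L1 P V ->
  Ex P (fun w => U w * V w) = Ex P U * Ex P V.
Proof. by move=> /ad_disjoint; exact: Ex_indepM. Qed.

End windows.

Section moments.
Set Implicit Arguments.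
Unset Strict Implicit.
Context {d : measure_display} {T : measurableType d} {R : realType}.
Variable P : probability T R.
Variables (X : nat -> T -> R) (M : R).
Hypothesis X_meas : forall j, measurable_fun [set: T] (X j).
Hypothesis M_ge1 : 1 <= M.
Hypothesis X_L3 : forall j, L1 P (fun w => `|X j w| ^+ 3).
Hypothesis X_M3 : forall j, Ex P (fun w => `|X j w| ^+ 3) <= M.

Definition seg (a b : nat) (w : T) : R := \sum_(a <= j < b) X j w.
Definition absseg (a b : nat) (w : T) : R := \sum_(a <= j < b) `|X j w|.

Lemma mul3_le_cubes (x y z : R) : 0 <= x -> 0 <= y -> 0 <= z ->
  x * y * z <= 3^-1 * (x ^+ 3 + y ^+ 3 + z ^+ 3).
Proof.
move=> x0 y0 z0; rewrite -subr_ge0.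
have -> : 3^-1 * (x ^+ 3 + y ^+ 3 + z ^+ 3) - x * y * z = 6^-1 *
  ((x + y + z) * ((x - y) ^+ 2 + (y - z) ^+ 2 + (z - x) ^+ 2)) by field.
by rewrite mulr_ge0 ?invr_ge0// mulr_ge0 ?addr_ge0 ?sqr_ge0.
Qed.

(** Hoelder's inequality for three factors whose third moments share the bound [M]:
    the inequality between arithmetic and geometric means gives it.  Taking
    some factors equal to 1 gives the lower moments. *)
Let cube_bound (U V W : T -> R) : measurable_fun [set: T] U ->
  measurable_fun [set: T] V -> measurable_fun [set: T] W ->
  L1 P (fun w => `|U w| ^+ 3) -> L1 P (fun w => `|V w| ^+ 3) ->
  L1 P (fun w => `|W w| ^+ 3) ->
  Ex P (fun w => `|U w| ^+ 3) <= M -> Ex P (fun w => `|V w| ^+ 3) <= M ->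
  Ex P (fun w => `|W w| ^+ 3) <= M ->
  L1 P (fun w => `|U w| * `|V w| * `|W w|) /\
  Ex P (fun w => `|U w| * `|V w| * `|W w|) <= M.
Proof.
move=> mU mV mW iU iV iW hU hV hW.
have ib : L1 P (fun w => 3^-1 * (`|U w| ^+ 3 + `|V w| ^+ 3 + `|W w| ^+ 3)).
  by apply: L1Z; apply: L1D => //; exact: L1D.
have il : L1 P (fun w => `|U w| * `|V w| * `|W w|).
  apply: L1_le ib; last by move=> w; rewrite ger0_norm ?mulr_ge0// mul3_le_cubes.
  by apply: measurable_funM; [apply: measurable_funM|]; exact: measurableT_comp.
split => //; apply: (le_trans (Ex_le il ib _)).
  by move=> w; rewrite mul3_le_cubes.
rewrite ExZ; last by apply: L1D => //; exact: L1D.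
rewrite ExD//; last exact: L1D.
rewrite ExD//; lra.
Qed.

Let one_cube : [/\ measurable_fun [set: T] (fun _ : T => 1 : R),
  L1 P (fun _ => `|1 : R| ^+ 3) & Ex P (fun _ => `|1 : R| ^+ 3) <= M].
Proof.
by split; [|exact: L1_cst|rewrite Ex_cst normr1 expr1n].
Qed.

Lemma L1_abs3 i j k : L1 P (fun w => `|X i w| * `|X j w| * `|X k w|).
Proof. by case: (cube_bound (X_meas i) (X_meas j) (X_meas k)). Qed.

Lemma Ex_abs3 i j k : Ex P (fun w => `|X i w| * `|X j w| * `|X k w|) <= M.
Proof. by case: (cube_bound (X_meas i) (X_meas j) (X_meas k)). Qed.

Let abs2 i j : L1 P (fun w => `|X i w| * `|X j w|) /\
  Ex P (fun w => `|X i w| * `|X j w|) <= M.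
Proof.
have [m1 i1 e1] := one_cube.
have := cube_bound (X_meas i) (X_meas j) m1 (X_L3 i) (X_L3 j) i1 (X_M3 i) (X_M3 j) e1.
by rewrite (_ : (fun w => _ * `|1|) = fun w => `|X i w| * `|X j w|)//;
  apply/funext => w; rewrite normr1 mulr1.
Qed.

Lemma L1_abs2 i j : L1 P (fun w => `|X i w| * `|X j w|).
Proof. by case: (abs2 i j). Qed.

Lemma Ex_abs2 i j : Ex P (fun w => `|X i w| * `|X j w|) <= M.
Proof. by case: (abs2 i j). Qed.

Lemma L1_X2 i j : L1 P (fun w => X i w * X j w).
Proof.
apply: L1_le (L1_abs2 i j); first exact: measurable_funM.
by move=> w; rewrite normrM.
Qed.

Let abs1 i : L1 P (fun w => `|X i w|) /\ Ex P (fun w => `|X i w|) <= M.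
Proof.
have [m1 i1 e1] := one_cube.
have := cube_bound (X_meas i) m1 m1 (X_L3 i) i1 i1 (X_M3 i) e1 e1.
by rewrite (_ : (fun w => _ * `|1|) = fun w => `|X i w|)//;
  apply/funext => w; rewrite normr1 !mulr1.
Qed.

Lemma L1_X i : L1 P (X i).
Proof. by apply: L1_le (abs1 i).1 => // w. Qed.

Lemma Ex_absX i : Ex P (fun w => `|X i w|) <= M.
Proof. by case: (abs1 i). Qed.

Lemma measurable_seg a b : measurable_fun [set: T] (seg a b).
Proof. exact: measurable_sum. Qed.

Lemma seg_le_absseg a b w : `|seg a b w| <= absseg a b w.
Proof. exact: ler_norm_sum. Qed.

Lemma absseg_ge0 a b w : 0 <= absseg a b w.
Proof. exact: sumr_ge0. Qed.

Lemma absseg_sub a b a' b' w : (a' <= a)%N -> (b <= b')%N ->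
  absseg a b w <= absseg a' b' w.
Proof.
move=> aa bb; have [ab|ba] := leqP a b; last first.
  by rewrite {1}/absseg big_geq ?absseg_ge0// ltnW.
rewrite /absseg (@big_cat_nat _ _ _ a a' b')//=; last exact: leq_trans bb.
rewrite (@big_cat_nat _ _ _ b a b')//=.
by rewrite addrCA lerDl addr_ge0//; exact: sumr_ge0.
Qed.

Lemma seg_cat a b e w : (a <= b)%N -> (b <= e)%N ->
  seg a e w = seg a b w + seg b e w.
Proof. by move=> ab be; rewrite /seg (@big_cat_nat _ _ _ b). Qed.

Lemma absseg_cat a b e w : (a <= b)%N -> (b <= e)%N ->
  absseg a e w = absseg a b w + absseg b e w.
Proof. by move=> ab be; rewrite /absseg (@big_cat_nat _ _ _ b). Qed.

Lemma seg_nil a b w : (b <= a)%N -> seg a b w = 0.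
Proof. by move=> ba; rewrite /seg big_geq. Qed.

Lemma L1_seg a b : L1 P (seg a b).
Proof. by apply: L1_sum => i _; exact: L1_X. Qed.

Lemma L1_absseg a b : L1 P (absseg a b).
Proof. by apply: L1_sum => i _; apply: L1_abs; exact: L1_X. Qed.

Lemma Ex_absseg a b : Ex P (absseg a b) <= M * (b - a)%:R.
Proof.
rewrite /absseg Ex_sum; last by move=> i _; apply: L1_abs; exact: L1_X.
apply: (@le_trans _ _ (\sum_(a <= j < b) M)).
  by apply: ler_sum => i _; exact: Ex_absX.
by rewrite sumr_const_nat mulr_natr.
Qed.

Lemma L1_X_absseg i a b : L1 P (fun w => `|X i w| * absseg a b w).
Proof.
have -> : (fun w => `|X i w| * absseg a b w) =
    fun w => \sum_(a <= j < b) `|X i w| * `|X j w|.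
  by apply/funext => w; rewrite mulr_sumr.
by apply: L1_sum => j _; exact: L1_abs2.
Qed.

Lemma Ex_X_absseg i a b : Ex P (fun w => `|X i w| * absseg a b w) <=
  M * (b - a)%:R.
Proof.
have -> : (fun w => `|X i w| * absseg a b w) =
    fun w => \sum_(a <= j < b) `|X i w| * `|X j w|.
  by apply/funext => w; rewrite mulr_sumr.
rewrite Ex_sum; last by move=> j _; exact: L1_abs2.
apply: (@le_trans _ _ (\sum_(a <= j < b) M)).
  by apply: ler_sum => j _; exact: Ex_abs2.
by rewrite sumr_const_nat mulr_natr.
Qed.

Let X_absseg2E i a b a' b' : (fun w => `|X i w| * absseg a b w * absseg a' b' w) =
  fun w => \sum_(a <= j < b) \sum_(a' <= k < b') `|X i w| * `|X j w| * `|X k w|.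
Proof.
apply/funext => w; rewrite exchange_big/= [LHS]mulr_sumr; apply: eq_bigr => k _.
by rewrite {1}/absseg mulr_sumr mulr_suml.
Qed.

Lemma L1_X_absseg2 i a b a' b' :
  L1 P (fun w => `|X i w| * absseg a b w * absseg a' b' w).
Proof.
rewrite X_absseg2E; apply: L1_sum => j _; apply: L1_sum => k _.
exact: L1_abs3.
Qed.

Lemma Ex_X_absseg2 i a b a' b' :
  Ex P (fun w => `|X i w| * absseg a b w * absseg a' b' w) <=
  M * (b - a)%:R * (b' - a')%:R.
Proof.
rewrite X_absseg2E Ex_sum; last first.
  by move=> j _; apply: L1_sum => k _; exact: L1_abs3.
apply: (@le_trans _ _ (\sum_(a <= j < b) (\sum_(a' <= k < b') M))).
  apply: ler_sum => j _; rewrite Ex_sum; last by move=> k _; exact: L1_abs3.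
  by apply: ler_sum => k _; exact: Ex_abs3.
by rewrite !sumr_const_nat -(mulr_natr (M *+ _)) -(mulr_natr M) mulrAC.
Qed.

Lemma L1_segM a b a' b' : L1 P (fun w => seg a b w * seg a' b' w).
Proof.
have -> : (fun w => seg a b w * seg a' b' w) =
    fun w => \sum_(a <= j < b) \sum_(a' <= k < b') X j w * X k w.
  by apply/funext => w; rewrite {1}/seg mulr_suml; apply: eq_bigr => j _;
    rewrite mulr_sumr.
by apply: L1_sum => j _; apply: L1_sum => k _; exact: L1_X2.
Qed.

Lemma L1_seg_sqr a b : L1 P (fun w => seg a b w ^+ 2).
Proof. exact: L1_segM. Qed.

Lemma L1_X_seg i a b : L1 P (fun w => X i w * seg a b w).
Proof.
have -> : (fun w => X i w * seg a b w) =
    fun w => \sum_(a <= j < b) X i w * X j w.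
  by apply/funext => w; rewrite mulr_sumr.
by apply: L1_sum => j _; exact: L1_X2.
Qed.

End moments.

(** * Stein's equation *)

Section stein_equation.
Set Implicit Arguments.
Unset Strict Implicit.
Context {R : realType}.
Local Notation mu := (@lebesgue_measure R).
Local Notation pdf := (normal_pdf (0 : R) 1).

Lemma pdfE x : pdf x = normal_peak 1 * expR (- (x ^+ 2 / 2)).
Proof.
rewrite normal_pdfE ?oner_eq0// /normal_fun subr0 expr1n mulr2n mulNr.
by congr (_ * expR (- (_ / _))).
Qed.

Lemma pdf_gt0 x : 0 < pdf x.
Proof. by rewrite pdfE mulr_gt0 ?expR_gt0// normal_peak_gt0// oner_eq0. Qed.

Lemma pdfN x : pdf (- x) = pdf x.
Proof. by rewrite !pdfE sqrrN. Qed.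

Lemma is_derive_pdf (x : R) : is_derive x 1 pdf (- x * pdf x).
Proof.
have -> : pdf = (fun y => normal_peak 1 * expR (- (y ^+ 2 / 2))).
  by apply/funext => y; rewrite pdfE.
by apply: is_derive_eq; rewrite /GRing.scale/=; field.
Qed.

Lemma is_derive_inv (g : R -> R) (x dg : R) : g x != 0 -> is_derive x 1 g dg ->
  is_derive x 1 (fun y => (g y)^-1) (- (g x) ^- 2 * dg).
Proof.
move=> g0 [d1 d2]; split; first exact: derivableV.
by rewrite deriveV// d2.
Qed.

Lemma continuous_pdf : continuous (pdf : R -> R).
Proof. by apply: continuous_normal_pdf; rewrite oner_eq0. Qed.

Lemma pdf_le1 x : pdf x <= 1.
Proof.
apply: le_trans (normal_pdf_ub _ _ (oner_neq0 _)) _.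
rewrite /normal_peak invf_le1 ?sqrtr_gt0; last first.
  by rewrite expr1n mul1r pmulrn_lgt0// pi_gt0.
rewrite expr1n mul1r -[leLHS]sqrtr1 ler_wsqrtr//.
have := pi_ge2 R; lra.
Qed.

(** The Gaussian tail is at most the integral of [q], a function above the density
    with the explicit primitive [- 2 * pdf x / (1 + x)]. *)
Lemma pdf_tail w : 0 <= w ->
  (\int[mu]_(x in `[w, +oo[) (pdf x)%:E <= (2 * pdf w / (1 + w))%:E)%E.
Proof.
move=> w0.
pose F x := - (2 * pdf x / (1 + x)).
pose q x := pdf x * (2 * x / (1 + x) + 2 / (1 + x) ^+ 2).
have dV (x : R) : 0 < 1 + x -> is_derive x 1 (fun y => (1 + y)^-1) (- (1 + x) ^- 2).
  move=> x1; have x0 : 1 + x != 0 by rewrite gt_eqF.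
  have h : is_derive x 1 (fun y => 1 + y) 1.
    by apply: is_derive_eq; rewrite add0r mulr1.
  by have := is_derive_inv x0 h; rewrite mulr1.
have dF (x : R) : 0 < 1 + x -> is_derive x 1 F (q x).
  move=> x1; have x0 : 1 + x != 0 by rewrite gt_eqF.
  have h1 := dV x x1; have h2 := is_derive_pdf x.
  rewrite /F /q.
  by apply: is_derive_eq; rewrite /GRing.scale/=; field.
have cV (x : R) : 0 < 1 + x -> {for x, continuous (fun y : R => (1 + y)^-1)}.
  by move=> x1; apply: cvgV; [rewrite gt_eqF|apply: cvgD; [exact: cvg_cst|exact: cvg_id]].
have cq (x : R) : 0 < 1 + x -> {for x, continuous q}.
  move=> x1; apply: cvgM; first exact: continuous_pdf.
  apply: cvgD; first apply: cvgM.
  - by apply: cvgM; [exact: cvg_cst|exact: cvg_id].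
  - exact: cV.
  - apply: cvgM; first exact: cvg_cst.
    apply: cvgV; first by rewrite expf_neq0// gt_eqF.
    apply: (@cvg_comp _ _ _ (fun y : R => 1 + y) (fun y : R => y ^+ 2)).
      by apply: cvgD; [exact: cvg_cst|exact: cvg_id].
    exact: exprn_continuous.
have le_q x : w <= x -> pdf x <= q x.
  move=> wx; have x0 : 0 <= x by exact: le_trans wx.
  rewrite /q ler_pMr ?pdf_gt0//.
  have x1 : 0 < (1 + x) by rewrite ltr_pwDl.
  have -> : 2 * x / (1 + x) + 2 / (1 + x) ^+ 2 =
    1 + (x ^+ 2 + 1) / (1 + x) ^+ 2 by field; rewrite gt_eqF.
  by rewrite lerDl divr_ge0 ?addr_ge0 ?sqr_ge0.
have pos x : x \in `[w, +oo[ -> 0 < 1 + x.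
  by rewrite in_itv/= andbT => wx; rewrite ltr_pwDl// (le_trans w0).
have cwq : {within `[w, +oo[, continuous q}.
  apply: continuous_in_subspaceT => x; rewrite inE/= => xw.
  exact/cq/pos.
apply: (@le_trans _ _ (\int[mu]_(x in `[w, +oo[) (q x)%:E)%E).
  apply: ge0_le_integral => //=.
  - by move=> x _; rewrite lee_fin normal_pdf_ge0.
  - by apply/measurable_EFinP/measurable_funTS; exact: measurable_normal_pdf.
  - by apply/measurable_EFinP; exact: subspace_continuous_measurable_fun.
  - move=> x; rewrite in_itv/= andbT => wx; rewrite lee_fin; exact: le_q.
rewrite (@ge0_continuous_FTC2y _ _ F w 0) //.
- by rewrite -EFinB /F sub0r opprK.
- by move=> x wx; rewrite (le_trans _ (le_q _ wx))// normal_pdf_ge0.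
- apply/cvgr0Pnorm_le => e e0; near=> x.
  have x0 : 0 < x by near: x; exact: nbhs_pinfty_gt.
  rewrite normrN ger0_norm; last first.
    by rewrite divr_ge0 ?mulr_ge0 ?normal_pdf_ge0// addr_ge0// ltW.
  rewrite ler_pdivrMr ?addr_gt0//.
  have p1 := pdf_le1 x.
  have : 2 / e <= x by near: x; apply: nbhs_pinfty_ge; rewrite num_real.
  rewrite ler_pdivrMr// mulrDr mulr1 mulrC => h; lra.
- move=> x wx; have /dF : 0 < 1 + x by apply: pos; rewrite in_itv/= andbT ltW.
  by case.
- have /dF[dFw _] : 0 < 1 + w by apply: pos; rewrite in_itv/= andbT.
  apply: cvg_at_right_filter.
  exact/differentiable_continuous/derivable1_diffP.
- move=> x; rewrite in_itv/= andbT => wx.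
  have /dF dFx : 0 < 1 + x by apply: pos; rewrite in_itv/= andbT ltW.
  by rewrite derive1E; exact: derive_val.
Unshelve. all: by end_near. Qed.

Section solution.
Variable h : R -> R.
Hypothesis h_cont : continuous h.
Hypothesis h_ge0 : forall x, 0 <= h x.
Hypothesis h_le1 : forall x, h x <= 1.

Definition gauss_mean : R := (\int[mu]_x (h x * pdf x))%R.

Let hc x := h x - gauss_mean.

Let ipdf : mu.-integrable setT (EFin \o pdf).
Proof. exact: integrable_normal_pdf. Qed.

Let mpdf : measurable_fun [set: R] pdf.
Proof. exact: measurable_normal_pdf. Qed.

Let mh : measurable_fun [set: R] h.
Proof. exact: continuous_measurable_fun. Qed.

Let int_bdd (g : R -> R) (r : R) : measurable_fun [set: R] g ->
  (forall x, `|g x| <= r) -> mu.-integrable setT (EFin \o (fun x => g x * pdf x)).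
Proof.
move=> mg gr; apply: (@le_integrable _ _ _ mu _ measurableT _
    (EFin \o (fun x => r * pdf x))).
- by apply/measurable_EFinP; exact: measurable_funM.
- move=> x _ /=; rewrite lee_fin normrM (ger0_norm (normal_pdf_ge0 _ _ _)).
  by apply: le_trans (ler_norm _); apply: ler_wpM2r => //; exact: normal_pdf_ge0.
- exact: (integrableZl measurableT r ipdf).
Qed.

Let pdf1 : (\int[mu]_x pdf x)%R = 1.
Proof. by rewrite /Rintegral integral_normal_pdf. Qed.

Let h_norm x : `|h x| <= 1.
Proof. by rewrite ger0_norm. Qed.

Let ihp : mu.-integrable setT (EFin \o (fun x => h x * pdf x)).
Proof. exact: (int_bdd mh h_norm). Qed.

Lemma gauss_mean_ge0 : 0 <= gauss_mean.
Proof.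
by apply: Rintegral_ge0 => x _; rewrite mulr_ge0// normal_pdf_ge0.
Qed.

Lemma gauss_mean_le1 : gauss_mean <= 1.
Proof.
rewrite -pdf1; apply: le_Rintegral => // x _.
by rewrite ler_piMl// normal_pdf_ge0.
Qed.

Lemma hc_le1 x : `|hc x| <= 1.
Proof.
rewrite /hc; have := gauss_mean_ge0; have := gauss_mean_le1.
have := h_ge0 x; have := h_le1 x; rewrite ler_norml => *.
by apply/andP; split; lra.
Qed.

Let mhc : measurable_fun [set: R] hc.
Proof. exact: measurable_funB. Qed.

Let ihc : mu.-integrable setT (EFin \o (fun x => hc x * pdf x)).
Proof. exact: (int_bdd mhc hc_le1). Qed.

Let G w := (\int[mu]_(x in `]-oo, w]) (hc x * pdf x))%R.

(** The solution of Stein's equation that stays bounded at infinity, [G] being the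
    integral of [(h - gauss_mean) * pdf] up to [w]. *)
Definition stein w := G w / pdf w.

Let total : (\int[mu]_x (hc x * pdf x))%R = 0.
Proof.
rewrite (_ : (fun x => _) = fun x => h x * pdf x - gauss_mean * pdf x); last first.
  by apply/funext => x; rewrite mulrBl.
rewrite RintegralB//; last exact: (integrableZl measurableT gauss_mean ipdf).
by rewrite RintegralZl// pdf1 mulr1 subrr.
Qed.
Let tail_bound A : measurable A ->
  `|(\int[mu]_(x in A) (hc x * pdf x))%R| <= (\int[mu]_(x in A) pdf x)%R.
Proof.
move=> mA; have iA : mu.-integrable A (EFin \o (fun x => hc x * pdf x)).
  exact: integrableS ihc.
apply: (le_trans (le_normr_Rintegral mA iA)); apply: le_Rintegral => //.
- exact: integrable_norm.
- exact: integrableS ipdf.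
- move=> x _; rewrite normrM (ger0_norm (normal_pdf_ge0 _ _ _)).
  by rewrite ler_piMl ?normal_pdf_ge0// hc_le1.
Qed.

Let le_Rint A (r : R) : measurable A -> (\int[mu]_(x in A) (pdf x)%:E <= r%:E)%E ->
  (\int[mu]_(x in A) pdf x)%R <= r.
Proof.
move=> mA h0; rewrite -lee_fin /Rintegral fineK//.
by apply: integrable_fin_num => //; exact: integrableS ipdf.
Qed.

(** The integral of [(h - gauss_mean) * pdf] over the line vanishes, so [stein w]
    can be computed from either tail; take the one that does not contain 0 and
    apply [pdf_tail]. *)
Lemma stein_bound w : `|stein w| <= 2 / (1 + `|w|).
Proof.
rewrite normrM normfV (gtr0_norm (pdf_gt0 w)) ler_pdivrMr ?pdf_gt0// mulrAC.
have [w0|w0] := leP 0 w.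
  rewrite (ger0_norm w0).
  have -> : G w = - (\int[mu]_(x in `]w, +oo[) (hc x * pdf x))%R.
    have := @Rintegral_itvB R (fun x => hc x * pdf x) -oo%O +oo%O w.
    rewrite set_itvNyy => /(_ ihc isT isT) <-.
    by rewrite total sub0r opprK.
  rewrite normrN; apply: le_trans (tail_bound _) _ => //.
  apply: le_Rint => //; rewrite integral_itv_obnd_cbnd; first exact: pdf_tail.
  by apply/measurable_EFinP/measurable_funTS.
rewrite (ltr0_norm w0); apply: le_trans (tail_bound _) _ => //.
apply: le_Rint => //.
have := pdf_tail (_ : 0 <= - w); rewrite oppr_ge0 (ltW w0) => /(_ isT).
rewrite pdfN; apply: le_trans.
rewrite -[X in (\int[mu]_(x in `]-oo, X]) _)%E](opprK w).
rewrite ge0_integration_by_substitutionNy.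
- by under eq_integral do rewrite /= pdfN.
- by apply: continuous_subspaceT; exact: continuous_pdf.
- by move=> x _; exact: normal_pdf_ge0.
Qed.

Lemma stein_le2 w : `|stein w| <= 2.
Proof.
apply: le_trans (stein_bound w) _.
by rewrite ler_pdivrMr ?ltr_pwDl// ler_peMr// lerDl.
Qed.

Lemma mul_stein_le2 w : `|w * stein w| <= 2.
Proof.
rewrite normrM; apply: le_trans (ler_wpM2l (normr_ge0 w) (stein_bound w)) _.
rewrite mulrA ler_pdivrMr ?ltr_pwDl// mulrC ler_wpM2l// lerDr//.
Qed.

Lemma is_derive_stein (w : R) : is_derive w 1 stein (w * stein w + hc w).
Proof.
have [dG1 dG2] : derivable G w 1 /\ derive1 G w = hc w * pdf w.
  apply: (@continuous_FTC1 _ _ _ _ (w + 1)); first by rewrite ltrDl.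
  - exact: integrableS ihc.
  - by rewrite ltNyr.
  - apply: continuousM; last exact: continuous_pdf.
    by apply: continuousB; [exact: h_cont|exact: cst_continuous].
have hG : is_derive w 1 G (hc w * pdf w).
  by split => //; rewrite -derive1E.
have p0 : pdf w != 0 by rewrite gt_eqF// pdf_gt0.
have hp := is_derive_inv p0 (is_derive_pdf w).
rewrite /stein; apply: is_derive_eq; rewrite /GRing.scale/=; field.
exact: p0.
Qed.

(** The derivative of [stein], as given by Stein's equation ([is_derive_stein]);
    it is as regular as [h], which need not be differentiable. *)
Definition stein' w := w * stein w + hc w.

Lemma stein'_le3 w : `|stein' w| <= 3.
Proof.
apply: le_trans (ler_normD _ _) _; have := mul_stein_le2 w; have := hc_le1 w.
lra.
Qed.

Lemma continuous_stein : continuous stein.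
Proof.
move=> w; have [dw _] := is_derive_stein w.
exact/differentiable_continuous/derivable1_diffP.
Qed.

Lemma measurable_stein : measurable_fun [set: R] stein.
Proof. exact: continuous_measurable_fun continuous_stein. Qed.

Lemma measurable_stein' : measurable_fun [set: R] stein'.
Proof.
apply: measurable_funD; last exact: mhc.
by apply: measurable_funM => //; exact: measurable_stein.
Qed.

Lemma stein_MVT x y : exists2 e, (Num.min x y <= e <= Num.max x y) &
  stein y - stein x = stein' e * (y - x).
Proof.
have main (a b : R) : a <= b ->
    exists2 e, (a <= e <= b) & stein b - stein a = stein' e * (b - a).
  move=> ab; have [e] := @MVT_segment R stein stein' a b ab
    (fun z _ => is_derive_stein z) (continuous_subspaceT continuous_stein).
  by rewrite in_itv/= => he E; exists e.
have [xy|/ltW yx] := leP x y.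
  have [e he E] := main _ _ xy; exists e => //.
have [e he E] := main _ _ yx; exists e => //.
by rewrite -opprB E -mulrN opprB.
Qed.

Lemma stein_lip x y : `|stein y - stein x| <= 3 * `|y - x|.
Proof.
by have [e _ ->] := stein_MVT x y; rewrite normrM ler_wpM2r// stein'_le3.
Qed.

(** Increments of [stein'] are those of [w * stein w] and of [h].  In this bound for
    the former, [w] appears only as the factor [`|w|], to be integrated
    separately when it is independent of [u] and [v]. *)
Lemma mul_stein_increment w u v :
  `|(w + u) * stein (w + u) - (w + v) * stein (w + v)| <=
  3 * `|w| * `|u - v| + 2 * `|u| + 2 * `|v|.
Proof.
have -> : (w + u) * stein (w + u) - (w + v) * stein (w + v) =
  w * (stein (w + u) - stein (w + v)) + u * stein (w + u) - v * stein (w + v).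
  by ring.
apply: le_trans (ler_normB _ _) _; apply: lerD; last first.
  by rewrite normrM mulrC ler_wpM2r// stein_le2.
apply: le_trans (ler_normD _ _) _; apply: lerD; last first.
  by rewrite normrM mulrC ler_wpM2r// stein_le2.
rewrite normrM -mulrA mulrCA ler_wpM2l//.
by have := stein_lip (w + v) (w + u); rewrite opprD addrACA subrr add0r.
Qed.

End solution.

Let ipdf : mu.-integrable setT (EFin \o pdf).
Proof. exact: integrable_normal_pdf. Qed.

Lemma PhiE (z : R) : Phi z = (\int[mu]_(x in `]-oo, z]) pdf x)%R.
Proof. by []. Qed.

Lemma Phi_increment (x y : R) : x <= y -> 0 <= Phi y - Phi x <= y - x.
Proof.
move=> xy; rewrite !PhiE.
have -> : (\int[mu]_(t in `]-oo, y]) pdf t)%R - (\int[mu]_(t in `]-oo, x]) pdf t)%R =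
    (\int[mu]_(t in `]x, y]) pdf t)%R.
  apply: (@Rintegral_itvB R pdf -oo%O (BRight y) x) => //.
  exact: integrableS ipdf.
apply/andP; split.
  by apply: Rintegral_ge0 => t _; exact: normal_pdf_ge0.
rewrite -lee_fin /Rintegral fineK; last first.
  by apply: integrable_fin_num => //; exact: integrableS ipdf.
apply: (@le_trans _ _ (\int[mu]_(t in `]x, y]) (cst 1 t))%E).
  apply: ge0_le_integral => //=.
  - by move=> t _; rewrite lee_fin normal_pdf_ge0.
  - by apply/measurable_EFinP/measurable_funTS; exact: measurable_normal_pdf.
  - by move=> t _; rewrite lee_fin pdf_le1.
rewrite integral_cst// mul1e.
rewrite [X in (X <= _)%E](_ : _ = lebesgue_measure `]x, y])// lebesgue_measure_itv/= lte_fin.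
by case: ltP => _; rewrite ?EFinB// lee_fin subr_ge0.
Qed.

Lemma Phi_lip (x y : R) : `|Phi x - Phi y| <= `|x - y|.
Proof.
have [xy|/ltW yx] := leP x y.
  have /andP[h1 h2] := Phi_increment xy.
  by rewrite distrC ger0_norm// distrC ger0_norm// subr_ge0.
have /andP[h1 h2] := Phi_increment yx.
by rewrite ger0_norm// ger0_norm// subr_ge0.
Qed.

Lemma Phi_ge0 (x : R) : 0 <= Phi x.
Proof. by apply: Rintegral_ge0 => t _; exact: normal_pdf_ge0. Qed.

Lemma Phi_le1 (x : R) : Phi x <= 1.
Proof.
rewrite -lee_fin /Phi fineK; last exact: fin_num_measure.
exact: probability_le1.
Qed.

(** The ramp of width [e] lies between the indicators of the half-lines ending at
    [z] and at [z + e], and [Phi] is 1-Lipschitz. *)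
Lemma gauss_mean_ramp (z e : R) : 0 < e ->
  Phi z <= gauss_mean (fun x => ramp ((x - z) / e)) <= Phi z + e.
Proof.
move=> e0; pose hz x := ramp ((x - z) / e).
have mhz : measurable_fun [set: R] hz.
  apply: (measurableT_comp measurable_ramp); apply: measurable_funM => //.
  exact: measurable_funB.
have iz : mu.-integrable setT (EFin \o (fun x => hz x * pdf x)).
  apply: (@le_integrable _ _ _ mu _ measurableT _ (EFin \o pdf)) => //.
    apply/measurable_EFinP; apply: measurable_funM => //.
    exact: measurable_normal_pdf.
  move=> x _ /=; rewrite lee_fin normrM (ger0_norm (ramp_ge0 _)).
  by rewrite ler_piMl// ramp_le1.
have restr w : Phi w = (\int[mu]_x (pdf \_ `]-oo, w]) x)%R.
  by rewrite PhiE Rintegral_mkcond.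
have irestr w : mu.-integrable setT (EFin \o (pdf \_ `]-oo, w])).
  by rewrite -restrict_EFin; apply/integrable_restrict => //; rewrite setTI;
    exact: integrableS ipdf.
apply/andP; split.
  rewrite restr; apply: le_Rintegral => // x _.
  rewrite patchE; case: ifPn => [|_].
    rewrite inE/= in_itv/= => xz; rewrite /hz ramp1 ?mul1r//.
    by rewrite mulr_le0_ge0 ?subr_le0// invr_ge0 ltW.
  by rewrite mulr_ge0 ?ramp_ge0 ?normal_pdf_ge0.
apply: (@le_trans _ _ (Phi (z + e))).
  rewrite restr; apply: le_Rintegral => // x _.
  rewrite patchE; case: ifPn => [_|].
    by rewrite ler_piMl ?ramp_le1 ?normal_pdf_ge0.
  rewrite notin_setE/= in_itv/= => /negP; rewrite -ltNge => zx.
  by rewrite ramp0 ?mul0r// ler_pdivlMr// mul1r lerBrDl ltW.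
have ze : z <= z + e by rewrite lerDl ltW.
have /andP[_] := Phi_increment ze; lra.
Qed.

End stein_equation.

(** * Probabilities of half-lines *)

Section probabilities_of_halflines.
Set Implicit Arguments.
Unset Strict Implicit.
Context {d : measure_display} {T : measurableType d} {R : realType}.
Context {P : probability T R}.

Local Notation E := (Ex P).
Local Notation L1 := (L1 P).

Lemma measurable_lt_set (U : T -> R) (r : R) : measurable_fun [set: T] U ->
  measurable [set w | U w < r].
Proof.
move=> mU; have mlt := measurable_fun_ltr mU (measurable_cst r).
have := mlt measurableT [set true] I.
by rewrite setTI; congr measurable; apply/seteqP; split => w /=.
Qed.

Lemma prob_ltE (U : T -> R) (r : R) : measurable_fun [set: T] U ->
  L1 (fun w => (U w < r)%R%:R) /\
  fine (P [set w | U w < r]) = E (fun w => (U w < r)%R%:R).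
Proof.
move=> mU; have mA := measurable_lt_set r mU.
have indE : \1_[set w | U w < r] = (fun w => (U w < r)%R%:R) :> (T -> R).
  apply/funext => w; rewrite indicE; congr (nat_of_bool _)%:R.
  by apply/idP/idP; rewrite inE.
split; last by rewrite /Ex -indE expectation_indic.
apply: (@L1_bounded _ _ _ _ _ 1); first by rewrite -indE; exact: measurable_indic.
by move=> w; case: ltP; rewrite ?normr1 ?normr0.
Qed.

Lemma prob_Phi_dist_le1 (A : set T) (x : R) : measurable A ->
  `|fine (P A) - Phi x| <= 1.
Proof.
move=> mA; have PA : 0 <= fine (P A) <= 1.
  by rewrite fine_ge0//= -lee_fin fineK ?probability_le1// fin_num_measure.
have := Phi_ge0 x; have := Phi_le1 x; move: PA => /andP[h1 h2] h3 h4.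
by rewrite ler_norml; apply/andP; split; lra.
Qed.

(** Markov's inequality: if [V] is above [r + 1] while [U] is below [r], then
    [(U - V) ^+ 2 >= 1]. *)
Lemma prob_lt_perturb (U V : T -> R) (r : R) : measurable_fun [set: T] U ->
  measurable_fun [set: T] V -> L1 (fun w => (U w - V w) ^+ 2) ->
  fine (P [set w | U w < r]) <=
  fine (P [set w | V w < r + 1]) + E (fun w => (U w - V w) ^+ 2).
Proof.
move=> mU mV iUV.
have [iu ->] := prob_ltE r mU; have [iv ->] := prob_ltE (r + 1) mV.
rewrite -ExD//; apply: (Ex_le iu (L1D iv iUV)) => w.
case: (ltP (V w) (r + 1)) => [_|h1] /=.
  by case: (U w < r); rewrite ?lerDl ?sqr_ge0// addr_ge0// sqr_ge0.
case: ltP => h2 /=; last by rewrite add0r sqr_ge0.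
rewrite add0r -[leRHS]real_normK ?num_real// expr_ge1//.
by rewrite ler_normr; apply/orP; right; lra.
Qed.

End probabilities_of_halflines.

(** * A Berry-Esseen bound for m-dependent sequences *)

Section m_dependent.
Set Implicit Arguments.
Unset Strict Implicit.
Context {d : measure_display} {T : measurableType d} {R : realType}.
Context {P : probability T R}.
Variables (eps : int -> {RV P >-> R}) (pos : nat -> int).
Hypothesis eps_indep : mutually_independent eps.
Hypothesis pos_inj : injective pos.
Variables (X : nat -> T -> R) (m N n0 : nat) (M C1 c : R).
Hypothesis m_gt0 : (0 < m)%N.
Hypothesis X_ad : forall j, ad eps pos [set k | (j <= k <= j + m)%N] (X j).
Hypothesis X_mean : forall j, Ex P (X j) = 0.
Hypothesis M_ge1 : 1 <= M.
Hypothesis X_L3 : forall j, L1 P (fun w => `|X j w| ^+ 3).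
Hypothesis X_M3 : forall j, Ex P (fun w => `|X j w| ^+ 3) <= M.
Hypothesis C1_gt0 : 0 < C1.
Hypothesis c_gt0 : 0 < c.
(** Linear growth of the variance is required up to a horizon [N] only: truncating at
    [m] preserves it for sums of at most [N] terms if [rho ^+ m <= N ^- 3]. *)
Hypothesis seg_ub : forall a n, (0 < n <= N)%N ->
  Ex P (fun w => seg X a (a + n) w ^+ 2) <= C1 ^+ 2 * n%:R.
Hypothesis seg_lb : forall a n, (n0 <= n <= N)%N ->
  c * n%:R <= Ex P (fun w => seg X a (a + n) w ^+ 2).

Local Notation ad := (ad eps pos).
Local Notation seg := (seg X).
Local Notation absseg := (absseg X).
Local Notation E := (Ex P).
Local Notation L1 := (L1 P).

Let X_meas j : measurable_fun [set: T] (X j).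
Proof. exact: (ad_meas (@X_ad j)). Qed.

Lemma seg_ad (A : set nat) a b :
  (forall k, (a < b)%N -> (a <= k)%N -> (k < b + m)%N -> A k) -> ad A (seg a b).
Proof.
move=> h; apply: ad_sum_nat => j jab; apply: adS (@X_ad j) => k /= hk.
by apply: h; lia.
Qed.

Lemma absseg_ad (A : set nat) a b :
  (forall k, (a < b)%N -> (a <= k)%N -> (k < b + m)%N -> A k) ->
  ad A (absseg a b).
Proof.
move=> h; apply: ad_sum_nat => j jab; apply: adapted_abs.
by apply: adS (@X_ad j) => k /= hk; apply: h; lia.
Qed.

Lemma X_adS (A : set nat) j :
  (forall k, (j <= k)%N -> (k <= j + m)%N -> A k) -> ad A (X j).
Proof. by move=> h; apply: adS (@X_ad j) => k /= hk; apply: h; lia. Qed.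

(** The block sum at scale [L] has concentration [D * L / sqrt n], also when
    weighted by a variable [om] independent of the block and shifted by a
    variable [H] independent of its interior.  This generality makes the
    property reproduce itself for shorter blocks. *)
Definition Conc (L D : R) (n : nat) : Prop := forall a (om H : T -> R),
  ad [set k | ~~ (a <= k < a + n + m)%N] om ->
  ad [set k | ~~ (a + m <= k < a + n)%N] H ->
  (forall w, 0 <= om w) -> L1 om ->
  E (fun w => om w * kap ((H w + seg a (a + n) w) / L)) <=
  D * L / Num.sqrt n%:R * E om.

Lemma invsqrt_quarter (n n' : nat) : (0 < n)%N -> (n <= 4 * n')%N ->
  (Num.sqrt n'%:R)^-1 <= 2 * (Num.sqrt n%:R)^-1 :> R.
Proof.
move=> n1 nn'; have n'1 : (0 < n')%N by lia.
have sn : (0 : R) < Num.sqrt n%:R by rewrite sqrtr_gt0 ltr0n.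
have sn' : (0 : R) < Num.sqrt n'%:R by rewrite sqrtr_gt0 ltr0n.
rewrite -[2]invrK -invfM lef_pV2 ?posrE ?mulr_gt0 ?invr_gt0//.
rewrite mulrC ler_pdivrMr// -(@ler_pXn2r _ 2) ?nnegrE ?mulr_ge0 ?sqrtr_ge0//.
rewrite exprMn !sqr_sqrtr ?ler0n//.
by rewrite (_ : 2 ^+ 2 = 4%:R) -?natrM ?ler_nat ?(mulnC n')// -natrX.
Qed.

(** Concentration for the block sum with the terms within [2 * m] of [i] taken out.
    One of the two remaining pieces, shortened further so that it is independent
    of [q] and [U], has length between [n / 4] and [n]; all the rest is absorbed
    in the shift.  The lower bound on [n] makes room for this. *)
Lemma conc_use L D n a i (H q U : T -> R) :
  0 < L -> 0 <= D -> (forall n', (0 < n' < n)%N -> Conc L D n') ->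
  (12 * m + 2 <= n)%N -> (a <= i < a + n)%N ->
  ad [set k | ~~ (a + m <= k < a + n)%N] H ->
  ad [set k | (i <= k + 2 * m)%N && (k <= i + 3 * m)%N ||
              ~~ (a <= k < a + n + m)%N] q ->
  ad [set k | (i <= k + 2 * m)%N && (k <= i + 3 * m)%N] U ->
  (forall w, 0 <= q w) -> L1 q ->
  E (fun w => q w * kap ((H w + U w + seg a (i - 2 * m) w +
    seg (i + 2 * m + 1) (a + n) w) / L)) <=
  2 * D * L / Num.sqrt n%:R * E q.
Proof.
move=> L0 D0 IH nm ain aH aq aU q0 iq.
have Eq0 : 0 <= E q by exact: Ex_ge0.
suff [n' [n'0 n'n nn' h]] : exists n', [/\ (0 < n')%N, (n' < n)%N,
   (n <= 4 * n')%N & E (fun w => q w * kap ((H w + U w + seg a (i - 2 * m) w +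
    seg (i + 2 * m + 1) (a + n) w) / L)) <= D * L / Num.sqrt n'%:R * E q].
  apply: le_trans h _; apply: ler_wpM2r => //.
  have -> : 2 * D * L / Num.sqrt n%:R = D * L * (2 * (Num.sqrt n%:R)^-1) by ring.
  apply: ler_wpM2l; first by rewrite mulr_ge0// ltW.
  by apply: invsqrt_quarter; lia.
have [right|left] := leqP (2 * i + 1) (2 * a + n).
  pose a' := (i + 3 * m + 1)%N; pose n' := (a + n - a')%N.
  have an' : (a' + n' = a + n)%N by rewrite /n' /a'; lia.
  exists n'; split; [rewrite /n' /a'; lia|rewrite /n' /a'; lia|rewrite /n' /a'; lia|].
  pose H' w := H w + U w + seg a (i - 2 * m) w + seg (i + 2 * m + 1) a' w.
  have -> : (fun w => q w * kap ((H w + U w + seg a (i - 2 * m) w +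
      seg (i + 2 * m + 1) (a + n) w) / L)) =
      fun w => q w * kap ((H' w + seg a' (a' + n') w) / L).
    apply/funext => w; rewrite /H' an'.
    by rewrite (@seg_cat _ _ _ X (i + 2 * m + 1) a') ?addrA// /a'; lia.
  apply: IH => //; first by rewrite /n' /a'; lia.
    by apply: adS aq => k /=; rewrite /n' /a'; lia.
  apply: adaptedD; [apply: adaptedD; [apply: adaptedD|]|].
  - by apply: adS aH => k /=; rewrite /n' /a'; lia.
  - by apply: adS aU => k /=; rewrite /n' /a'; lia.
  - by apply: seg_ad => k /=; rewrite /n' /a'; lia.
  - by apply: seg_ad => k /=; rewrite /n' /a'; lia.
pose b' := (i - 3 * m)%N; pose n' := (b' - a)%N.
have an' : (a + n' = b')%N by rewrite /n' /b'; lia.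
exists n'; split; [rewrite /n' /b'; lia|rewrite /n' /b'; lia|rewrite /n' /b'; lia|].
pose H' w := H w + U w + seg b' (i - 2 * m) w + seg (i + 2 * m + 1) (a + n) w.
have -> : (fun w => q w * kap ((H w + U w + seg a (i - 2 * m) w +
    seg (i + 2 * m + 1) (a + n) w) / L)) =
    fun w => q w * kap ((H' w + seg a (a + n') w) / L).
  apply/funext => w; rewrite /H' an'.
  rewrite (@seg_cat _ _ _ X a b' (i - 2 * m)); [|rewrite /b'; lia|rewrite /b'; lia].
  by congr (_ * kap (_ / _)); ring.
apply: IH => //; first by rewrite /n' /b'; lia.
  by apply: adS aq => k /=; rewrite /n' /b'; lia.
apply: adaptedD; [apply: adaptedD; [apply: adaptedD|]|].
- by apply: adS aH => k /=; rewrite /n' /b'; lia.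
- by apply: adS aU => k /=; rewrite /n' /b'; lia.
- by apply: seg_ad => k /=; rewrite /n' /b'; lia.
- by apply: seg_ad => k /=; rewrite /n' /b'; lia.
Qed.

(** Here [xt] and [xr] are [x] without a small and without a larger neighbourhood of
    one index, so that [kap] is finally evaluated at an argument independent of
    [Y]. *)
Lemma softsign_increment (L x xt xr Y D B : R) : 0 < L -> x = xt + Y / L ->
  x = xr + D / L -> `|Y| <= B -> `|D| <= B ->
  `|L * softsign x - L * softsign xt - Y * kap xr| <=
  B * B / L * (3 * kap x + kap xr).
Proof.
move=> L0 xE xE' YB DB; have B0 : 0 <= B := le_trans (normr_ge0 _) YB.
have h1 := softsign_taylor x xt; have h2 := kap_lip x xr.
have E1 : x - xt = Y / L by rewrite xE; ring.
have E2 : x - xr = D / L by rewrite xE'; ring.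
rewrite E1 in h1; rewrite E2 in h2.
have -> : L * softsign x - L * softsign xt - Y * kap xr =
  L * (softsign x - softsign xt - Y / L * kap x) + Y * (kap x - kap xr).
  by field; rewrite gt_eqF.
apply: le_trans (ler_normD _ _) _; rewrite !normrM (gtr0_norm L0).
have L0' : 0 <= L by exact: ltW.
have kx := kap_ge0 x; have kr := kap_ge0 xr.
have -> : B * B / L * (3 * kap x + kap xr) =
  L * (2 * (B / L) ^+ 2 * kap x) + B * (B / L * (kap x + kap xr)).
  by field; rewrite gt_eqF.
apply: lerD.
  apply: ler_wpM2l => //; apply: le_trans h1 _; apply: ler_wpM2r => //.
  apply: ler_wpM2l => //; rewrite -real_normK ?num_real//.
  rewrite ler_pXn2r ?nnegrE ?divr_ge0// normrM normfV (gtr0_norm L0).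
  by rewrite ler_wpM2r// invr_ge0.
apply: ler_pM => //; apply: le_trans h2 _; apply: ler_wpM2r.
  exact: addr_ge0.
by rewrite normrM normfV (gtr0_norm L0) ler_wpM2r// invr_ge0.
Qed.

Let iX i : L1 (X i).
Proof. exact: (L1_X X_meas M_ge1 X_L3 X_M3). Qed.

Let iXB i a b : L1 (fun w => `|X i w| * absseg a b w).
Proof. exact: (L1_X_absseg X_meas M_ge1 X_L3 X_M3). Qed.

Let iXBB i a b a' b' : L1 (fun w => `|X i w| * absseg a b w * absseg a' b' w).
Proof. exact: (L1_X_absseg2 X_meas X_L3 X_M3). Qed.

Let iXS i a b : L1 (fun w => X i w * seg a b w).
Proof. exact: (L1_X_seg X_meas M_ge1 X_L3 X_M3). Qed.

Let iB a b : L1 (absseg a b).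
Proof. exact: (L1_absseg X_meas M_ge1 X_L3 X_M3). Qed.

Let iS a b : L1 (seg a b).
Proof. exact: (L1_seg X_meas M_ge1 X_L3 X_M3). Qed.

Let iSS a b : L1 (fun w => seg a b w ^+ 2).
Proof. exact: (L1_seg_sqr X_meas M_ge1 X_L3 X_M3). Qed.

Lemma L1_Mkap q z : L1 q -> measurable_fun [set: T] z ->
  L1 (fun w => q w * kap (z w)).
Proof.
move=> iq mz; apply: (@L1_Mbounded _ _ _ _ _ _ 1) => //.
  exact: (measurableT_comp measurable_kap).
by move=> w; exact: normr_kap_le1.
Qed.

Lemma width_le i : ((i + 2 * m + 1) - (i - 2 * m))%:R <= 5 * m%:R :> R.
Proof. by rewrite -natrM ler_nat; lia. Qed.

(** Let [Y] be the part of the sum within [m] of [i].  Removing [Y] from the argument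
    makes it independent of [X i], whose mean is 0, and the first-order
    correction is [X i * Y * kap].  Removing everything within [2 * m] of [i]
    from the argument of [kap] makes it independent of [X i * Y].  The errors
    are concentration quantities with weights [q1] and [q2], bounded by the
    induction hypothesis; their windows contain at most [5 * m] terms. *)
Lemma interior_term L D n a i (H om : T -> R) :
  0 < L -> 0 <= D -> (forall n', (0 < n' < n)%N -> Conc L D n') ->
  (12 * m + 2 <= n)%N -> (a + 2 * m <= i)%N -> (i + 2 * m < a + n)%N ->
  ad [set k | ~~ (a <= k < a + n + m)%N] om ->
  ad [set k | ~~ (a + m <= k < a + n)%N] H ->
  (forall w, 0 <= om w) -> L1 om ->
  `|E (fun w => om w * X i w * (L * softsign ((H w + seg a (a + n) w) / L))) -
    E (fun w => X i w * seg (i - m) (i + m + 1) w) *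
    E (fun w => om w * kap ((H w + seg a (a + n) w) / L))| <=
  300 * D * M ^+ 2 * m%:R ^+ 2 / Num.sqrt n%:R * E om.
Proof.
move=> L0 D0 IH nm ai ian aom aH om0 iom.
pose W := [set k : nat | (i <= k + 2 * m)%N && (k <= i + 3 * m)%N].
pose B := absseg (i - 2 * m) (i + 2 * m + 1).
pose Dd := seg (i - 2 * m) (i + 2 * m + 1).
pose Y := seg (i - m) (i + m + 1).
pose Vt w := seg (i - 2 * m) (i - m) w + seg (i + m + 1) (i + 2 * m + 1) w.
pose arg (U : T -> R) w := (H w + U w + seg a (i - 2 * m) w +
    seg (i + 2 * m + 1) (a + n) w) / L.
have aB : ad W B by apply: absseg_ad => k; rewrite /W /=; lia.
have aD : ad W Dd by apply: seg_ad => k; rewrite /W /=; lia.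
have aV : ad W Vt by apply: adaptedD; apply: seg_ad => k; rewrite /W /=; lia.
have a0 : ad W (fun=> 0) by exact: adapted_cst.
have aX : ad W (X i) by apply: X_adS => k; rewrite /W /=; lia.
have mH := ad_meas aH; have mom := ad_meas aom.
have marg U : ad W U -> measurable_fun [set: T] (arg U).
  move=> aU; apply: measurable_funM => //; apply: measurable_funD; last first.
    exact: measurable_seg.
  apply: measurable_funD; last exact: measurable_seg.
  by apply: measurable_funD => //; exact: (ad_meas aU).
have SE w : seg a (a + n) w = Dd w + seg a (i - 2 * m) w + seg (i + 2 * m + 1) (a + n) w.
  rewrite (@seg_cat _ _ _ X a (i - 2 * m) (a + n)); [|lia|lia].
  rewrite (@seg_cat _ _ _ X (i - 2 * m) (i + 2 * m + 1) (a + n)); [|lia|lia].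
  by rewrite -/Dd; ring.
have DE w : Dd w = Vt w + Y w.
  rewrite /Dd (@seg_cat _ _ _ X (i - 2 * m) (i - m) (i + 2 * m + 1)); [|lia|lia].
  rewrite (@seg_cat _ _ _ X (i - m) (i + m + 1) (i + 2 * m + 1)); [|lia|lia].
  by rewrite /Vt /Y; ring.
have xE w : (H w + seg a (a + n) w) / L = arg Dd w.
  by rewrite /arg SE !addrA.
rewrite (_ : (fun w => om w * X i w * _) =
  fun w => om w * X i w * (L * softsign (arg Dd w))); last first.
  by apply/funext => w; rewrite xE.
rewrite (_ : (fun w => om w * kap _) = fun w => om w * kap (arg Dd w)); last first.
  by apply/funext => w; rewrite xE.
pose Kq := 2 * D * L / Num.sqrt n%:R.
have use q U : ad (W `|` [set k | ~~ (a <= k < a + n + m)%N]) q -> ad W U ->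
    (forall w, 0 <= q w) -> L1 q -> E (fun w => q w * kap (arg U w)) <= Kq * E q.
  move=> aq aU q0 iq; apply: conc_use => //; first by lia.
  by apply: adS aq => k /= [->//|->]; rewrite orbT.
have aWl U : ad W U -> ad (W `|` [set k | ~~ (a <= k < a + n + m)%N]) U.
  by apply: adS => k; left.
have aomr : ad (W `|` [set k | ~~ (a <= k < a + n + m)%N]) om.
  by apply: adS aom => k; right.
have dis k : ~~ (a <= k < a + n + m)%N -> W k -> False by rewrite /W /=; lia.
pose Q1 w := `|X i w| * B w * B w.
pose q1 w := om w * Q1 w.
pose q2 w := om w * B w.
have aQ1 : ad W Q1.
  by apply: adaptedM => //; apply: adaptedM => //; exact: adapted_abs.
have iQ1 : L1 Q1 by exact: iXBB.
have iB' : L1 B by exact: iB.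
have iq1 : L1 q1 by exact: (L1_adM eps_indep pos_inj dis aom aQ1).
have iq2 : L1 q2 by exact: (L1_adM eps_indep pos_inj dis aom aB).
have q10 w : 0 <= q1 w by rewrite !mulr_ge0// absseg_ge0.
have q20 w : 0 <= q2 w by rewrite mulr_ge0// absseg_ge0.
have aq1 : ad (W `|` [set k | ~~ (a <= k < a + n + m)%N]) q1.
  by apply: adaptedM => //; exact: aWl.
have aq2 : ad (W `|` [set k | ~~ (a <= k < a + n + m)%N]) q2.
  by apply: adaptedM => //; exact: aWl.
have M0 : 0 <= M := le_trans ler01 M_ge1.
have m5 := width_le i.
have Eom0 : 0 <= E om by exact: Ex_ge0.
have Eq1 : E q1 <= E om * (25 * M * m%:R ^+ 2).
  rewrite (Ex_adM eps_indep pos_inj dis aom aQ1)//; apply: ler_wpM2l => //.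
  apply: le_trans (Ex_X_absseg2 X_meas X_L3 X_M3 _ _ _ _ _) _.
  apply: (@le_trans _ _ (M * (5 * m%:R) * (5 * m%:R))).
    by rewrite ler_pM ?mulr_ge0// ler_wpM2l.
  by rewrite le_eqVlt; apply/orP; left; apply/eqP; ring.
have Eq2 : E q2 <= E om * (5 * M * m%:R).
  rewrite (Ex_adM eps_indep pos_inj dis aom aB)//; apply: ler_wpM2l => //.
  apply: le_trans (Ex_absseg X_meas M_ge1 X_L3 X_M3 _ _) _.
  apply: (@le_trans _ _ (M * (5 * m%:R))); first by rewrite ler_wpM2l.
  by rewrite le_eqVlt; apply/orP; left; apply/eqP; ring.
have aarg (A : set nat) U : ad A H -> ad A U -> ad A (seg a (i - 2 * m)) ->
    ad A (seg (i + 2 * m + 1) (a + n)) -> ad A (arg U).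
  move=> hH hU hl hr; apply: adaptedM; last exact: adapted_cst.
  by apply: adaptedD => //; apply: adaptedD => //; exact: adaptedD.
pose z (_ : T) : R := 0.
pose t1 w := om w * X i w * (L * softsign (arg Dd w)).
pose t2 w := X i w * (om w * (L * softsign (arg Vt w))).
pose t3 w := (X i w * Y w) * (om w * kap (arg z w)).
have iom2 U V : L1 U -> ad W V -> L1 (fun w => U w * (L * softsign (arg V w))).
  move=> iU aV'; apply: (@L1_Mbounded _ _ _ _ _ _ L) => //.
    apply: measurable_funM => //; apply: (measurableT_comp measurable_softsign).
    exact: marg.
  move=> w; rewrite normrM (gtr0_norm L0) -[leRHS]mulr1.
  by apply: ler_wpM2l; [exact: ltW|exact: softsign_le1].
have it1 : L1 t1 by apply: iom2 => //; exact: (L1_adM eps_indep pos_inj dis aom aX).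
have dis2 k : (i <= k <= i + m)%N -> ~~ (i <= k <= i + m)%N -> False by move=> ->.
have aV2 : ad [set k | ~~ (i <= k <= i + m)%N] (fun w => om w * (L * softsign (arg Vt w))).
  apply: adaptedM; first by apply: adS aom => k /=; clear -ai ian; lia.
  apply: adaptedM; first exact: adapted_cst.
  apply: (adapted_comp measurable_softsign); apply: aarg.
  - by apply: adS aH => k /=; clear -ai ian; lia.
  - by apply: adaptedD; apply: seg_ad => k /=; clear -ai ian; lia.
  - by apply: seg_ad => k /=; clear -ai ian; lia.
  - by apply: seg_ad => k /=; clear -ai ian; lia.
have iV2 : L1 (fun w => om w * (L * softsign (arg Vt w))) by exact: iom2.
have it2 : L1 t2 by exact: (L1_adM eps_indep pos_inj dis2 (@X_ad i) aV2).
have Et2 : E t2 = 0.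
  by rewrite (Ex_adM eps_indep pos_inj dis2 (@X_ad i) aV2)// X_mean mul0r.
have dis3 k : (i <= k + m)%N && (k <= i + 2 * m)%N ->
  ~~ ((i <= k + m)%N && (k <= i + 2 * m)%N) -> False by move=> ->.
have aXY : ad [set k | (i <= k + m)%N && (k <= i + 2 * m)%N] (fun w => X i w * Y w).
  apply: adaptedM; first by apply: X_adS => k /=; clear -ai ian; lia.
  by apply: seg_ad => k /=; clear -ai ian; lia.
have aV3 : ad [set k | ~~ ((i <= k + m)%N && (k <= i + 2 * m)%N)]
    (fun w => om w * kap (arg z w)).
  apply: adaptedM; first by apply: adS aom => k /=; clear -ai ian; lia.
  apply: (adapted_comp measurable_kap); apply: aarg.
  - by apply: adS aH => k /=; clear -ai ian; lia.
  - exact: adapted_cst.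
  - by apply: seg_ad => k /=; clear -ai ian; lia.
  - by apply: seg_ad => k /=; clear -ai ian; lia.
have iV3 : L1 (fun w => om w * kap (arg z w)) by apply: L1_Mkap => //; exact: marg.
have it3 : L1 t3.
  by apply: (L1_adM eps_indep pos_inj dis3 aXY aV3) => //; exact: iXS.
have Et3 : E t3 = E (fun w => X i w * Y w) * E (fun w => om w * kap (arg z w)).
  by rewrite (Ex_adM eps_indep pos_inj dis3 aXY aV3)//; exact: iXS.
have ik q U : L1 q -> ad W U -> L1 (fun w => q w * kap (arg U w)).
  by move=> iq aU; apply: L1_Mkap => //; exact: marg.
have YB w : `|Y w| <= B w.
  by apply: (le_trans (seg_le_absseg _ _ _ _)); apply: absseg_sub; clear; lia.
have DB w : `|Dd w| <= B w by exact: seg_le_absseg.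
have argD w : arg Dd w = arg Vt w + Y w / L.
  by rewrite /arg DE; field; rewrite gt_eqF.
have argD0 w : arg Dd w = arg z w + Dd w / L.
  by rewrite /arg /z; field; rewrite gt_eqF.
have step1 : `|E t1 - E t3| <= L^-1 * (4 * (Kq * E q1)).
  have -> : E t1 - E t3 = E (fun w => t1 w - t2 w - t3 w).
    by rewrite ExB//; [rewrite ExB// Et2 subr0|exact: L1B].
  pose b w := L^-1 * (3 * (q1 w * kap (arg Dd w)) + q1 w * kap (arg z w)).
  have ib : L1 b.
    by apply: L1Z; apply: L1D; [apply: L1Z|]; exact: ik.
  apply: (@le_trans _ _ (E b)).
    apply: Ex_abs_le => //; first by apply: L1B => //; exact: L1B.
    move=> w; have := softsign_increment L0 (argD w) (argD0 w) (YB w) (DB w).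
    have oX : 0 <= om w * `|X i w| by rewrite mulr_ge0.
    move=> /(ler_wpM2l oX).
    rewrite (_ : om w * `|X i w| * _ = `|t1 w - t2 w - t3 w|); last first.
      rewrite -{1}(ger0_norm (om0 w)) -!normrM; congr `|_|.
      by rewrite /t1 /t2 /t3; ring.
    move=> /le_trans; apply; rewrite /b /q1 /Q1.
    by rewrite le_eqVlt; apply/orP; left; apply/eqP; ring.
  rewrite ExZ; last by apply: L1D; [apply: L1Z|]; exact: ik.
  apply: ler_wpM2l; first by rewrite invr_ge0 ltW.
  rewrite ExD; [|by apply: L1Z; exact: ik|exact: ik].
  rewrite ExZ; last exact: ik.
  have h1 := use q1 Dd aq1 aD q10 iq1; have h2 := use q1 z aq1 a0 q10 iq1.
  apply: (@le_trans _ _ (3 * (Kq * E q1) + Kq * E q1)).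
    by apply: lerD => //; exact: ler_wpM2l.
  by rewrite le_eqVlt; apply/orP; left; apply/eqP; ring.
have step2 : `|E (fun w => om w * kap (arg z w)) -
    E (fun w => om w * kap (arg Dd w))| <= L^-1 * (2 * (Kq * E q2)).
  rewrite -ExB; [|exact: ik|exact: ik].
  pose b w := L^-1 * (q2 w * kap (arg Dd w) + q2 w * kap (arg z w)).
  have ib : L1 b by apply: L1Z; apply: L1D; exact: ik.
  apply: (@le_trans _ _ (E b)).
    apply: Ex_abs_le => //; first by apply: L1B; exact: ik.
    move=> w; have := kap_lip (arg Dd w) (arg z w).
    rewrite -mulrBr normrM (ger0_norm (om0 w)) distrC => /(ler_wpM2l (om0 w)).
    move=> /le_trans; apply.
    rewrite (_ : arg Dd w - arg z w = Dd w / L); last by rewrite argD0; ring.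
    rewrite /b /q2 normrM normfV (gtr0_norm L0).
    have -> : L^-1 * (om w * B w * kap (arg Dd w) + om w * B w * kap (arg z w)) =
      om w * (B w / L * (kap (arg Dd w) + kap (arg z w))) by ring.
    apply: ler_wpM2l => //; apply: ler_wpM2r; first by rewrite addr_ge0 ?kap_ge0.
    by rewrite ler_wpM2r// invr_ge0 ltW.
  rewrite ExZ; last by apply: L1D; exact: ik.
  apply: ler_wpM2l; first by rewrite invr_ge0 ltW.
  rewrite ExD; [|exact: ik|exact: ik].
  have h1 := use q2 Dd aq2 aD q20 iq2; have h2 := use q2 z aq2 a0 q20 iq2.
  apply: (@le_trans _ _ (Kq * E q2 + Kq * E q2)); first exact: lerD.
  by rewrite le_eqVlt; apply/orP; left; apply/eqP; ring.
have EXY : `|E (fun w => X i w * Y w)| <= 5 * M * m%:R.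
  apply: (@le_trans _ _ (E (fun w => `|X i w| * B w))).
    apply: Ex_abs_le; [exact: iXS|exact: iXB|].
    by move=> w; rewrite normrM ler_wpM2l.
  apply: le_trans (Ex_X_absseg X_meas M_ge1 X_L3 X_M3 _ _ _) _.
  apply: (@le_trans _ _ (M * (5 * m%:R))); first by rewrite ler_wpM2l.
  by rewrite le_eqVlt; apply/orP; left; apply/eqP; ring.
have -> : E (fun w => om w * X i w * (L * softsign (arg Dd w))) -
    E (fun w => X i w * Y w) * E (fun w => om w * kap (arg Dd w)) =
    (E t1 - E t3) + E (fun w => X i w * Y w) *
    (E (fun w => om w * kap (arg z w)) - E (fun w => om w * kap (arg Dd w))).
  by rewrite Et3 /t1; ring.
apply: le_trans (ler_normD _ _) _; rewrite normrM.
have Kq0 : 0 <= Kq by rewrite !mulr_ge0 ?invr_ge0 ?sqrtr_ge0// ltW.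
have L'0 : 0 <= L^-1 by rewrite invr_ge0 ltW.
apply: (@le_trans _ _ (L^-1 * (4 * (Kq * (E om * (25 * M * m%:R ^+ 2)))) +
  (5 * M * m%:R) * (L^-1 * (2 * (Kq * (E om * (5 * M * m%:R))))))).
  apply: lerD.
    apply: le_trans step1 _; rewrite ler_wpM2l// ler_wpM2l// ler_wpM2l//.
  apply: ler_pM => //; apply: le_trans step2 _.
  by rewrite ler_wpM2l// ler_wpM2l// ler_wpM2l//.
(* Since [M <= M ^+ 2] and [Kq] contains a factor 2, the constant is
   [2 * (100 + 50) = 300]. *)
have -> : L^-1 * (4 * (Kq * (E om * (25 * M * m%:R ^+ 2)))) +
  (5 * M * m%:R) * (L^-1 * (2 * (Kq * (E om * (5 * M * m%:R))))) =
  (L^-1 * Kq * E om * m%:R ^+ 2) * (100 * M + 50 * M ^+ 2) by ring.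
have -> : 300 * D * M ^+ 2 * m%:R ^+ 2 / Num.sqrt n%:R * E om =
  (L^-1 * Kq * E om * m%:R ^+ 2) * (150 * M ^+ 2).
  rewrite /Kq.
  have -> : L^-1 * (2 * D * L / Num.sqrt n%:R) = 2 * D / Num.sqrt n%:R.
    have sn0 : (0 : R) < Num.sqrt n%:R by rewrite sqrtr_gt0 ltr0n; clear -nm; lia.
    by field; rewrite !gt_eqF.
  by ring.
apply: ler_wpM2l; first by apply: mulr_ge0 (sqr_ge0 _); apply: mulr_ge0 => //; exact: mulr_ge0.
have M2 : M <= M ^+ 2 by rewrite expr2 ler_peMl.
lra.
Qed.

Lemma Ex_Xseg_far i a b (A : set nat) :
  (forall k, A k -> (i <= k <= i + m)%N -> False) -> ad A (seg a b) ->
  E (fun w => X i w * seg a b w) = 0.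
Proof.
move=> dis aS.
rewrite (Ex_adM eps_indep pos_inj _ (@X_ad i) aS) ?X_mean ?mul0r//.
by move=> k /= /[swap]; exact: dis.
Qed.

(** By [m]-dependence only the terms within [m] of [i] are correlated with [X i]. *)
Lemma Ex_X_local i a b : (a + m <= i)%N -> (i + m < b)%N ->
  E (fun w => X i w * seg a b w) =
  E (fun w => X i w * seg (i - m) (i + m + 1) w).
Proof.
move=> ai ib.
have -> : (fun w => X i w * seg a b w) = fun w => X i w * seg a (i - m) w +
    (X i w * seg (i - m) (i + m + 1) w + X i w * seg (i + m + 1) b w).
  apply/funext => w; rewrite -!mulrDr; congr (_ * _).
  rewrite (@seg_cat _ _ _ X a (i - m) b); [|clear -ai; lia|clear -ai ib; lia].
  by rewrite (@seg_cat _ _ _ X (i - m) (i + m + 1) b)//; clear -ib; lia.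
rewrite ExD//; last by apply: L1D; exact: iXS.
rewrite ExD//.
rewrite (@Ex_Xseg_far i a (i - m) [set k | (k < i)%N]); first last.
- by apply: seg_ad => k /=; clear -ai; lia.
- by move=> k /=; clear; lia.
rewrite (@Ex_Xseg_far i (i + m + 1) b [set k | (i + m < k)%N]); first last.
- by apply: seg_ad => k /=; clear; lia.
- by move=> k /=; clear; lia.
by rewrite add0r addr0.
Qed.

(** From [2 * Si * S >= S ^+ 2 + Si ^+ 2 - 2 * (Sl ^+ 2 + Sr ^+ 2)] when
    [S = Sl + Si + Sr], where the two ends have variance of order [m]. *)
Lemma Ex_inner_outer a n : (12 * m + 2 <= n)%N -> (n0 + 4 * m <= n)%N ->
  (n <= N)%N -> (4 * c + 8 * C1 ^+ 2) * m%:R <= c * n%:R ->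
  c * n%:R / 2 <=
  E (fun w => seg (a + 2 * m) (a + n - 2 * m) w * seg a (a + n) w).
Proof.
move=> nm nn0 nN cn.
pose S := seg a (a + n); pose Si := seg (a + 2 * m) (a + n - 2 * m).
pose Sl := seg a (a + 2 * m); pose Sr := seg (a + n - 2 * m) (a + n - 2 * m + 2 * m).
have SE w : S w = Sl w + Si w + Sr w.
  rewrite /S (@seg_cat _ _ _ X a (a + 2 * m) (a + n)); [|lia|lia].
  rewrite (@seg_cat _ _ _ X (a + 2 * m) (a + n - 2 * m) (a + n)); [|lia|lia].
  rewrite /Sr (_ : (a + n - 2 * m + 2 * m)%N = (a + n)%N); last by lia.
  by rewrite addrA.
have iSiS : L1 (fun w => Si w * S w) by exact: (L1_segM X_meas M_ge1 X_L3 X_M3).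
have ptw w : S w ^+ 2 + Si w ^+ 2 - 2 * (Sl w ^+ 2 + Sr w ^+ 2) <= 2 * (Si w * S w).
  rewrite SE -subr_ge0.
  have -> : 2 * (Si w * (Sl w + Si w + Sr w)) - ((Sl w + Si w + Sr w) ^+ 2 +
    Si w ^+ 2 - 2 * (Sl w ^+ 2 + Sr w ^+ 2)) = (Sl w - Sr w) ^+ 2 by ring.
  exact: sqr_ge0.
have lS : c * n%:R <= E (fun w => S w ^+ 2).
  by apply: (@seg_lb a n); clear -nn0 nN; lia.
have lSi : c * n%:R - 4 * c * m%:R <= E (fun w => Si w ^+ 2).
  have -> : c * n%:R - 4 * c * m%:R = c * (n - 4 * m)%:R.
    by rewrite natrB ?natrM; [ring|lia].
  have -> : Si = seg (a + 2 * m) (a + 2 * m + (n - 4 * m)).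
    by rewrite /Si; congr (seg _ _); lia.
  by apply: seg_lb; lia.
have ul : E (fun w => Sl w ^+ 2) <= 2 * C1 ^+ 2 * m%:R.
  by rewrite mulrAC mulrC -natrM; apply: seg_ub; lia.
have ur : E (fun w => Sr w ^+ 2) <= 2 * C1 ^+ 2 * m%:R.
  by rewrite mulrAC mulrC -natrM; apply: seg_ub; lia.
have := Ex_le (L1B (L1D (iSS a (a + n)) (iSS (a + 2 * m) (a + n - 2 * m)))
  (L1Z 2 (L1D (iSS a (a + 2 * m)) (iSS (a + n - 2 * m) (a + n - 2 * m + 2 * m)))))
  (L1Z 2 iSiS) ptw.
rewrite ExB; [|exact: L1D|by apply: L1Z; exact: L1D].
rewrite ExD// ExZ//; last exact: L1D.
rewrite ExD// ExZ//.
rewrite -/S -/Si -/Sl -/Sr.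
move: lS lSi ul ur cn.
set e1 := E (fun w => S w ^+ 2); set e2 := E (fun w => Si w ^+ 2).
set e3 := E (fun w => Sl w ^+ 2); set e4 := E (fun w => Sr w ^+ 2).
set e5 := E (fun w => Si w * S w).
set u := C1 ^+ 2 * m%:R; set v := c * m%:R; set t := c * n%:R.
rewrite (_ : 2 * C1 ^+ 2 * m%:R = 2 * u); last by rewrite /u; ring.
rewrite (_ : 4 * c * m%:R = 4 * v); last by rewrite /v; ring.
rewrite (_ : (4 * c + 8 * C1 ^+ 2) * m%:R = 4 * v + 8 * u); last by rewrite /u /v; ring.
clearbody e1 e2 e3 e4 e5 u v t.
lra.
Qed.

(** With [Si] the inner part of the block sum, [om * Si * L * softsign x] has mean at
    most [E om * C1 * sqrt n * L] in absolute value.  By [interior_term] this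
    mean is [E (Si * S)] times the concentration quantity [k0], up to [n]
    times the error for one term, and [E (Si * S) >= c * n / 2].  The last
    hypothesis says that the resulting bound for [k0] is the claimed one. *)
Lemma conc_step L D n :
  0 < L -> 0 <= D -> (forall n', (0 < n' < n)%N -> Conc L D n') ->
  (12 * m + 2 <= n)%N -> (n0 + 4 * m <= n)%N -> (n <= N)%N ->
  (4 * c + 8 * C1 ^+ 2) * m%:R <= c * n%:R ->
  2 * (C1 * L + 300 * D * M ^+ 2 * m%:R ^+ 2) <= c * (D * L) ->
  Conc L D n.
Proof.
move=> L0 D0 IH nm nn0 nN cn cst a om H aom aH om0 iom.
pose x w := (H w + seg a (a + n) w) / L.
pose Si := seg (a + 2 * m) (a + n - 2 * m).
have mom := ad_meas aom; have mH := ad_meas aH.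
have mx : measurable_fun [set: T] x.
  apply: measurable_funM => //; apply: measurable_funD => //.
  exact: measurable_seg.
have mg : measurable_fun [set: T] (fun w => L * softsign (x w)).
  by apply: measurable_funM => //; exact: (measurableT_comp measurable_softsign).
have gL w : `|L * softsign (x w)| <= L.
  rewrite normrM (gtr0_norm L0) -[leRHS]mulr1.
  by apply: ler_wpM2l; [exact: ltW|exact: softsign_le1].
have dis k : ~~ (a <= k < a + n + m)%N -> (a <= k < a + n + m)%N -> False.
  by move=> /negbTE ->.
have aX i : (a + 2 * m <= i < a + n - 2 * m)%N ->
    ad [set k | (a <= k < a + n + m)%N] (X i).
  by move=> hi; apply: X_adS => k /=; clear -hi; lia.
have aSi : ad [set k | (a <= k < a + n + m)%N] Si.
  by apply: seg_ad => k /=; clear; lia.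
have iomX i : (a + 2 * m <= i < a + n - 2 * m)%N -> L1 (fun w => om w * X i w).
  by move=> hi; exact: (L1_adM eps_indep pos_inj dis aom (aX i hi)).
pose k0 := E (fun w => om w * kap (x w)).
have k00 : 0 <= k0 by apply: Ex_ge0 => w; rewrite mulr_ge0 ?kap_ge0.
have Eom0 : 0 <= E om by exact: Ex_ge0.
pose r := Num.sqrt n%:R : R.
have r0 : 0 < r by rewrite sqrtr_gt0 ltr0n; clear -nm; lia.
have r2 : r ^+ 2 = n%:R by rewrite sqr_sqrtr ?ler0n.
pose err := 300 * D * M ^+ 2 * m%:R ^+ 2 / r * E om.
have err0 : 0 <= err.
  apply: mulr_ge0 Eom0; apply: divr_ge0; last exact: ltW.
  apply: mulr_ge0 (sqr_ge0 _); apply: mulr_ge0 (sqr_ge0 _).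
  by apply: mulr_ge0 D0; exact: ler0n.
pose tt i w := om w * X i w * (L * softsign (x w)).
have itt i : (a + 2 * m <= i < a + n - 2 * m)%N -> L1 (tt i).
  by move=> hi; apply: (@L1_Mbounded _ _ _ _ _ _ L) => //; exact: iomX.
have terms : `|\sum_(a + 2 * m <= i < a + n - 2 * m) E (tt i) -
    E (fun w => Si w * seg a (a + n) w) * k0| <= n%:R * err.
  have -> : E (fun w => Si w * seg a (a + n) w) =
      \sum_(a + 2 * m <= i < a + n - 2 * m)
        E (fun w => X i w * seg (i - m) (i + m + 1) w).
    have -> : (fun w => Si w * seg a (a + n) w) =
        fun w => \sum_(a + 2 * m <= i < a + n - 2 * m) X i w * seg a (a + n) w.
      by apply/funext => w; rewrite {1}/Si {1}/seg mulr_suml.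
    rewrite Ex_sum; last by move=> i _; exact: iXS.
    rewrite big_nat [RHS]big_nat; apply: eq_bigr => i hi.
    by apply: Ex_X_local; clear -hi; lia.
  rewrite mulr_suml -sumrB; apply: le_trans (ler_norm_sum _ _ _) _.
  apply: (@le_trans _ _ (\sum_(a + 2 * m <= i < a + n - 2 * m) err)).
    rewrite big_nat [leRHS]big_nat; apply: ler_sum => i hi.
    by apply: interior_term => //; clear -hi; lia.
  rewrite sumr_const_nat -(mulr_natl err); apply: ler_wpM2r => //.
  by rewrite ler_nat; clear; lia.
have [iSi ESi] : L1 Si /\ E (fun w => `|Si w|) <= C1 * r.
  apply: Ex_abs_le_sqr.
  - exact: mulr_gt0.
  - exact: measurable_seg.
  - exact: iSS.
  - rewrite exprMn r2.
    have -> : Si = seg (a + 2 * m) (a + 2 * m + (n - 4 * m)).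
      by rewrite /Si; congr (seg _ _); clear -nm; lia.
    apply: (@le_trans _ _ (C1 ^+ 2 * (n - 4 * m)%:R)).
      by apply: seg_ub; clear -nm nN; lia.
    by apply: ler_wpM2l; [exact: sqr_ge0|rewrite ler_nat; clear; lia].
have bigsum : `|\sum_(a + 2 * m <= i < a + n - 2 * m) E (tt i)| <=
    E om * (C1 * r) * L.
  have -> : \sum_(a + 2 * m <= i < a + n - 2 * m) E (tt i) =
      E (fun w => om w * Si w * (L * softsign (x w))).
    transitivity (E (fun w => \sum_(a + 2 * m <= i < a + n - 2 * m |
        (a + 2 * m <= i < a + n - 2 * m)%N) tt i w)).
      by rewrite Ex_sum// [LHS]big_nat.
    congr Ex; apply/funext => w; rewrite -big_nat /Si /seg mulr_sumr mulr_suml.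
    by [].
  have iomSi : L1 (fun w => om w * Si w).
    exact: (L1_adM eps_indep pos_inj dis aom aSi).
  have aSi' := adapted_abs aSi; have iSi' := L1_abs iSi.
  have iomSi' : L1 (fun w => om w * `|Si w|).
    exact: (L1_adM eps_indep pos_inj dis aom aSi').
  apply: (@le_trans _ _ (E (fun w => om w * `|Si w| * L))).
    apply: Ex_abs_le.
    - by apply: (@L1_Mbounded _ _ _ _ _ _ L).
    - exact: L1Zr.
    - move=> w; rewrite normrM normrM (ger0_norm (om0 w)).
      by apply: ler_wpM2l; [rewrite mulr_ge0|exact: gL].
  rewrite ExZr//; apply: ler_wpM2r; first exact: ltW.
  rewrite (Ex_adM eps_indep pos_inj dis aom aSi')//.
  exact: ler_wpM2l.
have low := Ex_inner_outer a nm nn0 nN cn.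
have key : c * n%:R / 2 * k0 <= E om * (C1 * r) * L + n%:R * err.
  apply: le_trans (ler_wpM2r k00 low) _.
  move: terms bigsum.
  set s1 := \sum_(_ <= i < _) _; set s2 := E (fun w => Si w * _) * k0.
  move=> h1 h2; have h3 : s2 <= `|s1| + `|s1 - s2|.
    by rewrite -[leLHS](subrK s1) addrC distrC lerD// ler_norm.
  by apply: le_trans h3 _; exact: lerD.
have E1 : n%:R * err = r * (300 * D * M ^+ 2 * m%:R ^+ 2) * E om.
  by rewrite /err -r2; field; rewrite gt_eqF.
have E2 : c * n%:R / 2 * k0 = r * (c * r / 2 * k0) by rewrite -r2; ring.
rewrite E1 E2 in key.
have {}key : c * r / 2 * k0 <= E om * (C1 * L + 300 * D * M ^+ 2 * m%:R ^+ 2).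
  rewrite -(ler_pM2l r0); apply: le_trans key _.
  by rewrite le_eqVlt; apply/orP; left; apply/eqP; ring.
rewrite -/x -/k0 -/r.
rewrite -(ler_pM2l (_ : 0 < c * r / 2)); last by rewrite divr_gt0// mulr_gt0.
apply: le_trans key _.
have -> : c * r / 2 * (D * L / r * E om) = E om * (c * (D * L) / 2).
  by field; rewrite gt_eqF.
apply: ler_wpM2l => //; rewrite ler_pdivlMr// mulrC.
exact: cst.
Qed.

(** The width is chosen so that the error term of [conc_step], of order [D * m ^+ 2],
    is absorbed by [c * D * L]; the rate so that its main term [C1 * L] is
    absorbed as well, and so that blocks violating the other hypotheses of
    [conc_step] satisfy [sqrt n <= D * L].  The constant 1200 is 4 times the
    constant of [interior_term]. *)
Definition conc_width : R := (1200 * M ^+ 2 / c + 1) * m%:R ^+ 2.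
Definition conc_rate : R := 4 * C1 / c + 16 * C1 ^+ 2 / c + n0%:R + 20.

Lemma conc_factor_ge1 : 1 <= 1200 * M ^+ 2 / c + 1.
Proof.
rewrite lerDr; apply: divr_ge0; last exact: ltW.
by apply: mulr_ge0 (sqr_ge0 _); exact: ler0n.
Qed.

Lemma conc_width_gt0 : 0 < conc_width.
Proof.
apply: mulr_gt0; last by rewrite exprn_gt0// ltr0n.
exact: lt_le_trans ltr01 conc_factor_ge1.
Qed.

Let rate1_ge0 : 0 <= 4 * C1 / c.
Proof. by apply: divr_ge0 (ltW c_gt0); exact: mulr_ge0 (ler0n _ _) (ltW C1_gt0). Qed.

Let rate2_ge0 : 0 <= 16 * C1 ^+ 2 / c.
Proof. by apply: divr_ge0 (ltW c_gt0); exact: mulr_ge0 (ler0n _ _) (sqr_ge0 _). Qed.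

Lemma conc_rate_ge20 : 20 <= conc_rate.
Proof.
rewrite /conc_rate lerDr; apply: addr_ge0 (ler0n _ _).
exact: addr_ge0.
Qed.

(** Strong induction on [n], trivial as long as [sqrt n <= D * L] since [kap] is at
    most 1. *)
Lemma conc_all n : (0 < n <= N)%N -> Conc conc_width conc_rate n.
Proof.
elim/ltn_ind: n => n IH /andP[n1 nN].
pose L := conc_width; pose D := conc_rate.
have L0 : 0 < L := conc_width_gt0.
have D20 : 20 <= D := conc_rate_ge20.
have D0 : 0 <= D by exact: le_trans D20.
pose r := Num.sqrt n%:R : R.
have r0 : 0 < r by rewrite sqrtr_gt0 ltr0n.
have r2 : r ^+ 2 = n%:R by rewrite sqr_sqrtr ?ler0n.
have [rs|rl] := leP r (D * L).
  move=> a om H aom aH om0 iom; have Eom0 : 0 <= E om by exact: Ex_ge0.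
  apply: (@le_trans _ _ (E om)).
    apply: Ex_le => //.
      apply: L1_Mkap => //; apply: measurable_funM => //.
      by apply: measurable_funD; [exact: (ad_meas aH)|exact: measurable_seg].
    by move=> w; rewrite ler_piMr ?kap_le1.
  by rewrite ler_peMl// ler_pdivlMr// mul1r.
have m1 : 1 <= m%:R :> R by rewrite ler1n.
have mL : m%:R <= L.
  rewrite /L /conc_width; apply: (@le_trans _ _ (1 * m%:R ^+ 2)).
    by rewrite mul1r expr2 ler_peMl// (le_trans ler01).
  by apply: ler_wpM2r; [exact: sqr_ge0|exact: conc_factor_ge1].
have Dmn : D * m%:R <= n%:R.
  have Dm1 : 1 <= D * m%:R.
    by rewrite (le_trans _ (ler_pM _ _ D20 m1))//; lra.
  have Dmr : D * m%:R <= r.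
    by apply: le_trans (ltW rl); exact: ler_wpM2l.
  rewrite -r2 expr2; apply: (@le_trans _ _ (1 * r)); first by rewrite mul1r.
  by apply: ler_wpM2r; [exact: ltW|exact: le_trans Dm1 Dmr].
have Dm n' : n'%:R <= D * m%:R -> (n' <= n)%N.
  by move=> h; rewrite -(ler_nat R) (le_trans h).
have m0 : 0 <= m%:R :> R by rewrite ler0n.
have nn : 0 <= n0%:R :> R by rewrite ler0n.
have DE : D * m%:R = 4 * C1 / c * m%:R + 16 * C1 ^+ 2 / c * m%:R +
    n0%:R * m%:R + 20 * m%:R by rewrite /D /conc_rate; ring.
have c1m : 0 <= 4 * C1 / c * m%:R by exact: mulr_ge0 rate1_ge0 m0.
have c2m : 0 <= 16 * C1 ^+ 2 / c * m%:R by exact: mulr_ge0 rate2_ge0 m0.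
have n0m : n0%:R <= n0%:R * m%:R :> R by rewrite ler_peMr.
apply: conc_step => //.
- move=> n' /andP[n'0 n'n]; apply: IH => //; rewrite n'0/=.
  by rewrite (leq_trans (ltnW n'n)).
- by apply: Dm; rewrite natrD natrM; move: DE c1m c2m n0m m1 nn;
    set t1 := 4 * _ / _ * _; set t2 := 16 * _ / _ * _; lra.
- by apply: Dm; rewrite natrD natrM; move: DE c1m c2m n0m m1 nn;
    set t1 := 4 * _ / _ * _; set t2 := 16 * _ / _ * _; lra.
- apply: (@le_trans _ _ (c * (D * m%:R))); last first.
    by apply: ler_wpM2l => //; exact: ltW.
  have -> : c * (D * m%:R) = 4 * C1 * m%:R + 16 * C1 ^+ 2 * m%:R +
      c * (n0%:R * m%:R) + 20 * c * m%:R.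
    by rewrite /D /conc_rate; field; rewrite gt_eqF.
  have t1 : 0 <= C1 * m%:R by rewrite mulr_ge0// ltW.
  have t2 : 0 <= C1 ^+ 2 * m%:R by rewrite mulr_ge0// sqr_ge0.
  have t3 : 0 <= c * (n0%:R * m%:R) by rewrite mulr_ge0 ?mulr_ge0// ltW.
  have t4 : 0 <= c * m%:R by rewrite mulr_ge0// ltW.
  lra.
- have -> : c * (conc_rate * conc_width) =
    conc_rate * conc_width * c by ring.
  have h1 : 4 * C1 * L <= D * L * c.
    rewrite (mulrAC D); apply: ler_wpM2r; first exact: ltW.
    have -> : D * c = 4 * C1 + (16 * C1 ^+ 2 + n0%:R * c + 20 * c).
      by rewrite /D /conc_rate; field; rewrite gt_eqF.
    have := mulr_ge0 nn (ltW c_gt0); have := sqr_ge0 C1; have := c_gt0; lra.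
  have h2 : 1200 * D * M ^+ 2 * m%:R ^+ 2 <= D * L * c.
    have -> : D * L * c = D * (1200 * M ^+ 2 + c) * m%:R ^+ 2.
      by rewrite /L /conc_width; field; rewrite gt_eqF.
    apply: ler_wpM2r; first exact: sqr_ge0.
    rewrite -mulrA mulrCA; apply: ler_wpM2l => //.
    by rewrite lerDl ltW.
  rewrite -/D -/L.
  have -> : 2 * (C1 * L + 300 * D * M ^+ 2 * m%:R ^+ 2) =
    2^-1 * (4 * C1 * L) + 2^-1 * (1200 * D * M ^+ 2 * m%:R ^+ 2) by field.
  move: h1 h2; set u1 := 4 * C1 * L; set u2 := 1200 * D * _ * _; set u3 := D * L * c.
  clearbody u1 u2 u3; lra.
Qed.

Lemma between_dist (p q u v : R) : Num.min p q <= u <= Num.max p q ->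
  `|u - v| <= `|q - v| + `|p - v|.
Proof.
rewrite ge_min le_max => /andP[lo hi].
have q1 := ler_norm (q - v); have q2 := ler_norm (v - q); rewrite distrC in q2.
have p1 := ler_norm (p - v); have p2 := ler_norm (v - p); rewrite distrC in p2.
move: q1 q2 p1 p2; set a := `|q - v|; set b := `|p - v|; clearbody a b => *.
by rewrite ler_norml; case/orP: lo => ?; case/orP: hi => ?; apply/andP; split; lra.
Qed.

Section berry_esseen.
Variables (n : nat) (B z : R).
Hypothesis n_big : (12 * m + 2 <= n)%N.
Hypothesis nN : (n <= N)%N.
Hypothesis B_gt0 : 0 < B.
Hypothesis B_lb : c * n%:R <= B ^+ 2.

Local Notation Lam := conc_width.
Local Notation rate := conc_rate.
Local Notation S := (seg 0 n).

Let s : R := Num.sqrt n%:R.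

Let hz (x : R) : R := ramp ((x - z) / (Lam / B)).

Let s_gt0 : 0 < s.
Proof. by rewrite sqrtr_gt0 ltr0n; clear -n_big; lia. Qed.

Let s2 : s ^+ 2 = n%:R.
Proof. by rewrite sqr_sqrtr ?ler0n. Qed.

Let b_gt0 : 0 < Num.sqrt c.
Proof. by rewrite sqrtr_gt0. Qed.

Let bs_le : Num.sqrt c * s <= B.
Proof.
have B0 : 0 <= B by exact: ltW.
rewrite -(@ler_pXn2r _ 2) ?nnegrE ?mulr_ge0 ?sqrtr_ge0//.
by rewrite exprMn s2 (sqr_sqrtr (ltW c_gt0)).
Qed.

Let eps0 : 0 < Lam / B.
Proof. by rewrite divr_gt0// conc_width_gt0. Qed.

(** In terms of the sum itself the ramp has width [Lam], the scale at which
    concentration is known. *)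
Let hzE x : hz (x / B) = ramp ((x - z * B) / Lam).
Proof.
rewrite /hz; congr ramp; field.
by rewrite !gt_eqF// conc_width_gt0.
Qed.

Let hz_cont : continuous hz.
Proof.
move=> x; apply: (@cvg_comp _ _ _ (fun y : R => (y - z) / (Lam / B)) ramp).
  apply: cvgM; last exact: cvg_cst.
  by apply: cvgB; [exact: cvg_id|exact: cvg_cst].
exact: continuous_ramp.
Qed.

Let hz0 x : 0 <= hz x. Proof. exact: ramp_ge0. Qed.
Let hz1 x : hz x <= 1. Proof. exact: ramp_le1. Qed.

Let hz_nincr x y : x <= y -> hz y <= hz x.
Proof. by move=> xy; apply: ramp_nincr; rewrite ler_pM2r ?invr_gt0// lerB. Qed.

Local Notation f := (stein hz).
Local Notation f' := (stein' hz).

Let mf : measurable_fun [set: R] f.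
Proof. exact: (measurable_stein hz_cont hz0 hz1). Qed.

Let mf' : measurable_fun [set: R] f'.
Proof. exact: (measurable_stein' hz_cont hz0 hz1). Qed.

Definition gap_rate : R := 6 * C1 / c + 4 / Num.sqrt c + 36 * rate.

Let B'0 : 0 <= B^-1. Proof. by rewrite invr_ge0 ltW. Qed.

Lemma Ex_abs_seg a b : (b <= a + n)%N -> E (fun w => `|seg a b w|) <= C1 * s.
Proof.
move=> ban; have s0 := s_gt0; have [ab|ba] := ltnP a b; last first.
  rewrite (_ : (fun w => _) = fun=> 0) ?Ex_cst ?mulr_ge0 ?ltW//.
  by apply/funext => w; rewrite seg_nil ?normr0.
have C1s : 0 < C1 * s by rewrite mulr_gt0.
case: (@Ex_abs_le_sqr _ _ _ P (seg a b) _ C1s _ (iSS a b)) => //.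
  exact: measurable_seg.
rewrite exprMn s2 (_ : b = a + (b - a))%N; last by clear -ab; lia.
apply: (@le_trans _ _ (C1 ^+ 2 * (b - a)%:R)).
  by apply: seg_ub; clear -ab ban nN; lia.
by rewrite ler_wpM2l ?sqr_ge0// ler_nat; clear -ban; lia.
Qed.

(** [Y] and [D] are the sums within [m] and [2 * m] of [i], [Wi] and [W3] the sums
    beyond [2 * m] and [3 * m].  [Wi] is independent of [X i * Y], and [W3] of
    everything that carries labels in [W], such as [Y], [D] and [Db].  The
    minima with [n] cut the windows at the right end; truncated subtraction cuts
    them at the left end. *)
Section one_term.
Variable i : nat.
Hypothesis i_lt : (i < n)%N.

Let W := [set k : nat | (i <= k + 2 * m)%N && (k <= i + 3 * m)%N].
Let Y := seg (i - m) (minn n (i + m + 1)).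
Let D := seg (i - 2 * m) (minn n (i + 2 * m + 1)).
Let Db := absseg (i - 2 * m) (i + 2 * m + 1).
Let Eb := absseg (i - 3 * m) (i + 3 * m + 1).
Let Wi w := seg 0 (i - 2 * m) w + seg (i + 2 * m + 1) n w.
Let W3 w := seg 0 (i - 3 * m) w + seg (i + 3 * m + 1) n w.

Let seg_minn a w : seg (minn n a) n w = seg a n w.
Proof.
rewrite /minn; case: ltnP => // na; rewrite !seg_nil//; exact: ltnW.
Qed.

Let split_at k w : seg 0 n w = seg 0 (i - k) w +
  (seg (i - k) (minn n (i + k + 1)) w + seg (i + k + 1) n w).
Proof.
rewrite -(seg_minn (i + k + 1)) (@seg_cat _ _ _ X 0 (i - k) n)//; last by clear -i_lt; lia.
by rewrite (@seg_cat _ _ _ X (i - k) (minn n (i + k + 1)) n)//; clear -i_lt; lia.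
Qed.

Let SD w : seg 0 n w = Wi w + D w.
Proof. by rewrite (split_at (2 * m)) /Wi /D; ring. Qed.

Let SE3 w : `|seg 0 n w - W3 w| <= Eb w.
Proof.
rewrite (split_at (3 * m)) /W3.
rewrite (_ : _ - _ = seg (i - 3 * m) (minn n (i + 3 * m + 1)) w); last by ring.
apply: le_trans (seg_le_absseg _ _ _ _) _; apply: absseg_sub => //.
exact: geq_minr.
Qed.

Let SY w : seg 0 n w - Y w = seg 0 (i - m) w + seg (i + m + 1) n w.
Proof. by rewrite (split_at m) /Y; ring. Qed.

Let DY0 w : `|D w - Y w| <= absseg (i - 2 * m) (minn n (i + 2 * m + 1)) w.
Proof.
have -> : D w - Y w = seg (i - 2 * m) (i - m) w +
    seg (minn n (i + m + 1)) (minn n (i + 2 * m + 1)) w.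
  rewrite /D (@seg_cat _ _ _ X _ (i - m)); [|clear; lia|clear -i_lt; lia].
  rewrite (@seg_cat _ _ _ X _ (minn n (i + m + 1)) (minn n (i + 2 * m + 1)));
    [|clear -i_lt; lia|clear; lia].
  by rewrite /Y; ring.
apply: le_trans (ler_normD _ _) _.
apply: (@le_trans _ _ (absseg (i - 2 * m) (i - m) w +
    absseg (minn n (i + m + 1)) (minn n (i + 2 * m + 1)) w)).
  by apply: lerD; exact: seg_le_absseg.
rewrite (@absseg_cat _ _ _ X (i - 2 * m) (i - m) (minn n (i + 2 * m + 1)));
  [|clear; lia|clear -i_lt; lia].
rewrite (@absseg_cat _ _ _ X (i - m) (minn n (i + m + 1)) (minn n (i + 2 * m + 1)));
  [|clear -i_lt; lia|clear; lia].
by rewrite lerD2l lerDr absseg_ge0.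
Qed.

Let DY w : `|D w - Y w| <= Db w.
Proof. by apply: le_trans (DY0 w) _; apply: absseg_sub => //; exact: geq_minr. Qed.

Let YB w : `|Y w| <= Db w.
Proof.
apply: le_trans (seg_le_absseg _ _ _ _) _; apply: absseg_sub; clear; lia.
Qed.

Let DB w : `|D w| <= Db w.
Proof.
apply: le_trans (seg_le_absseg _ _ _ _) _; apply: absseg_sub; clear; lia.
Qed.

Let ring_le w : absseg (i - 2 * m) (minn n (i + 2 * m + 1)) w +
    (absseg (i - 3 * m) (i - 2 * m) w +
     absseg (minn n (i + 2 * m + 1)) (minn n (i + 3 * m + 1)) w) <= Eb w.
Proof.
apply: (@le_trans _ _ (absseg (i - 3 * m) (minn n (i + 3 * m + 1)) w)); last first.
  by apply: absseg_sub => //; exact: geq_minr.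
rewrite (@absseg_cat _ _ _ X (i - 3 * m) (i - 2 * m) (minn n (i + 3 * m + 1)));
  [|clear; lia|clear -i_lt; lia].
rewrite (@absseg_cat _ _ _ X (i - 2 * m) (minn n (i + 2 * m + 1)) (minn n (i + 3 * m + 1)));
  [|clear -i_lt; lia|clear; lia].
by rewrite addrCA addrA.
Qed.

Let SYE3 w : `|seg 0 n w - Y w - W3 w| <= Eb w.
Proof.
have -> : seg 0 n w - Y w - W3 w =
    (D w - Y w) + (seg (i - 3 * m) (i - 2 * m) w +
    seg (minn n (i + 2 * m + 1)) (minn n (i + 3 * m + 1)) w).
  rewrite (split_at (3 * m)) /W3.
  rewrite (@seg_cat _ _ _ X (i - 3 * m) (i - 2 * m) (minn n (i + 3 * m + 1)));
    [|clear; lia|clear -i_lt; lia].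
  rewrite (@seg_cat _ _ _ X (i - 2 * m) (minn n (i + 2 * m + 1)) (minn n (i + 3 * m + 1)));
    [|clear -i_lt; lia|clear; lia].
  by rewrite /D; ring.
apply: le_trans (ler_normD _ _) _.
apply: (@le_trans _ _ (absseg (i - 2 * m) (minn n (i + 2 * m + 1)) w +
    (absseg (i - 3 * m) (i - 2 * m) w +
     absseg (minn n (i + 2 * m + 1)) (minn n (i + 3 * m + 1)) w))).
  apply: lerD; first exact: DY0.
  apply: le_trans (ler_normD _ _) _; apply: lerD; exact: seg_le_absseg.
apply: le_trans (ring_le w).
by rewrite le_refl.
Qed.

Let aWY : ad W Y.
Proof. by apply: seg_ad => k; rewrite /W /=; clear; lia. Qed.

Let aWD : ad W D.
Proof. by apply: seg_ad => k; rewrite /W /=; clear; lia. Qed.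

Let aWDb : ad W Db.
Proof. by apply: absseg_ad => k; rewrite /W /=; clear; lia. Qed.

Let aWX : ad W (X i).
Proof. by apply: X_adS => k; rewrite /W /=; clear; lia. Qed.

Let aW3 : ad (~` W) W3.
Proof.
by apply: adaptedD; apply: seg_ad => k; rewrite /setC /W /=; clear; lia.
Qed.

Let disW k : W k -> (~` W) k -> False.
Proof. by []. Qed.

Let w3 w := W3 w / B.

(** Bounds the variation of [f'] between [Wi / B] and any point that Taylor's formula
    may produce between [(S - Y) / B] and [S / B]. *)
Let gap w := (3 * `|w3 w| * Db w + 4 * Eb w) / B +
  (`|hz (S w / B) - hz (Wi w / B)| + `|hz ((S w - Y w) / B) - hz (Wi w / B)|).

Let stein'_gap x w : `|x - w3 w| <= Eb w / B -> `|x - Wi w / B| <= Db w / B ->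
  `|f' x - f' (Wi w / B)| <= (3 * `|w3 w| * Db w + 4 * Eb w) / B +
  `|hz x - hz (Wi w / B)|.
Proof.
move=> h1 h2.
have h3 : `|Wi w / B - w3 w| <= Eb w / B.
  rewrite -mulrBl normrM (ger0_norm B'0); apply: ler_wpM2r => //.
  have -> : Wi w - W3 w = seg (i - 3 * m) (i - 2 * m) w +
    seg (minn n (i + 2 * m + 1)) (minn n (i + 3 * m + 1)) w.
    rewrite /Wi /W3 -(seg_minn (i + 2 * m + 1)) -(seg_minn (i + 3 * m + 1)).
    rewrite (@seg_cat _ _ _ X 0 (i - 3 * m) (i - 2 * m)); [|by []|clear; lia].
    rewrite (@seg_cat _ _ _ X (minn n (i + 2 * m + 1)) (minn n (i + 3 * m + 1)) n);
      [|clear; lia|clear; lia].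
    by ring.
  apply: le_trans (ler_normD _ _) _.
  apply: le_trans (lerD (seg_le_absseg _ _ _ _) (seg_le_absseg _ _ _ _)) _.
  apply: le_trans (ring_le w).
  by rewrite lerDr absseg_ge0.
have := mul_stein_increment hz_cont hz0 hz1 (w3 w) (x - w3 w) (Wi w / B - w3 w).
rewrite !subrKC.
have -> : x - w3 w - (Wi w / B - w3 w) = x - Wi w / B by ring.
move=> h4.
have -> : f' x - f' (Wi w / B) = (x * f x - Wi w / B * f (Wi w / B)) +
  (hz x - hz (Wi w / B)) by rewrite /stein'; ring.
apply: le_trans (ler_normD _ _) _; rewrite lerD2r.
apply: le_trans h4 _.
have -> : (3 * `|w3 w| * Db w + 4 * Eb w) / B =
  3 * `|w3 w| * (Db w / B) + 2 * (Eb w / B) + 2 * (Eb w / B) by field; rewrite gt_eqF.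
by apply: lerD; [apply: lerD|]; rewrite ler_wpM2l// mulr_ge0.
Qed.

Let gap_first w : `|f' (S w / B) - f' (Wi w / B)| <= gap w.
Proof.
apply: le_trans (stein'_gap _ _) _.
- by rewrite /w3 -mulrBl normrM (ger0_norm B'0) ler_wpM2r.
- rewrite -mulrBl normrM (ger0_norm B'0) ler_wpM2r//.
  by rewrite SD addrAC subrr add0r.
- by rewrite /gap lerD2l lerDl.
Qed.

(** The intermediate point of the mean value theorem may depend on [w] in a
    nonmeasurable way, so it only enters through the bound by [gap]; the ramp being monotone, its value there lies between
    its values at the two ends. *)
Let gap_MVT w : exists2 e, `|f' e - f' (Wi w / B)| <= gap w &
  B * (f (S w / B) - f ((S w - Y w) / B)) = Y w * f' e.
Proof.
have [e he E1] := stein_MVT hz_cont hz0 hz1 ((S w - Y w) / B) (S w / B).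
exists e; last by rewrite E1; field; rewrite gt_eqF.
have conv (q r : R) : `|(S w - Y w) / B - q| <= r -> `|S w / B - q| <= r -> `|e - q| <= r.
  move: he; rewrite ge_min le_max !ler_norml => /andP[/orP[]h1 /orP[]h2] /andP[h3 h4] /andP[h5 h6];
    apply/andP; split; lra.
apply: le_trans (stein'_gap _ _) _.
- apply: conv.
    by rewrite /w3 -mulrBl normrM (ger0_norm B'0) ler_wpM2r.
  by rewrite /w3 -mulrBl normrM (ger0_norm B'0) ler_wpM2r.
- apply: conv.
    rewrite -mulrBl normrM (ger0_norm B'0) ler_wpM2r//.
    by rewrite SD (_ : _ - _ = D w - Y w)//; ring.
  rewrite -mulrBl normrM (ger0_norm B'0) ler_wpM2r//.
  by rewrite SD addrAC subrr add0r.
- rewrite /gap lerD2l.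
  move: he; rewrite ge_min le_max => /andP[lo hi].
  apply: between_dist; rewrite ge_min le_max; apply/andP; split.
    by case/orP: hi => /hz_nincr ->//; rewrite orbT.
  by case/orP: lo => /hz_nincr ->//; rewrite orbT.
Qed.

Let iDb : L1 Db. Proof. exact: iB. Qed.
Let iEb : L1 Eb. Proof. exact: iB. Qed.

Let Db0 w : 0 <= Db w. Proof. exact: absseg_ge0. Qed.
Let Eb0 w : 0 <= Eb w. Proof. exact: absseg_ge0. Qed.

Let iW3 : L1 W3. Proof. by apply: L1D; exact: iS. Qed.

Let Ew3 : E (fun w => `|w3 w|) <= 2 * C1 * s / B.
Proof.
have iabs a b : L1 (fun w => `|seg a b w|) by apply: L1_abs; exact: iS.
apply: (@le_trans _ _ (E (fun w => B^-1 *
    (`|seg 0 (i - 3 * m) w| + `|seg (i + 3 * m + 1) n w|)))).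
  apply: Ex_le.
  - by apply: L1_abs; exact: L1Zr.
  - by apply: L1Z; exact: L1D.
  - move=> w; rewrite normrM (ger0_norm B'0) mulrC ler_wpM2l//.
    exact: ler_normD.
rewrite ExZ; last exact: L1D.
rewrite ExD// mulrC; apply: ler_wpM2r => //.
rewrite -mulrA mulr_natl mulr2n.
by apply: lerD; apply: Ex_abs_seg; clear -i_lt; lia.
Qed.

Let mWi : measurable_fun [set: T] Wi.
Proof. by apply: measurable_funD; exact: measurable_seg. Qed.

Let m_hz (U : T -> R) : measurable_fun [set: T] U ->
  measurable_fun [set: T] (fun w => hz (U w / B)).
Proof.
move=> mU; apply: (measurableT_comp (continuous_measurable_fun hz_cont)).
exact: measurable_funM.
Qed.

Let hz_diff1 x y : `| `|hz x - hz y| | <= 1.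
Proof.
rewrite normr_id; have := hz0 x; have := hz1 x; have := hz0 y; have := hz1 y.
by rewrite ler_norml => *; apply/andP; split; lra.
Qed.

(** Increments of the ramp are bounded by averages of the peak at scale [Lam], hence
    by the concentration inequality, with a weight at most [om * Db / Lam]. *)
Let gap_ramp (om U : T -> R) (e : R) : (forall w, 0 <= om w) -> ad W om ->
  L1 om -> L1 (fun w => om w * Db w) -> E (fun w => om w * Db w) <= e ->
  ad W U -> (forall w, `|U w| <= Db w) ->
  E (fun w => om w * `|hz ((Wi w + U w) / B) - hz (Wi w / B)|) <=
  18 * rate * e / s.
Proof.
move=> om0 aom iom iomD ee aU UD.
have L0 := conc_width_gt0; have L'0 : 0 <= Lam^-1 by rewrite invr_ge0 ltW.
have mU := ad_meas aU.
pose Z w := (Wi w - z * B) / Lam; pose u w := U w / Lam.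
have rate0 : 0 <= rate by exact: le_trans conc_rate_ge20.
have mu_ : measurable_fun [set: T] u by exact: measurable_funM.
have mZ : measurable_fun [set: T] Z.
  by apply: measurable_funM => //; apply: measurable_funB.
have uD w : om w * `|u w| <= Lam^-1 * (om w * Db w).
  rewrite normrM (ger0_norm L'0) mulrA mulrC; apply: ler_wpM2l => //.
  by apply: ler_wpM2l.
have iou : L1 (fun w => om w * `|u w|).
  apply: L1_le (L1Z Lam^-1 iomD).
    by apply: measurable_funM; [exact: L1_meas iom|exact: measurableT_comp].
  by move=> w; rewrite ger0_norm ?mulr_ge0.
have -> : (fun w => om w * `|hz ((Wi w + U w) / B) - hz (Wi w / B)|) =
    fun w => om w * `|ramp (Z w + u w) - ramp (Z w)|.
  apply/funext => w; rewrite !hzE /Z /u.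
  by congr (_ * `|ramp _ - _|); ring.
apply: (@le_trans _ _ (9 * (2 * rate * Lam / s * (Lam^-1 * e)))); last first.
  by rewrite le_eqVlt; apply/orP; left; apply/eqP; field; rewrite !gt_eqF.
apply: Ex_ramp_increment => // th.
have -> : (fun w => om w * `|u w| * kap (Z w + th * u w)) = fun w =>
    om w * `|u w| * kap ((- (z * B) + th * U w + seg 0 (i - 2 * m) w +
      seg (i + 2 * m + 1) (0 + n) w) / Lam).
  by apply/funext => w; rewrite /Z /u /Wi add0n; congr (_ * kap _); ring.
apply: (@le_trans _ _ (2 * rate * Lam / s * E (fun w => om w * `|u w|))).
  apply: conc_use => //.
  - move=> n' /andP[n'0 n'n]; apply: conc_all; rewrite n'0/=.
    exact: leq_trans (ltnW n'n) nN.
  - exact: adapted_cst.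
  - apply: (@adS _ _ _ _ _ _ W); first by move=> k; rewrite /W /= => ->.
    apply: adaptedM => //; apply: adapted_abs; apply: adaptedM => //.
    exact: adapted_cst.
  - by apply: adaptedM => //; exact: adapted_cst.
  - by move=> w; rewrite mulr_ge0.
apply: ler_wpM2l.
  apply: mulr_ge0; last by rewrite invr_ge0; exact: ltW s_gt0.
  apply: mulr_ge0 (ltW L0); exact: mulr_ge0 (ler0n _ _) rate0.
apply: le_trans (Ex_le iou (L1Z Lam^-1 iomD) uD) _.
by rewrite ExZ// ler_wpM2l.
Qed.

(** In [`|w3| * Db] the first factor is independent of the weighted second one, so
    its mean, at most of order [sqrt n / B], factors out. *)
Let gap_weight (om : T -> R) (e : R) : (forall w, 0 <= om w) -> ad W om ->
  L1 om -> L1 (fun w => om w * Db w) -> L1 (fun w => om w * Eb w) ->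
  E (fun w => om w * Db w) <= e -> E (fun w => om w * Eb w) <= e ->
  L1 (fun w => om w * gap w) /\ E (fun w => om w * gap w) <= gap_rate * e / s.
Proof.
move=> om0 aom iom iD iE eD eE.
have e0 : 0 <= e by apply: le_trans eD; apply: Ex_ge0 => w; rewrite mulr_ge0.
have aoD : ad W (fun w => om w * Db w) by exact: adaptedM.
have aw3 : ad (~` W) (fun w => `|w3 w|).
  by apply: adapted_abs; apply: adaptedM => //; exact: adapted_cst.
have iw3 : L1 (fun w => `|w3 w|) by apply: L1_abs; exact: L1Zr.
have i1 : L1 (fun w => om w * Db w * `|w3 w|).
  exact: (L1_adM eps_indep pos_inj disW aoD aw3).
have e1 : E (fun w => om w * Db w * `|w3 w|) <= e * (2 * C1 * s / B).
  rewrite (Ex_adM eps_indep pos_inj disW aoD aw3)//.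
  by apply: ler_pM => //; apply: Ex_ge0 => w; rewrite ?mulr_ge0.
have mSY : measurable_fun [set: T] (fun w => S w - Y w).
  by apply: measurable_funB; exact: measurable_seg.
have i2 : L1 (fun w => om w * `|hz (S w / B) - hz (Wi w / B)|).
  apply: (@L1_Mbounded _ _ _ _ _ _ 1) => //.
  apply: measurableT_comp => //; apply: measurable_funB; apply: m_hz => //.
  exact: measurable_seg.
have i3 : L1 (fun w => om w * `|hz ((S w - Y w) / B) - hz (Wi w / B)|).
  apply: (@L1_Mbounded _ _ _ _ _ _ 1) => //.
  by apply: measurableT_comp => //; apply: measurable_funB; exact: m_hz.
have e2 : E (fun w => om w * `|hz (S w / B) - hz (Wi w / B)|) <= 18 * rate * e / s.
  have := gap_ramp om0 aom iom iD eD aWD DB.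
  by under [X in Ex _ X]funext do rewrite -SD.
have e3 : E (fun w => om w * `|hz ((S w - Y w) / B) - hz (Wi w / B)|) <=
    18 * rate * e / s.
  have := gap_ramp om0 aom iom iD eD (adaptedB aWD aWY) DY.
  by under [X in Ex _ X]funext do rewrite addrA -SD.
have gE : (fun w => om w * gap w) = fun w =>
    (3 / B * (om w * Db w * `|w3 w|) + 4 / B * (om w * Eb w)) +
    (om w * `|hz (S w / B) - hz (Wi w / B)| +
     om w * `|hz ((S w - Y w) / B) - hz (Wi w / B)|).
  by apply/funext => w; rewrite /gap; ring.
have i12 : L1 (fun w => 3 / B * (om w * Db w * `|w3 w|) + 4 / B * (om w * Eb w)).
  by apply: L1D; exact: L1Z.
rewrite gE; split; first by apply: L1D => //; exact: L1D.
rewrite ExD//; last exact: L1D.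
rewrite [E (fun w => om w * `|_| + _)]ExD//.
rewrite ExD; [|exact: L1Z|exact: L1Z].
rewrite ExZ// ExZ//.
have b0 := b_gt0; have s0 := s_gt0.
have Binv : B^-1 <= (Num.sqrt c * s)^-1 by rewrite lef_pV2 ?posrE ?mulr_gt0// bs_le.
have t1 : 3 / B * E (fun w => om w * Db w * `|w3 w|) <= 6 * C1 / c * e / s.
  apply: (@le_trans _ _ (3 / B * (e * (2 * C1 * s / B)))).
    by apply: ler_wpM2l => //; rewrite mulr_ge0.
  have -> : 3 / B * (e * (2 * C1 * s / B)) = (6 * C1 * e * s) * (B ^+ 2)^-1.
    by field; rewrite gt_eqF.
  have -> : 6 * C1 / c * e / s = (6 * C1 * e * s) * (c * s ^+ 2)^-1.
    by field; rewrite !gt_eqF.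
  apply: ler_wpM2l; first by rewrite !mulr_ge0// ltW.
  rewrite s2 lef_pV2 ?posrE ?exprn_gt0// mulr_gt0// ltr0n.
  by clear -n_big; lia.
have t2 : 4 / B * E (fun w => om w * Eb w) <= 4 / Num.sqrt c * e / s.
  apply: (@le_trans _ _ (4 * (Num.sqrt c * s)^-1 * e)).
    apply: ler_pM => //; [by rewrite mulr_ge0|..].
      by apply: Ex_ge0 => w; rewrite mulr_ge0.
    by apply: ler_wpM2l.
  by rewrite le_eqVlt; apply/orP; left; apply/eqP; field; rewrite !gt_eqF.
apply: le_trans (lerD (lerD t1 t2) (lerD e2 e3)) _.
rewrite le_eqVlt; apply/orP; left; apply/eqP.
by rewrite /gap_rate; field; rewrite !gt_eqF.
Qed.

Let width5 : (i + 2 * m + 1 - (i - 2 * m))%:R <= 5 * m%:R :> R.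
Proof. by rewrite -natrM ler_nat; clear -m_gt0; lia. Qed.

Let width7 : (i + 3 * m + 1 - (i - 3 * m))%:R <= 7 * m%:R :> R.
Proof. by rewrite -natrM ler_nat; clear -m_gt0; lia. Qed.

Let M0 : 0 <= M. Proof. exact: le_trans ler01 M_ge1. Qed.

Let m1 : 1 <= m%:R :> R. Proof. by rewrite ler1n. Qed.

Let gap_rate0 : 0 <= gap_rate.
Proof.
apply: addr_ge0; [apply: addr_ge0|].
- by apply: divr_ge0 (ltW c_gt0); exact: mulr_ge0 (ler0n _ _) (ltW C1_gt0).
- exact: divr_ge0 (ler0n _ _) (sqrtr_ge0 _).
- by apply: mulr_ge0 (ler0n _ _) (le_trans (ler0n _ _) conc_rate_ge20).
Qed.

Let gap_one : L1 gap /\ E gap <= gap_rate * (7 * M * m%:R) / s.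
Proof.
have a1 : ad W (fun=> 1) by exact: adapted_cst.
have h := @gap_weight (fun=> 1) (7 * M * m%:R) (fun=> ler01) a1 (L1_cst P 1).
have E1 (U : T -> R) : (fun w => 1 * U w) = U by apply/funext => w; rewrite mul1r.
rewrite !E1 in h; apply: h => //.
- apply: le_trans (Ex_absseg X_meas M_ge1 X_L3 X_M3 _ _) _.
  apply: (@le_trans _ _ (M * (5 * m%:R))); first exact: ler_wpM2l.
  rewrite mulrCA mulrA; apply: ler_wpM2r => //; apply: ler_wpM2r => //.
  by rewrite ler_nat.
- apply: le_trans (Ex_absseg X_meas M_ge1 X_L3 X_M3 _ _) _.
  rewrite (mulrC 7) -mulrA; exact: ler_wpM2l.
Qed.

Let gap_XD : L1 (fun w => `|X i w| * Db w * gap w) /\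
  E (fun w => `|X i w| * Db w * gap w) <= gap_rate * (35 * M * m%:R ^+ 2) / s.
Proof.
apply: gap_weight.
- by move=> w; rewrite mulr_ge0.
- by apply: adaptedM => //; exact: adapted_abs.
- exact: iXB.
- exact: iXBB.
- exact: iXBB.
- apply: le_trans (Ex_X_absseg2 X_meas X_L3 X_M3 _ _ _ _ _) _.
  apply: (@le_trans _ _ (M * (5 * m%:R) * (5 * m%:R))).
    by apply: ler_pM => //; [exact: mulr_ge0|exact: ler_wpM2l].
  rewrite (_ : M * (5 * m%:R) * (5 * m%:R) = 25 * (M * m%:R ^+ 2)); last by ring.
  rewrite -mulrA; apply: ler_wpM2r; last by rewrite ler_nat.
  exact: mulr_ge0 M0 (sqr_ge0 _).
- apply: le_trans (Ex_X_absseg2 X_meas X_L3 X_M3 _ _ _ _ _) _.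
  apply: (@le_trans _ _ (M * (5 * m%:R) * (7 * m%:R))).
    by apply: ler_pM => //; [exact: mulr_ge0|exact: ler_wpM2l].
  by rewrite le_eqVlt; apply/orP; left; apply/eqP; ring.
Qed.

Let EXY : `|E (fun w => X i w * Y w)| <= 5 * M * m%:R.
Proof.
apply: (@le_trans _ _ (E (fun w => `|X i w| * Db w))).
  apply: Ex_abs_le; [exact: iXS|exact: iXB|].
  by move=> w; rewrite normrM ler_wpM2l.
apply: le_trans (Ex_X_absseg X_meas M_ge1 X_L3 X_M3 _ _ _) _.
by rewrite (mulrC 5) -mulrA; exact: ler_wpM2l.
Qed.

Let f'3 x : `|f' x| <= 3. Proof. exact: (stein'_le3 hz_cont hz0 hz1). Qed.
Let f2 x : `|f x| <= 2. Proof. exact: (stein_le2 hz_cont hz0 hz1). Qed.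

Let mSB : measurable_fun [set: T] (fun w => S w / B).
Proof. by apply: measurable_funM => //; exact: measurable_seg. Qed.

Let mWB : measurable_fun [set: T] (fun w => Wi w / B).
Proof. exact: measurable_funM. Qed.

Let if'S : L1 (fun w => f' (S w / B)).
Proof. by apply: (@L1_bounded _ _ _ _ _ 3) => //; exact: measurableT_comp. Qed.

Let if'W : L1 (fun w => f' (Wi w / B)).
Proof. by apply: (@L1_bounded _ _ _ _ _ 3) => //; exact: measurableT_comp. Qed.

(** [X i] is independent of [S - Y], so [X i * f ((S - Y) / B)] has mean 0 and the
    mean value theorem leaves [X i * Y * f'].  There [f'] is compared with its
    value at [Wi / B], which is independent of [X i * Y]. *)
Lemma stein_one_term :
  `|B * E (fun w => X i w * f (S w / B)) -
    E (fun w => X i w * Y w) * E (fun w => f' (S w / B))| <=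
  70 * gap_rate * M ^+ 2 * m%:R ^+ 2 / s.
Proof.
have dis2 k : (i <= k <= i + m)%N -> ~~ (i <= k <= i + m)%N -> False by move=> ->.
have mSY : measurable_fun [set: T] (fun w => (S w - Y w) / B).
  by apply: measurable_funM => //; apply: measurable_funB; exact: measurable_seg.
have afSY : ad [set k | ~~ (i <= k <= i + m)%N] (fun w => f ((S w - Y w) / B)).
  apply: (adapted_comp mf); apply: adaptedM; last exact: adapted_cst.
  have -> : (fun w => S w - Y w) = fun w => seg 0 (i - m) w + seg (i + m + 1) n w.
    by apply/funext => w; rewrite SY.
  by apply: adaptedD; apply: seg_ad => k /=; clear -i_lt; lia.
have ifSY : L1 (fun w => f ((S w - Y w) / B)).
  by apply: (@L1_bounded _ _ _ _ _ 2) => //; exact: measurableT_comp.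
have EfSY : E (fun w => X i w * f ((S w - Y w) / B)) = 0.
  by rewrite (Ex_adM eps_indep pos_inj dis2 (@X_ad i) afSY)// X_mean mul0r.
have iXfSY : L1 (fun w => X i w * f ((S w - Y w) / B)).
  exact: (L1_adM eps_indep pos_inj dis2 (@X_ad i) afSY).
have iXfS : L1 (fun w => X i w * f (S w / B)).
  by apply: (@L1_Mbounded _ _ _ _ _ _ 2) => //; exact: measurableT_comp.
have dis3 k : (i <= k + m)%N && (k <= i + 2 * m)%N ->
  ~~ ((i <= k + m)%N && (k <= i + 2 * m)%N) -> False by move=> ->.
have aXY : ad [set k | (i <= k + m)%N && (k <= i + 2 * m)%N] (fun w => X i w * Y w).
  apply: adaptedM; first by apply: X_adS => k /=; clear; lia.
  by apply: seg_ad => k /=; clear; lia.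
have af'W : ad [set k | ~~ ((i <= k + m)%N && (k <= i + 2 * m)%N)]
    (fun w => f' (Wi w / B)).
  apply: (adapted_comp mf'); apply: adaptedM; last exact: adapted_cst.
  by apply: adaptedD; apply: seg_ad => k /=; clear; lia.
have iXYf : L1 (fun w => X i w * Y w * f' (Wi w / B)).
  by apply: (L1_adM eps_indep pos_inj dis3 aXY af'W) => //; exact: iXS.
have EXYf : E (fun w => X i w * Y w * f' (Wi w / B)) =
    E (fun w => X i w * Y w) * E (fun w => f' (Wi w / B)).
  by apply: (Ex_adM eps_indep pos_inj dis3 aXY af'W) => //; exact: iXS.
have [ig Eg] := gap_one; have [igX EgX] := gap_XD.
have step1 : `|B * E (fun w => X i w * f (S w / B)) -
    E (fun w => X i w * Y w) * E (fun w => f' (Wi w / B))| <=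
    gap_rate * (35 * M * m%:R ^+ 2) / s.
  apply: le_trans EgX.
  have -> : B * E (fun w => X i w * f (S w / B)) -
      E (fun w => X i w * Y w) * E (fun w => f' (Wi w / B)) =
      E (fun w => (B * (X i w * f (S w / B)) - B * (X i w * f ((S w - Y w) / B))) -
        X i w * Y w * f' (Wi w / B)).
    rewrite ExB//; last by apply: L1B; exact: L1Z.
    rewrite ExB; [|exact: L1Z|exact: L1Z].
    by rewrite ExZ// ExZ// EfSY mulr0 subr0 EXYf.
  apply: Ex_abs_le => //.
    by apply: L1B => //; apply: L1B; exact: L1Z.
  move=> w; have [e he E1] := gap_MVT w.
  have -> : (B * (X i w * f (S w / B)) - B * (X i w * f ((S w - Y w) / B))) -
      X i w * Y w * f' (Wi w / B) = X i w * Y w * (f' e - f' (Wi w / B)).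
    by rewrite mulrBr -(mulrA _ _ (f' e)) -E1; ring.
  rewrite !normrM; apply: ler_pM; [exact: mulr_ge0|exact: normr_ge0| |exact: he].
  exact: ler_wpM2l.
have step2 : `|E (fun w => f' (S w / B)) - E (fun w => f' (Wi w / B))| <=
    gap_rate * (7 * M * m%:R) / s.
  apply: le_trans Eg; rewrite -ExB//.
  by apply: Ex_abs_le => //; exact: L1B.
have -> : B * E (fun w => X i w * f (S w / B)) -
    E (fun w => X i w * Y w) * E (fun w => f' (S w / B)) =
    (B * E (fun w => X i w * f (S w / B)) -
    E (fun w => X i w * Y w) * E (fun w => f' (Wi w / B))) -
    E (fun w => X i w * Y w) *
    (E (fun w => f' (S w / B)) - E (fun w => f' (Wi w / B))) by ring.
apply: le_trans (ler_normB _ _) _; rewrite [X in _ + X]normrM.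
apply: (@le_trans _ _ (gap_rate * (35 * M * m%:R ^+ 2) / s +
  5 * M * m%:R * (gap_rate * (7 * M * m%:R) / s))).
  by apply: lerD => //; exact: ler_pM.
have -> : gap_rate * (35 * M * m%:R ^+ 2) / s +
    5 * M * m%:R * (gap_rate * (7 * M * m%:R) / s) =
    (gap_rate * m%:R ^+ 2 / s) * (35 * M + 35 * M ^+ 2).
  by field; rewrite gt_eqF.
have -> : 70 * gap_rate * M ^+ 2 * m%:R ^+ 2 / s =
    (gap_rate * m%:R ^+ 2 / s) * (70 * M ^+ 2).
  by field; rewrite gt_eqF.
apply: ler_wpM2l.
  by apply: mulr_ge0; [exact: mulr_ge0 gap_rate0 (sqr_ge0 _)|rewrite invr_ge0 ltW].
have M2 : M <= M ^+ 2 by rewrite expr2 ler_peMl.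
lra.
Qed.

End one_term.

Let f'3 x : `|f' x| <= 3. Proof. exact: (stein'_le3 hz_cont hz0 hz1). Qed.
Let f2 x : `|f x| <= 2. Proof. exact: (stein_le2 hz_cont hz0 hz1). Qed.

Let mSB : measurable_fun [set: T] (fun w => S w / B).
Proof. by apply: measurable_funM => //; exact: measurable_seg. Qed.

Definition be_rate : R := 4 * rate * (1200 * M ^+ 2 / c + 1) +
  (1200 * M ^+ 2 / c + 1) / Num.sqrt c + 70 * gap_rate * M ^+ 2 / c.

Lemma stein_sum :
  `|B * E (fun w => S w * f (S w / B)) -
    E (fun w => S w ^+ 2) * E (fun w => f' (S w / B))| <=
  n%:R * (70 * gap_rate * M ^+ 2 * m%:R ^+ 2 / s).
Proof.
have iXf i : L1 (fun w => X i w * f (S w / B)).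
  by apply: (@L1_Mbounded _ _ _ _ _ _ 2) => //; exact: measurableT_comp.
have -> : E (fun w => S w * f (S w / B)) =
    \sum_(0 <= i < n) E (fun w => X i w * f (S w / B)).
  rewrite -Ex_sum//; congr Ex; apply/funext => w.
  by rewrite {1}/seg mulr_suml.
have -> : E (fun w => S w ^+ 2) =
    \sum_(0 <= i < n) E (fun w => X i w * seg (i - m) (minn n (i + m + 1)) w).
  have -> : (fun w => S w ^+ 2) = fun w => \sum_(0 <= i < n) X i w * S w.
    by apply/funext => w; rewrite expr2 {1}/seg mulr_suml.
  rewrite Ex_sum; last by move=> i _; exact: iXS.
  rewrite big_nat [RHS]big_nat; apply: eq_bigr => i /andP[_ i_lt].
  have -> : (fun w => X i w * S w) = fun w => X i w * seg 0 (i - m) w +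
      (X i w * seg (i - m) (minn n (i + m + 1)) w +
       X i w * seg (minn n (i + m + 1)) n w).
    apply/funext => w; rewrite -!mulrDr; congr (_ * _).
    rewrite (@seg_cat _ _ _ X 0 (i - m) n); [|by []|clear -i_lt; lia].
    by rewrite (@seg_cat _ _ _ X (i - m) (minn n (i + m + 1)) n)//; clear -i_lt; lia.
  rewrite ExD; [|exact: iXS|by apply: L1D; exact: iXS].
  rewrite ExD; [|exact: iXS|exact: iXS].
  rewrite (@Ex_Xseg_far i 0 (i - m) [set k | (k < i)%N]); first last.
  - by apply: seg_ad => k /=; clear; lia.
  - by move=> k /=; clear; lia.
  rewrite (@Ex_Xseg_far i (minn n (i + m + 1)) n [set k | (i + m < k)%N]); first last.
  - by apply: seg_ad => k /=; clear; lia.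
  - by move=> k /=; clear; lia.
  by rewrite add0r addr0.
rewrite mulr_sumr mulr_suml -sumrB; apply: le_trans (ler_norm_sum _ _ _) _.
apply: (@le_trans _ _ (\sum_(0 <= i < n) (70 * gap_rate * M ^+ 2 * m%:R ^+ 2 / s))).
  rewrite big_nat [leRHS]big_nat; apply: ler_sum => i /andP[_ i_lt].
  exact: stein_one_term.
by rewrite sumr_const_nat subn0 -[leLHS]mulr_natl.
Qed.

(** The three sources of error are the passage from the indicator to the ramp, a
    concentration quantity; the Gaussian mean of the ramp, within [Lam / B] of
    [Phi z]; and Stein's identity. *)
Lemma berry_esseen_large :
  `|fine (P [set w | S w < z * B]) - Phi z| <=
  be_rate * m%:R ^+ 2 / s + 3 * `|1 - E (fun w => S w ^+ 2) / B ^+ 2|.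
Proof.
have n0' : (0 : R) < n%:R by rewrite ltr0n; clear -n_big; lia.
have B20 : 0 < B ^+ 2 by rewrite exprn_gt0.
pose V := E (fun w => S w ^+ 2).
pose err := 70 * gap_rate * M ^+ 2 * m%:R ^+ 2 / s.
have iSf : L1 (fun w => S w * f (S w / B)).
  by apply: (@L1_Mbounded _ _ _ _ _ _ 2) => //; exact: measurableT_comp.
have if' : L1 (fun w => f' (S w / B)).
  by apply: (@L1_bounded _ _ _ _ _ 3) => //; exact: measurableT_comp.
have mhzS : measurable_fun [set: T] (fun w => hz (S w / B)).
  exact: (measurableT_comp (continuous_measurable_fun hz_cont)).
have ihz : L1 (fun w => hz (S w / B)).
  by apply: (@L1_bounded _ _ _ _ _ 1) => // w; rewrite ger0_norm.
have Ef' : `|E (fun w => f' (S w / B))| <= 3.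
  rewrite -[leRHS](Ex_cst P); apply: Ex_abs_le => //; exact: L1_cst.
pose Nh := gauss_mean hz.
have stein_id : E (fun w => hz (S w / B)) - Nh =
    E (fun w => f' (S w / B)) - B^-1 * E (fun w => S w * f (S w / B)).
  rewrite -ExZ// -ExB//; last exact: L1Z.
  rewrite -[Nh in LHS](Ex_cst P) -ExB//; last exact: L1_cst.
  by congr Ex; apply/funext => w; rewrite /stein' /Nh; ring.
have t1 : `|E (fun w => hz (S w / B)) - Nh| <=
    n%:R * err / B ^+ 2 + 3 * `|1 - V / B ^+ 2|.
  rewrite stein_id.
  have -> : E (fun w => f' (S w / B)) - B^-1 * E (fun w => S w * f (S w / B)) =
     (1 - V / B ^+ 2) * E (fun w => f' (S w / B)) -
     (B * E (fun w => S w * f (S w / B)) - V * E (fun w => f' (S w / B))) / B ^+ 2.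
    by field; rewrite gt_eqF.
  apply: le_trans (ler_normB _ _) _; rewrite addrC; apply: lerD.
    rewrite normrM normfV (gtr0_norm B20); apply: ler_wpM2r.
      by rewrite invr_ge0 ltW.
    exact: stein_sum.
  by rewrite normrM mulrC; apply: ler_wpM2r.
have err_le : n%:R * err / B ^+ 2 <= 70 * gap_rate * M ^+ 2 / c * m%:R ^+ 2 / s.
  have e0 : 0 <= n%:R * err.
    by apply: mulr_ge0 (ltW n0') _; apply: le_trans (stein_one_term (i := 0%N) _);
      [exact: normr_ge0|clear -n_big; lia].
  apply: (@le_trans _ _ (n%:R * err / (c * n%:R))).
    by apply: ler_wpM2l => //; rewrite lef_pV2 ?posrE// mulr_gt0.
  rewrite le_eqVlt; apply/orP; left; apply/eqP; rewrite /err; field.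
  by rewrite !gt_eqF.
pose A := [set w | S w < z * B].
have mS : measurable_fun [set: T] S by exact: measurable_seg.
have [i1A PA] := prob_ltE (P := P) (z * B) mS.
pose x w := (- (z * B) + seg 0 (0 + n) w) / Lam.
have mx : measurable_fun [set: T] x.
  by apply: measurable_funM => //; apply: measurable_funD.
have L0 := conc_width_gt0.
have conc1 : E (fun w => kap (x w)) <= rate * Lam / s.
  have h := @conc_all n _ 0 (fun=> 1) (fun=> - (z * B)).
  have a1 (A' : set nat) (r : R) : ad A' (fun=> r) by exact: adapted_cst.
  have := h _ (a1 _ _) (a1 _ _) (fun=> ler01) (L1_cst P 1).
  rewrite Ex_cst mulr1 (_ : (fun w => 1 * _) = fun w => kap (x w)).
    by apply; rewrite nN andbT; clear -n_big; lia.
  by apply/funext => w; rewrite mul1r.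
have ikap : L1 (fun w => kap (x w)).
  apply: (@L1_bounded _ _ _ _ _ 1); last by move=> w; exact: normr_kap_le1.
  exact: (measurableT_comp measurable_kap).
have t2 : `|fine (P A) - E (fun w => hz (S w / B))| <= 4 * (rate * Lam / s).
  rewrite PA -ExB//.
  apply: (@le_trans _ _ (E (fun w => 4 * kap (x w)))); last first.
    by rewrite ExZ// ler_wpM2l.
  apply: Ex_abs_le; [exact: L1B|exact: L1Z|move=> w].
  have := ramp_indic (x w); rewrite hzE.
  have -> : (S w - z * B) / Lam = x w by rewrite /x add0n addrC.
  have -> : (x w < 0) = (S w < z * B).
    rewrite /x add0n pmulr_llt0 ?invr_gt0// addrC subr_lt0.
    by [].
  by [].
have t3 : `|Nh - Phi z| <= Lam * (Num.sqrt c * s)^-1.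
  have /andP[h1 h2] := gauss_mean_ramp z eps0.
  rewrite ger0_norm ?subr_ge0//; apply: (@le_trans _ _ (Lam / B)).
    by rewrite lerBlDl.
  apply: ler_wpM2l; first exact: ltW.
  by rewrite lef_pV2 ?posrE ?mulr_gt0.
have -> : fine (P A) - Phi z = (fine (P A) - E (fun w => hz (S w / B))) +
    (Nh - Phi z) + (E (fun w => hz (S w / B)) - Nh) by ring.
apply: le_trans (ler_normD _ _) _.
apply: le_trans (lerD (ler_normD _ _) (lexx _)) _.
apply: le_trans (lerD (lerD t2 t3) (le_trans t1 (lerD err_le (lexx _)))) _.
rewrite -/V le_eqVlt; apply/orP; left; apply/eqP.
rewrite /be_rate /conc_width; field.
by rewrite !gt_eqF.
Qed.

End berry_esseen.

(** For [n < 12 * m + 2] the bound is at least 1. *)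
Lemma berry_esseen_m_dependent (n : nat) (B z : R) : (0 < n <= N)%N -> 0 < B ->
  c * n%:R <= B ^+ 2 ->
  `|fine (P [set w | seg 0 n w < z * B]) - Phi z| <=
  (be_rate + 4) * m%:R ^+ 2 / Num.sqrt n%:R +
  3 * `|1 - E (fun w => seg 0 n w ^+ 2) / B ^+ 2|.
Proof.
move=> /andP[n1 nN] B0 cB; pose s := Num.sqrt n%:R : R.
have s0 : 0 < s by rewrite sqrtr_gt0 ltr0n.
have be0 : 0 <= be_rate.
  have f0 := le_trans ler01 conc_factor_ge1.
  have r0 := le_trans (ler0n _ _) conc_rate_ge20.
  apply: addr_ge0; [apply: addr_ge0|].
  - exact: mulr_ge0 (mulr_ge0 (ler0n _ _) r0) f0.
  - exact: mulr_ge0 f0 _; rewrite invr_ge0 sqrtr_ge0.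
  - apply: divr_ge0 (ltW c_gt0); apply: mulr_ge0 (sqr_ge0 _).
    apply: mulr_ge0 (ler0n _ _) _; apply: addr_ge0; [apply: addr_ge0|].
    + by apply: divr_ge0 (ltW c_gt0); exact: mulr_ge0 (ler0n _ _) (ltW C1_gt0).
    + exact: divr_ge0 (ler0n _ _) (sqrtr_ge0 _).
    + exact: mulr_ge0 (ler0n _ _) r0.
have m2s : 0 <= m%:R ^+ 2 / s by rewrite divr_ge0 ?sqr_ge0// ltW.
have e0 : 0 <= 3 * `|1 - E (fun w => seg 0 n w ^+ 2) / B ^+ 2| by rewrite mulr_ge0.
have [big|small] := leqP (12 * m + 2) n.
  apply: le_trans (berry_esseen_large z big nN B0 cB) _; rewrite lerD2r.
  by rewrite -!mulrA ler_wpM2r// lerDl.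
have Pb : `|fine (P [set w | seg 0 n w < z * B]) - Phi z| <= 1.
  by apply: prob_Phi_dist_le1; apply: measurable_lt_set; exact: measurable_seg.
apply: le_trans Pb _; apply: (@le_trans _ _ (4 * (m%:R ^+ 2 / s))); last first.
  apply: (@le_trans _ _ ((be_rate + 4) * (m%:R ^+ 2 / s))).
    by rewrite ler_wpM2r// lerDr.
  by rewrite mulrA lerDl.
have sn0 : 0 <= s by exact: ltW.
rewrite mulrA ler_pdivlMr// mul1r -(@ler_pXn2r _ 2) ?nnegrE ?mulr_ge0 ?sqr_ge0//.
rewrite sqr_sqrtr ?ler0n// -natrX -natrM -natrX ler_nat.
have m4 : (m <= m ^ 4)%N by rewrite -{1}(expn1 m) leq_pexp2l.
rewrite expnMn -expnM; move: m4 small m_gt0; rewrite (_ : (2 * 2)%N = 4%N)//.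
by move: (m ^ 4)%N => k; clear; lia.
Qed.

End m_dependent.

(** * Stationary sequences approximated by m-dependent ones *)

Section approximable.
Set Implicit Arguments.
Unset Strict Implicit.
Context {d : measure_display} {T : measurableType d} {R : realType}.
Context {P : probability T R}.
Variable eps : int -> {RV P >-> R}.
Hypothesis eps_indep : mutually_independent eps.
Variables (Z : int -> T -> R) (Zm : nat -> int -> T -> R) (rho C M : R).
Hypothesis rho_gt0 : 0 < rho.
Hypothesis rho_lt1 : rho < 1.
Hypothesis Z_ad : forall k, adapted eps [set l | l <= k] (Z k).
Hypothesis Zm_ad : forall m k,
  adapted eps [set l | k - m%:Z <= l <= k] (Zm m k).
Hypothesis Z_L2 : forall k, L1 P (fun w => Z k w ^+ 2).
Hypothesis Zm_mean : forall m k, Ex P (Zm m k) = 0.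
Hypothesis M_ge1 : 1 <= M.
Hypothesis Zm_L3 : forall m k, L1 P (fun w => `|Zm m k w| ^+ 3).
Hypothesis Zm_M3 : forall m k, Ex P (fun w => `|Zm m k w| ^+ 3) <= M.
Hypothesis Zm_close : forall m k,
  Ex P (fun w => (Z k w - Zm m k w) ^+ 2) <= (C * rho ^+ m) ^+ 2.
Hypothesis Z_stat : forall h i j,
  Ex P (fun w => Z (i + h) w * Z (j + h) w) = Ex P (fun w => Z i w * Z j w).

Local Notation E := (Ex P).
Local Notation L1 := (L1 P).

Lemma L1_mul_of_sqr (U V : T -> R) : measurable_fun [set: T] U ->
  measurable_fun [set: T] V -> L1 (fun w => U w ^+ 2) ->
  L1 (fun w => V w ^+ 2) -> L1 (fun w => U w * V w).
Proof.
move=> mU mV iU iV; apply: L1_le (L1D iU iV); first exact: measurable_funM.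
move=> w; rewrite -subr_ge0 normrM.
have -> : U w ^+ 2 + V w ^+ 2 - `|U w| * `|V w| =
  (`|U w| - `|V w|) ^+ 2 + `|U w| * `|V w|.
  rewrite -(real_normK (num_real (U w))) -(real_normK (num_real (V w))); ring.
by rewrite addr_ge0 ?sqr_ge0// mulr_ge0.
Qed.

Lemma L1_of_sqr (U : T -> R) : measurable_fun [set: T] U ->
  L1 (fun w => U w ^+ 2) -> L1 U.
Proof.
move=> mU iU; have := L1_mul_of_sqr mU (measurable_cst (1 : R)) iU (L1_cst P ((1 : R) ^+ 2)).
by rewrite (_ : (fun w => U w * _) = U)//; apply/funext => w; rewrite mulr1.
Qed.

Let mZ k : measurable_fun [set: T] (Z k).
Proof. exact: (adapted_measurable (@Z_ad k)). Qed.

Let mZm m k : measurable_fun [set: T] (Zm m k).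
Proof. exact: (adapted_measurable (@Zm_ad m k)). Qed.

Let Zm_L2 m k : L1 (fun w => Zm m k w ^+ 2).
Proof.
exact: (L1_X2 (X := fun=> Zm m k) (M := M) (fun=> @mZm m k) M_ge1
  (fun=> @Zm_L3 m k) (fun=> Zm_M3 m k) 0 0).
Qed.

Let iZ k : L1 (Z k). Proof. exact: L1_of_sqr. Qed.
Let iZm m k : L1 (Zm m k). Proof. exact: L1_of_sqr. Qed.
Let iZZ i j : L1 (fun w => Z i w * Z j w). Proof. exact: L1_mul_of_sqr. Qed.
Let iZZm i m j : L1 (fun w => Z i w * Zm m j w). Proof. exact: L1_mul_of_sqr. Qed.

Let diff_L2 m k : L1 (fun w => (Z k w - Zm m k w) ^+ 2).
Proof.
have -> : (fun w => (Z k w - Zm m k w) ^+ 2) =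
  fun w => Z k w ^+ 2 - 2 * (Z k w * Zm m k w) + Zm m k w ^+ 2.
  by apply/funext => w; ring.
by apply: L1D => //; apply: L1B => //; exact: L1Z.
Qed.

Definition autocov (j : nat) : R := E (fun w => Z 0 w * Z j%:Z w).

Lemma autocov_shift i (j : nat) : E (fun w => Z i w * Z (i + j%:Z) w) = autocov j.
Proof. by have := Z_stat i 0 j%:Z; rewrite add0r (addrC _ i). Qed.

(** [Z 0] is independent of the approximation of [Z j.+1] that looks [j] steps back,
    hence uncorrelated with it, and it remains to bound the product with a
    remainder of size [rho ^+ j]; the weights in the inequality
    [2 * a * b <= t * a ^+ 2 + b ^+ 2 / t] are chosen accordingly. *)
Lemma autocov_le j : `|autocov j.+1| <= (autocov 0 + C ^+ 2) * rho ^+ j.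
Proof.
have dis : [set l : int | l <= 0] `&` [set l : int | j.+1%:Z - j%:Z <= l <= j.+1%:Z] = set0.
  by apply/seteqP; split => // l /= [l0 /andP[l1 _]]; lia.
have E0 : E (fun w => Z 0 w * Zm j j.+1%:Z w) = 0.
  by rewrite (Ex_indepM eps_indep dis (@Z_ad 0) (@Zm_ad j j.+1%:Z))// Zm_mean mulr0.
have r0 : 0 < rho ^+ j by rewrite exprn_gt0.
have -> : autocov j.+1 = E (fun w => Z 0 w * (Z j.+1%:Z w - Zm j j.+1%:Z w)).
  rewrite (_ : (fun w => _) = fun w => Z 0 w * Z j.+1%:Z w - Z 0 w * Zm j j.+1%:Z w).
    by rewrite ExB// E0 subr0.
  by apply/funext => w; rewrite mulrBr.
pose b w := 2^-1 * (rho ^+ j * (Z 0 w ^+ 2)) +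
  2^-1 * ((rho ^+ j)^-1 * (Z j.+1%:Z w - Zm j j.+1%:Z w) ^+ 2).
apply: (@le_trans _ _ (E b)).
  apply: Ex_abs_le.
  - by apply: L1_mul_of_sqr => //; apply: measurable_funB.
  - by apply: L1D; apply: L1Z; exact: L1Z.
  - move=> w; rewrite /b -subr_ge0 normrM.
    set a := Z 0 w; set e := Z _ w - Zm _ _ w.
    rewrite -(real_normK (num_real a)) -(real_normK (num_real e)).
    have -> : 2^-1 * (rho ^+ j * `|a| ^+ 2) + 2^-1 * ((rho ^+ j)^-1 * `|e| ^+ 2) -
       `|a| * `|e| = 2^-1 * (rho ^+ j)^-1 * (rho ^+ j * `|a| - `|e|) ^+ 2.
      by field; rewrite gt_eqF.
    by rewrite mulr_ge0 ?sqr_ge0// mulr_ge0// invr_ge0 ltW.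
rewrite ExD; [|by apply: L1Z; exact: L1Z|by apply: L1Z; exact: L1Z].
rewrite !ExZ//; [|exact: L1Z|exact: L1Z].
have g0 : E (fun w => Z 0 w ^+ 2) = autocov 0 by [].
have g00 : 0 <= autocov 0 by rewrite -g0; apply: Ex_ge0 => w; exact: sqr_ge0.
rewrite g0.
have h1 : (rho ^+ j)^-1 * E (fun w => (Z j.+1%:Z w - Zm j j.+1%:Z w) ^+ 2) <=
    C ^+ 2 * rho ^+ j.
  rewrite mulrC ler_pdivrMr//; apply: le_trans (Zm_close _ _) _.
  by rewrite exprMn expr2 expr2 !mulrA.
have h2 : 0 <= rho ^+ j * autocov 0 by rewrite mulr_ge0// ltW.
have h3 : 0 <= C ^+ 2 * rho ^+ j by rewrite mulr_ge0 ?sqr_ge0// ltW.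
rewrite mulrDl (mulrC (autocov 0)); lra.
Qed.

(** The increment of the variance of the partial sum from [n] to [n.+1] terms. *)
Definition var_step (n : nat) : R := autocov 0 + 2 * \sum_(0 <= j < n) autocov j.+1.

Definition step_bound : R := autocov 0 + 2 * ((autocov 0 + C ^+ 2) / (1 - rho)).

Lemma autocov0_ge0 : 0 <= autocov 0.
Proof. by apply: Ex_ge0 => w; exact: sqr_ge0. Qed.

Lemma geometric_sum_le n : \sum_(0 <= j < n) rho ^+ j <= (1 - rho)^-1.
Proof.
have r1 : 0 < 1 - rho by rewrite subr_gt0.
have -> : \sum_(0 <= j < n) rho ^+ j = (1 - rho ^+ n) / (1 - rho).
  elim: n => [|n IH]; first by rewrite big_geq// expr0 subrr mul0r.
  by rewrite big_nat_recr//= IH exprS; field; rewrite gt_eqF.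
rewrite ler_pdivrMr// mulVf ?gt_eqF// lerBlDr lerDl exprn_ge0//; exact: ltW.
Qed.

Lemma var_step_le n : `|var_step n| <= step_bound.
Proof.
have g0 := autocov0_ge0.
apply: le_trans (ler_normD _ _) _; rewrite ger0_norm// lerD2l normrM ger0_norm//.
apply: ler_wpM2l => //; apply: le_trans (ler_norm_sum _ _ _) _.
apply: (@le_trans _ _ (\sum_(0 <= j < n) (autocov 0 + C ^+ 2) * rho ^+ j)).
  by apply: ler_sum => j _; exact: autocov_le.
rewrite -mulr_sumr; apply: ler_wpM2l; last exact: geometric_sum_le.
by rewrite addr_ge0// sqr_ge0.
Qed.

Lemma var_step_cvg : cvgn var_step.
Proof.
apply: is_cvgD; first exact: is_cvg_cst.
apply: is_cvgM; first exact: is_cvg_cst.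
have h : cvgn (series (fun j => autocov j.+1)).
  apply: normed_cvg; apply: (@series_le_cvg _ _ (geometric (autocov 0 + C ^+ 2) rho)).
  - by move=> j; exact: normr_ge0.
  - by move=> j; rewrite mulr_ge0 ?addr_ge0 ?sqr_ge0 ?autocov0_ge0// exprn_ge0// ltW.
  - by move=> j; exact: autocov_le.
  - by apply: is_cvg_geometric_series; rewrite ger0_norm// ltW.
exact: h.
Qed.

Definition part (a n : nat) (w : T) : R := \sum_(a <= j < a + n) Z j.+1%:Z w.

Definition var_sum (n : nat) : R := E (fun w => part 0 n w ^+ 2).

Let mpart a n : measurable_fun [set: T] (part a n).
Proof. by apply: measurable_sum. Qed.

Let part_L2 a n : L1 (fun w => part a n w ^+ 2).
Proof.
elim: n => [|n IH].
  rewrite (_ : (fun w => _) = fun=> 0); first exact: L1_cst.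
  by apply/funext => w; rewrite /part big_geq ?addn0// expr0n.
have -> : (fun w => part a n.+1 w ^+ 2) =
  fun w => part a n w ^+ 2 + (2 * (part a n w * Z (a + n).+1%:Z w) +
    Z (a + n).+1%:Z w ^+ 2).
  by apply/funext => w; rewrite /part addnS big_nat_recr/= ?leq_addr//; ring.
apply: L1D => //; apply: L1D => //; apply: L1Z.
exact: L1_mul_of_sqr.
Qed.

Lemma part_var a n : E (fun w => part a n w ^+ 2) = \sum_(0 <= j < n) var_step j.
Proof.
elim: n => [|n IH].
  rewrite big_geq// (_ : (fun w => _) = fun=> 0) ?Ex_cst//.
  by apply/funext => w; rewrite /part big_geq ?addn0// expr0n.
have -> : (fun w => part a n.+1 w ^+ 2) =
  fun w => part a n w ^+ 2 + (2 * (part a n w * Z (a + n).+1%:Z w) +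
    Z (a + n).+1%:Z w * Z (a + n).+1%:Z w).
  by apply/funext => w; rewrite /part addnS big_nat_recr/= ?leq_addr//; ring.
have ipZ : L1 (fun w => part a n w * Z (a + n).+1%:Z w) by exact: L1_mul_of_sqr.
rewrite ExD//; last by apply: L1D => //; exact: L1Z.
rewrite ExD//; last exact: L1Z.
rewrite ExZ// IH big_nat_recr//=; congr (_ + _).
rewrite /var_step addrC; congr (_ + 2 * _).
  by have := autocov_shift (a + n).+1%:Z 0; rewrite addr0.
have -> : (fun w => part a n w * Z (a + n).+1%:Z w) =
    fun w => \sum_(a <= j < a + n) Z j.+1%:Z w * Z (a + n).+1%:Z w.
  by apply/funext => w; rewrite /part mulr_suml.
rewrite Ex_sum//.
rewrite -[X in \sum_(X <= _ < _) _](add0n a) big_addn addKn.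
rewrite [RHS]big_nat_rev/= add0n big_nat [RHS]big_nat; apply: eq_bigr => j /andP[_ jn].
rewrite -(@autocov_shift (j + a).+1%:Z); congr (E _); apply/funext => w.
by congr (_ * Z _ _); lia.
Qed.

Lemma var_sumE n : var_sum n = \sum_(0 <= j < n) var_step j.
Proof. exact: part_var. Qed.

(** The variance of the sum, divided by [n], is the Cesaro mean of its increments. *)
Lemma var_sum_mean_cvg :
  (fun n => var_sum n / n%:R) @ \oo --> limn var_step.
Proof.
rewrite -cvg_shiftS (_ : [sequence _]_n = arithmetic_mean var_step).
  exact: cesaro var_step_cvg.
by apply/funext => n; rewrite /arithmetic_mean /series/= var_sumE mulrC.
Qed.

Lemma step_bound_ge0 : 0 <= step_bound.
Proof. exact: le_trans (var_step_le 0). Qed.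

Lemma part_var_le a n : E (fun w => part a n w ^+ 2) <= step_bound * n%:R.
Proof.
rewrite part_var; apply: (@le_trans _ _ (\sum_(0 <= j < n) step_bound)).
  by apply: ler_sum => j _; exact: le_trans (ler_norm _) (var_step_le j).
by rewrite sumr_const_nat subn0 mulr_natr.
Qed.

Lemma var_sum_lb (s : R) : 0 < s -> limn var_step = s ->
  exists2 n0 : nat, (0 < n0)%N &
  forall n, (n0 <= n)%N -> s / 2 * n%:R <= var_sum n.
Proof.
move=> s0 sE; have := var_sum_mean_cvg; rewrite sE => /cvgr_ge/(_ (s / 2)).
have s2 : s / 2 < s by rewrite ltr_pdivrMr// ltr_pMr// ltr1n.
move=> /(_ s2)[n1 _ hn]; exists n1.+1 => // n n1n.
have := hn n (ltnW n1n) => /=; rewrite ler_pdivlMr// ltr0n.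
exact: leq_trans n1n.
Qed.

Lemma sqr_sum_le (U : nat -> R) a n :
  (\sum_(a <= j < a + n) U j) ^+ 2 <= n%:R * \sum_(a <= j < a + n) U j ^+ 2.
Proof.
elim: n => [|n IH]; first by rewrite addn0 !big_geq// expr0n mul0r.
rewrite addnS !big_nat_recr/= ?leq_addr//.
set s1 := \sum_(_ <= _ < _) U _ in IH *; set s2 := \sum_(_ <= _ < _) _ in IH *.
set x := U _.
have cross : 2 * (s1 * x) <= s2 + n%:R * x ^+ 2.
  have [n0|n0] := posnP n.
    have -> : s1 = 0 by rewrite /s1 n0 addn0 big_geq.
    rewrite mul0r mulr0; apply: addr_ge0; last exact: mulr_ge0 (ler0n _ _) (sqr_ge0 _).
    by rewrite /s2; apply: sumr_ge0 => j _; exact: sqr_ge0.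
  have np : (0 : R) < n%:R by rewrite ltr0n.
  have h : n%:R^-1 * s1 ^+ 2 <= s2 by rewrite mulrC ler_pdivrMr// mulrC.
  apply: le_trans (lerD h (lexx _)); rewrite -subr_ge0.
  have -> : n%:R^-1 * s1 ^+ 2 + n%:R * x ^+ 2 - 2 * (s1 * x) =
    n%:R^-1 * (s1 - n%:R * x) ^+ 2 by field; rewrite gt_eqF.
  by rewrite mulr_ge0 ?sqr_ge0// invr_ge0 ltW.
rewrite -natr1; lra.
Qed.

Section one_scale.
Variables (n m : nat).
Hypothesis n_ge1 : (0 < n)%N.
Hypothesis m_ge1 : (0 < m)%N.
Hypothesis rho_small : rho ^+ m <= n%:R ^- 3.

(** Labels for which the window of [Zm m j.+1] consists of [j, ..., j + m]. *)
Definition shifted_pos (k : nat) : int := k%:Z + 1 - m%:Z.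

Let X (j : nat) : T -> R := Zm m j.+1%:Z.

Definition remainder (a k : nat) (w : T) : R := part a k w - seg X a (a + k) w.

Let nR : (1 : R) <= n%:R. Proof. by rewrite ler1n. Qed.
Let nR0 : (0 : R) < n%:R. Proof. by rewrite ltr0n. Qed.

Let remainderE a k w : remainder a k w =
  \sum_(a <= j < a + k) (Z j.+1%:Z w - Zm m j.+1%:Z w).
Proof. by rewrite /remainder /part /seg sumrB. Qed.

Let iX2 a b : L1 (fun w => seg X a b w ^+ 2).
Proof.
exact: (L1_seg_sqr (X := X) (M := M) (fun j => @mZm m j.+1%:Z) M_ge1
  (fun j => @Zm_L3 m j.+1%:Z) (fun j => Zm_M3 m j.+1%:Z)).
Qed.

Let mX a b : measurable_fun [set: T] (seg X a b).
Proof. by apply: measurable_seg => j; exact: mZm. Qed.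

Let mrem a k : measurable_fun [set: T] (remainder a k).
Proof. exact: measurable_funB. Qed.

Lemma remainder_L2 a k : L1 (fun w => remainder a k w ^+ 2).
Proof.
have -> : (fun w => remainder a k w ^+ 2) = fun w =>
  part a k w ^+ 2 - 2 * (part a k w * seg X a (a + k) w) + seg X a (a + k) w ^+ 2.
  by apply/funext => w; rewrite /remainder; ring.
by apply: L1D => //; apply: L1B => //; apply: L1Z; exact: L1_mul_of_sqr.
Qed.

Lemma remainder_le a k : (k <= n)%N ->
  E (fun w => remainder a k w ^+ 2) <= C ^+ 2 / n%:R ^+ 4.
Proof.
move=> kn; apply: (@le_trans _ _ (E (fun w => k%:R *
    \sum_(a <= j < a + k) (Z j.+1%:Z w - Zm m j.+1%:Z w) ^+ 2))).
  apply: Ex_le; [exact: remainder_L2|by apply: L1Z; exact: L1_sum|].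
  move=> w; rewrite remainderE.
  exact: (sqr_sum_le (fun j => Z j.+1%:Z w - Zm m j.+1%:Z w)).
rewrite ExZ; last exact: L1_sum.
rewrite Ex_sum//.
apply: (@le_trans _ _ (n%:R * (n%:R * (C * n%:R ^- 3) ^+ 2))).
  apply: ler_pM => //.
  - by apply: sumr_ge0 => j _; apply: Ex_ge0 => w; exact: sqr_ge0.
  - by rewrite ler_nat.
  - apply: (@le_trans _ _ (\sum_(a <= j < a + k) (C * n%:R ^- 3) ^+ 2)).
      apply: ler_sum => j _; apply: le_trans (Zm_close _ _) _.
      have r0 : 0 <= rho ^+ m by rewrite exprn_ge0// ltW.
      have i0 : 0 <= n%:R ^- 3 :> R by rewrite invr_ge0 exprn_ge0.
      by rewrite !exprMn ler_wpM2l ?sqr_ge0// ler_pXn2r.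
    rewrite sumr_const_nat addKn -[leLHS]mulr_natl ler_wpM2r ?sqr_ge0//.
    by rewrite ler_nat.
by rewrite le_eqVlt; apply/orP; left; apply/eqP; field; rewrite gt_eqF.
Qed.

Let n4 : C ^+ 2 / n%:R ^+ 4 <= C ^+ 2 / n%:R.
Proof.
rewrite ler_wpM2l ?sqr_ge0// lef_pV2 ?posrE ?exprn_gt0//.
by rewrite -[leLHS]expr1 ler_weXn2l.
Qed.

Let n1 : C ^+ 2 / n%:R <= C ^+ 2.
Proof. by rewrite ler_pdivrMr// ler_peMr ?sqr_ge0. Qed.

Lemma trunc_var_le a k : (0 < k <= n)%N ->
  E (fun w => seg X a (a + k) w ^+ 2) <= (2 * step_bound + 2 * C ^+ 2) * k%:R.
Proof.
move=> /andP[k0 kn].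
apply: (@le_trans _ _ (E (fun w => 2 * part a k w ^+ 2 + 2 * remainder a k w ^+ 2))).
  apply: Ex_le => //; first by apply: L1D; apply: L1Z => //; exact: remainder_L2.
  move=> w; rewrite -subr_ge0 /remainder.
  have -> : 2 * part a k w ^+ 2 + 2 * (part a k w - seg X a (a + k) w) ^+ 2 -
    seg X a (a + k) w ^+ 2 = (2 * part a k w - seg X a (a + k) w) ^+ 2 by ring.
  exact: sqr_ge0.
rewrite ExD; [|exact: L1Z|by apply: L1Z; exact: remainder_L2].
rewrite ExZ// ExZ; last exact: remainder_L2.
rewrite (mulrDl (2 * step_bound)); apply: lerD; rewrite -mulrA;
  apply: ler_wpM2l => //; first exact: part_var_le.
apply: le_trans (remainder_le a kn) _; apply: le_trans n4 _; apply: le_trans n1 _.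
by rewrite ler_peMr ?sqr_ge0// ler1n.
Qed.

(** By [(a + b) ^+ 2 <= 2 * a ^+ 2 + 2 * b ^+ 2] truncation loses half of the lower
    bound and twice the remainder, which costs another half. *)
Lemma trunc_var_ge (s : R) a k : (k <= n)%N -> C ^+ 2 <= s / 8 * k%:R ->
  s / 2 * k%:R <= var_sum k ->
  s / 8 * k%:R <= E (fun w => seg X a (a + k) w ^+ 2).
Proof.
move=> kn Cs lb.
have : E (fun w => part a k w ^+ 2) <=
    E (fun w => 2 * seg X a (a + k) w ^+ 2 + 2 * remainder a k w ^+ 2).
  apply: Ex_le => //; first by apply: L1D; apply: L1Z => //; exact: remainder_L2.
  move=> w; rewrite -subr_ge0 /remainder.
  have -> : 2 * seg X a (a + k) w ^+ 2 + 2 * (part a k w - seg X a (a + k) w) ^+ 2 -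
    part a k w ^+ 2 = (2 * seg X a (a + k) w - part a k w) ^+ 2 by ring.
  exact: sqr_ge0.
rewrite ExD; [|exact: L1Z|by apply: L1Z; exact: remainder_L2].
rewrite ExZ// ExZ; last exact: remainder_L2.
rewrite part_var -var_sumE => h.
have := le_trans (remainder_le a kn) (le_trans n4 n1) => h2.
lra.
Qed.

(** Weights [n^-1] and [n] in the inequality for the cross term suffice, since the
    remainder has second moment of order [n ^- 4]. *)
Lemma trunc_var_close (s : R) : 0 < s -> s / 2 * n%:R <= var_sum n ->
  `|1 - E (fun w => seg X 0 n w ^+ 2) / var_sum n| <= (1 + 4 * C ^+ 2 / s) / n%:R.
Proof.
move=> s0 lb; have v0 : 0 < var_sum n by apply: lt_le_trans lb; rewrite mulr_gt0// divr_gt0.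
pose t : R := n%:R^-1.
have iR := remainder_L2 0 n.
have ipR : L1 (fun w => part 0 n w * remainder 0 n w) by exact: L1_mul_of_sqr.
have segE w : seg X 0 n w = part 0 n w - remainder 0 n w.
  by rewrite /remainder add0n; ring.
have D1 : var_sum n - E (fun w => seg X 0 n w ^+ 2) =
    E (fun w => 2 * (part 0 n w * remainder 0 n w) - remainder 0 n w ^+ 2).
  rewrite /var_sum -ExB//; congr (E _); apply/funext => w; rewrite segE; ring.
have D2 : `|var_sum n - E (fun w => seg X 0 n w ^+ 2)| <=
    t * var_sum n + (n%:R + 1) * (C ^+ 2 / n%:R ^+ 4).
  rewrite D1.
  apply: (@le_trans _ _ (E (fun w => t * part 0 n w ^+ 2 +
      (n%:R + 1) * remainder 0 n w ^+ 2))).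
    apply: Ex_abs_le.
    - by apply: L1B => //; exact: L1Z.
    - by apply: L1D; exact: L1Z.
    - move=> w; apply: le_trans (ler_normB _ _) _.
      rewrite (_ : t * part 0 n w ^+ 2 + (n%:R + 1) * remainder 0 n w ^+ 2 =
        t * part 0 n w ^+ 2 + n%:R * remainder 0 n w ^+ 2 + remainder 0 n w ^+ 2);
        last by ring.
      rewrite (ger0_norm (sqr_ge0 (remainder 0 n w))) lerD2r.
      rewrite -subr_ge0 normrM (@ger0_norm _ 2)// normrM.
      rewrite -(real_normK (num_real (part 0 n w))).
      rewrite -(real_normK (num_real (remainder 0 n w))).
      set p := `|part 0 n w|; set q := `|remainder 0 n w|.
      have -> : t * p ^+ 2 + n%:R * q ^+ 2 - 2 * (p * q) = t * (p - n%:R * q) ^+ 2.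
        by rewrite /t; field; rewrite gt_eqF.
      by rewrite mulr_ge0 ?sqr_ge0// invr_ge0.
  rewrite ExD; [|exact: L1Z|exact: L1Z].
  rewrite ExZ// ExZ//; apply: lerD => //.
  by apply: ler_wpM2l; [rewrite addr_ge0|exact: remainder_le].
have -> : 1 - E (fun w => seg X 0 n w ^+ 2) / var_sum n =
  (var_sum n - E (fun w => seg X 0 n w ^+ 2)) / var_sum n by field; rewrite gt_eqF.
rewrite normrM normfV (gtr0_norm v0) ler_pdivrMr//.
apply: le_trans D2 _.
have h1 : (n%:R + 1) * (C ^+ 2 / n%:R ^+ 4) <= 2 * C ^+ 2.
  apply: (@le_trans _ _ (2 * n%:R * (C ^+ 2 / n%:R ^+ 4))).
    apply: ler_wpM2r; first by rewrite divr_ge0 ?sqr_ge0// exprn_ge0.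
    by rewrite mulr_natl mulr2n lerD2l.
  have -> : 2 * n%:R * (C ^+ 2 / n%:R ^+ 4) = 2 * (C ^+ 2 / n%:R ^+ 3).
    by field; rewrite gt_eqF.
  rewrite ler_wpM2l// ler_pdivrMr ?exprn_gt0// ler_peMr ?sqr_ge0//.
  exact: exprn_ege1.
have h2 : 2 * C ^+ 2 <= 4 * C ^+ 2 / s / n%:R * var_sum n.
  apply: (@le_trans _ _ (4 * C ^+ 2 / s / n%:R * (s / 2 * n%:R))).
    by rewrite le_eqVlt; apply/orP; left; apply/eqP; field; rewrite !gt_eqF.
  apply: ler_wpM2l => //; apply: divr_ge0 (ler0n _ _).
  apply: divr_ge0 (ltW s0); exact: mulr_ge0 (ler0n _ _) (sqr_ge0 _).
have -> : (1 + 4 * C ^+ 2 / s) / n%:R * var_sum n =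
  t * var_sum n + 4 * C ^+ 2 / s / n%:R * var_sum n by rewrite /t; ring.
by rewrite lerD2l (le_trans h1 h2).
Qed.

End one_scale.

Lemma shifted_pos_inj m : injective (shifted_pos m).
Proof. by move=> i j /addIr/addIr[]. Qed.

Lemma shifted_window (m j : nat) : [set l : int | j.+1%:Z - m%:Z <= l <= j.+1%:Z] `<=`
  shifted_pos m @` [set k | (j <= k <= j + m)%N].
Proof.
move=> l /= hl; exists `|(l - 1 + m%:Z)%R|%N; first by clear -hl; lia.
by rewrite /shifted_pos; clear -hl; lia.
Qed.

Section limit_theorem.
Variables (s : R) (n0 : nat).
Hypothesis s_gt0 : 0 < s.
Hypothesis var_lb : forall k, (n0 <= k)%N -> s / 2 * k%:R <= var_sum k.
Hypothesis n0_big : C ^+ 2 <= s / 8 * n0%:R.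

Let C1 : R := Num.sqrt (2 * step_bound + 2 * C ^+ 2 + 1).

Let C1_arg : 0 < 2 * step_bound + 2 * C ^+ 2 + 1.
Proof.
by rewrite ltr_wpDl// addr_ge0// mulr_ge0 ?sqr_ge0// step_bound_ge0.
Qed.

Definition trunc_rate : R := be_rate n0 M C1 (s / 8) + 4.

Definition close_rate : R :=
  3 * (1 + 4 * C ^+ 2 / s) + Num.sqrt (2 / s) + C ^+ 2.

(** Replacing the sum by the truncated one moves the level [x * B] by at most 1, that
    is, [x] by [B ^-1], which is of order [n ^- (1 / 2)]. *)
Lemma berry_esseen_one_scale (n m : nat) (x : R) : (0 < n)%N -> (0 < m)%N ->
  rho ^+ m <= n%:R ^- 3 -> (n0 <= n)%N ->
  `|fine (P [set w | part 0 n w < x * Num.sqrt (var_sum n)]) - Phi x| <=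
  trunc_rate * m%:R ^+ 2 / Num.sqrt n%:R + close_rate / Num.sqrt n%:R.
Proof.
move=> n1 m1 rn n0n.
pose X (j : nat) : T -> R := Zm m j.+1%:Z.
have nR : (1 : R) <= n%:R by rewrite ler1n.
have nR0 : (0 : R) < n%:R by rewrite ltr0n.
have v0 : 0 < var_sum n.
  by apply: lt_le_trans (var_lb n0n); rewrite mulr_gt0// divr_gt0.
pose B := Num.sqrt (var_sum n); have B0 : 0 < B by rewrite sqrtr_gt0.
have B2 : B ^+ 2 = var_sum n by rewrite sqr_sqrtr// ltW.
have s8 : 0 < s / 8 by rewrite divr_gt0.
have cB : s / 8 * n%:R <= B ^+ 2.
  rewrite B2; apply: le_trans (var_lb n0n); rewrite ler_wpM2r// ler_wpM2l ?(ltW s_gt0)//.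
  by rewrite lef_pV2 ?posrE// ler_nat.
pose sn : R := Num.sqrt n%:R; have sn0 : 0 < sn by rewrite sqrtr_gt0.
have n_sn : n%:R^-1 <= sn^-1.
  rewrite lef_pV2 ?posrE// -[leRHS]sqr_sqrtr ?ler0n// expr2 ler_peMr ?sqrtr_ge0//.
  by rewrite -[leLHS]sqrtr1 ler_wsqrtr.
have BE y : `|fine (P [set w | seg X 0 n w < y * B]) - Phi y| <=
    trunc_rate * m%:R ^+ 2 / sn + 3 * ((1 + 4 * C ^+ 2 / s) / n%:R).
  have inj := @shifted_pos_inj m.
  have Xad j : ad eps (shifted_pos m) [set k | (j <= k <= j + m)%N] (X j).
    exact: adaptedS (@shifted_window m j) (@Zm_ad m j.+1%:Z).
  have C1_gt0 : 0 < C1 by rewrite sqrtr_gt0.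
  have ub a k : (0 < k <= n)%N ->
      E (fun w => seg X a (a + k) w ^+ 2) <= C1 ^+ 2 * k%:R.
    move=> kn; apply: le_trans (trunc_var_le n1 rn a kn) _.
    by rewrite ler_wpM2r// sqr_sqrtr ?(ltW C1_arg)// lerDl.
  have lb a k : (n0 <= k <= n)%N ->
      s / 8 * k%:R <= E (fun w => seg X a (a + k) w ^+ 2).
    move=> /andP[n0k kn]; apply: (trunc_var_ge n1 rn) => //; last exact: var_lb.
    apply: le_trans n0_big _; rewrite ler_wpM2l ?ler_nat//; exact: ltW.
  have nn : (0 < n <= n)%N by rewrite n1 leqnn.
  apply: le_trans (berry_esseen_m_dependent eps_indep inj m1 Xad
    (fun j => Zm_mean m j.+1%:Z) M_ge1 (fun j => @Zm_L3 m j.+1%:Z)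
    (fun j => Zm_M3 m j.+1%:Z) C1_gt0 s8 ub lb y nn B0 cB) _.
  rewrite lerD2l ler_wpM2l// B2; apply: (trunc_var_close n1 rn) => //.
  exact: var_lb.
have mpart' : measurable_fun [set: T] (part 0 n) by exact: mpart.
have mX' : measurable_fun [set: T] (seg X 0 n) by apply: measurable_seg => j; exact: mZm.
have iR : L1 (fun w => (part 0 n w - seg X 0 n w) ^+ 2).
  by have := remainder_L2 m 0 n; rewrite /remainder add0n.
have ER : E (fun w => (part 0 n w - seg X 0 n w) ^+ 2) <= C ^+ 2 / sn.
  have := remainder_le n1 rn 0 (leqnn n); rewrite /remainder add0n => /le_trans; apply.
  rewrite ler_wpM2l ?sqr_ge0//; apply: le_trans n_sn.
  by rewrite lef_pV2 ?posrE ?exprn_gt0// -[leLHS]expr1 ler_weXn2l.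
have RE : E (fun w => (seg X 0 n w - part 0 n w) ^+ 2) =
    E (fun w => (part 0 n w - seg X 0 n w) ^+ 2).
  by congr (E _); apply/funext => w; ring.
have Binv : B^-1 <= Num.sqrt (2 / s) / sn.
  rewrite -[Num.sqrt (2 / s)]invrK -invfM lef_pV2 ?posrE//; last first.
    by rewrite mulr_gt0// invr_gt0 sqrtr_gt0 divr_gt0.
  rewrite -(@ler_pXn2r _ 2) ?nnegrE ?(ltW B0)//; last first.
    by rewrite mulr_ge0// ?invr_ge0 ?sqrtr_ge0// ltW.
  rewrite B2 exprMn exprVn sqr_sqrtr ?divr_ge0 ?(ltW s_gt0)// sqr_sqrtr ?ler0n//.
  by rewrite invf_div; exact: var_lb.
have hi := prob_lt_perturb (P := P) (x * B) mpart' mX' iR.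
have lo := prob_lt_perturb (P := P) (x * B - 1) mX' mpart'.
rewrite RE in lo.
have iR' : L1 (fun w => (seg X 0 n w - part 0 n w) ^+ 2).
  by rewrite (_ : (fun w => _) = fun w => (part 0 n w - seg X 0 n w) ^+ 2)//;
    apply/funext => w; ring.
have {}lo := lo iR'.
rewrite subrK in lo.
have xp : x * B + 1 = (x + B^-1) * B by field; rewrite gt_eqF.
have xm : x * B - 1 = (x - B^-1) * B by field; rewrite gt_eqF.
rewrite xp in hi; rewrite xm in lo.
have bp := BE (x + B^-1); have bm := BE (x - B^-1).
have Bi0 : 0 <= B^-1 by rewrite invr_ge0 ltW.
have pp := Phi_lip (x + B^-1) x; have pm := Phi_lip (x - B^-1) x.
rewrite (_ : x + B^-1 - x = B^-1) in pp; last by ring.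
rewrite (_ : x - B^-1 - x = - B^-1) in pm; last by ring.
rewrite normrN in pm; rewrite !(ger0_norm Bi0) in pp pm.
have c1 : (1 + 4 * C ^+ 2 / s) / n%:R <= (1 + 4 * C ^+ 2 / s) / sn.
  apply: ler_wpM2l => //; apply: addr_ge0 => //.
  by apply: divr_ge0 (ltW s_gt0); exact: mulr_ge0 (ler0n _ _) (sqr_ge0 _).
have -> : close_rate / sn = 3 * ((1 + 4 * C ^+ 2 / s) / sn) +
  Num.sqrt (2 / s) / sn + C ^+ 2 / sn by rewrite /close_rate; ring.
move: hi lo bp bm pp pm c1 Binv ER; rewrite -/B -/sn.
set p := fine (P [set w | part _ _ _ < _]).
set pu := fine (P [set w | seg _ _ _ _ < (x + _) * _]).
set pl := fine (P [set w | seg _ _ _ _ < (x - _) * _]).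
set e1 := trunc_rate * _ / _; set e2 := (1 + _) / n%:R; set e3 := (1 + _) / sn.
set e4 := Num.sqrt _ / sn; set e5 := C ^+ 2 / sn; set e6 := E _.
set ph := Phi (x + _); set pl' := Phi (x - _).
clearbody p pu pl e1 e2 e3 e4 e5 e6 ph pl'.
rewrite !ler_norml => hi lo /andP[b1 b2] /andP[b3 b4] /andP[q1 q2] /andP[q3 q4] *.
by apply/andP; split; lra.
Qed.

End limit_theorem.

Definition mean_sd (n : nat) : R := Num.sqrt (var_sum n / n%:R).

Lemma mean_sd_cvg : mean_sd @ \oo --> Num.sqrt (limn var_step).
Proof.
apply: (@cvg_comp _ _ _ (fun n => var_sum n / n%:R) Num.sqrt).
  exact: var_sum_mean_cvg.
exact: sqrt_continuous.
Qed.

(** With [m] the integer part of [3 * ln n / - ln rho], plus one, [rho ^+ m] is at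
    most [n ^- 3] and [m] is of order [ln n].  Small values of [n] are covered by
    enlarging the constant. *)
Theorem berry_esseen_process : cvgn mean_sd /\
  (0 < limn mean_sd -> exists2 K : R, 0 < K & forall (n : nat) (x : R),
     (2 <= n)%N ->
     `|fine (P [set w | part 0 n w < x * Num.sqrt (var_sum n)]) - Phi x| <=
     K * (ln n%:R ^+ 2 / Num.sqrt n%:R)).
Proof.
split; first by apply: cvgP; exact: mean_sd_cvg.
have -> : limn mean_sd = Num.sqrt (limn var_step) by exact: cvg_lim mean_sd_cvg.
rewrite sqrtr_gt0; set s := limn var_step => s0.
have [n1 n1_gt0 lb] := var_sum_lb s0 erefl.
(* From [n0] on, the variance is linear in [n] also after truncation. *)
pose n0 := (n1 + (Num.truncn (8 * C ^+ 2 / s)).+1)%N.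
have lb0 k : (n0 <= k)%N -> s / 2 * k%:R <= var_sum k.
  by move=> h; apply: lb; apply: leq_trans h; exact: leq_addr.
have big0 : C ^+ 2 <= s / 8 * n0%:R.
  have h : 8 * C ^+ 2 / s <= n0%:R.
    apply: le_trans (ltW (truncnS_gt _)) _; rewrite ler_nat; exact: leq_addl.
  move: h; rewrite ler_pdivrMr// => h; lra.
pose lam := - ln rho.
have lam0 : 0 < lam by rewrite oppr_gt0 ln_lt0// rho_gt0.
have l2 : 0 < ln 2%:R :> R by rewrite ln_gt0// ltr1n.
pose kap0 := 3 / lam + (ln 2%:R)^-1.
pose K := `|trunc_rate s n0| * kap0 ^+ 2 + `|close_rate s| * (ln 2%:R) ^- 2 +
  Num.sqrt n0%:R * (ln 2%:R) ^- 2 + 1.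
have k1 : 0 <= `|trunc_rate s n0| * kap0 ^+ 2 by rewrite mulr_ge0 ?sqr_ge0.
have l22 : 0 <= (ln 2%:R) ^- 2 :> R by rewrite invr_ge0 sqr_ge0.
have k2 : 0 <= `|close_rate s| * (ln 2%:R) ^- 2 by rewrite mulr_ge0.
have k3 : 0 <= Num.sqrt n0%:R * (ln 2%:R) ^- 2 :> R by rewrite mulr_ge0 ?sqrtr_ge0.
exists K; first by rewrite /K ltr_wpDl// addr_ge0// addr_ge0.
move=> n x n2.
have nR0 : (0 : R) < n%:R by rewrite ltr0n; exact: leq_trans n2.
pose sn : R := Num.sqrt n%:R; have sn0 : 0 < sn by rewrite sqrtr_gt0.
have lnn : ln 2%:R <= ln n%:R :> R by rewrite ler_ln ?posrE ?ltr0n ?ler_nat// (leq_trans _ n2).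
have lnn0 : 0 < ln n%:R :> R by exact: lt_le_trans lnn.
have one_le : 1 <= (ln 2%:R) ^- 2 * ln n%:R ^+ 2 :> R.
  rewrite mulrC ler_pdivlMr ?exprn_gt0// mul1r.
  have h1 := ltW l2; have h2 := ltW lnn0.
  by rewrite ler_pXn2r ?nnegrE.
have [n0n|nn0] := leqP n0 n; last first.
  apply: (@le_trans _ _ 1).
    by apply: prob_Phi_dist_le1; apply: measurable_lt_set; exact: mpart.
  apply: (@le_trans _ _ (Num.sqrt n0%:R * (ln 2%:R) ^- 2 * (ln n%:R ^+ 2 / sn))).
    rewrite mulrA ler_pdivlMr// mul1r -mulrA.
    apply: (@le_trans _ _ (Num.sqrt n0%:R)).
      by rewrite ler_wsqrtr// ler_nat ltnW.
    by rewrite ler_peMr ?sqrtr_ge0.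
  apply: ler_wpM2r; first by rewrite divr_ge0 ?sqr_ge0// ltW.
  rewrite /K -addrA addrCA lerDl addr_ge0// addr_ge0//.
pose m := (Num.truncn (3 * ln n%:R / lam)).+1.
have a0 : 0 <= 3 * ln n%:R / lam by rewrite divr_ge0 ?mulr_ge0// ltW.
have mlo : 3 * ln n%:R / lam <= m%:R by exact: ltW (truncnS_gt _).
have mhi : m%:R <= kap0 * ln n%:R.
  have h : m%:R <= 3 * ln n%:R / lam + 1.
    by rewrite /m -natr1 lerD2r; have /andP[] := truncn_itv a0.
  apply: le_trans h _.
  rewrite /kap0 (mulrDl (3 / lam)) (mulrAC 3 lam^-1) lerD2l.
  by rewrite mulrC ler_pdivlMr// mul1r.
have rn : rho ^+ m <= n%:R ^- 3.
  have eR : rho ^+ m = expR (m%:R * - lam).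
    by rewrite expRM_natl /lam opprK lnK// posrE.
  have eN : (n%:R : R) ^- 3 = expR (- (3%:R * ln n%:R)).
    by rewrite expRN expRM_natl lnK// posrE.
  rewrite eR eN ler_expR mulrN lerN2.
  by move: mlo; rewrite ler_pdivrMr.
have := berry_esseen_one_scale s0 lb0 big0 x (ltnW n2) (ltn0Sn _) rn n0n.
move=> /le_trans; apply.
have t1 : trunc_rate s n0 * m%:R ^+ 2 / sn <=
    `|trunc_rate s n0| * kap0 ^+ 2 * (ln n%:R ^+ 2 / sn).
  rewrite [leRHS]mulrA; apply: ler_wpM2r; first by rewrite invr_ge0 ltW.
  rewrite -[leRHS]mulrA -exprMn; apply: (@le_trans _ _ (`|trunc_rate s n0| * m%:R ^+ 2)).
    by apply: ler_wpM2r; [exact: sqr_ge0|exact: ler_norm].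
  by apply: ler_wpM2l => //; rewrite ler_pXn2r ?nnegrE// (le_trans _ mhi).
have t2 : close_rate s / sn <= `|close_rate s| * (ln 2%:R) ^- 2 * (ln n%:R ^+ 2 / sn).
  rewrite [leRHS]mulrA; apply: ler_wpM2r; first by rewrite invr_ge0 ltW.
  rewrite -[leRHS]mulrA; apply: le_trans (ler_norm _) _; exact: ler_peMr.
apply: le_trans (lerD t1 t2) _; rewrite -mulrDl; apply: ler_wpM2r.
  by rewrite divr_ge0 ?sqr_ge0// ltW.
by rewrite /K -addrA lerDl addr_ge0.
Qed.

End approximable.

(** * Measurable limits and the law of the shifted noise *)

Section limits_and_shifts.
Set Implicit Arguments.
Unset Strict Implicit.

(** The sequence converges exactly where its upper and lower limits are equal and
    finite; elsewhere [limn] is a default value, the same at every point. *)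
Lemma measurable_limn {d : measure_display} {T : measurableType d}
    {R : realType} (u : nat -> T -> R) :
  (forall n, measurable_fun [set: T] (u n)) ->
  measurable_fun [set: T] (fun w => limn (fun n => u n w)).
Proof.
move=> mu.
pose s w := limn_esup (fun n => (u n w)%:E).
pose i w := limn_esup (fun n => (- u n w)%:E).
have ms : measurable_fun [set: T] s.
  apply: (@measurable_fun_limn_esup _ _ _ _ (fun n w => (u n w)%:E)) => n.
  exact/measurable_EFinP.
have mi : measurable_fun [set: T] i.
  apply: (@measurable_fun_limn_esup _ _ _ _ (fun n w => (- u n w)%:E)) => n.
  by apply/measurable_EFinP; exact: measurableT_comp.
have iE w : i w = (- limn_einf (fun n => (u n w)%:E))%E.
  by rewrite -limn_esupN.
have cvgE w : (s w + i w = 0)%E <-> cvgn (fun n => u n w).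
  rewrite iE; split.
    have := is_cvg_einfs (u := fun n => (u n w)%:E).
    move: (nondecreasing_einfs (fun n => (u n w)%:E)) => _ ce.
    have cs : cvgn (esups (fun n => (u n w)%:E)) by exact: is_cvg_esups.
    move=> h.
    have [E ef] : s w = limn_einf (fun n => (u n w)%:E) /\
        limn_einf (fun n => (u n w)%:E) \is a fin_num.
      move: h; case: (s w) (limn_einf _) => [a| |] [b| |]//= [ab].
      by split=> //; congr EFin; apply/eqP; rewrite -subr_eq0 ab.
    have : (u n w)%:E @[n --> \oo] --> limn_einf (fun n => (u n w)%:E).
      apply: (@squeeze_cvge _ _ _ _ (einfs (fun n => (u n w)%:E)) _
        (esups (fun n => (u n w)%:E))).
      - apply: nearW => n; apply/andP; split.
          by apply: ereal_inf_lbound; exists n => //=.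
        by apply: ereal_sup_ubound; exists n => //=.
      - by rewrite limn_einf_lim.
      - by rewrite -E /s limn_esup_lim.
    by rewrite -[limn_einf _]fineK// => /fine_cvgP[_]; exact: cvgP.
  move=> /cvg_ex[/= l ul].
  have h : (u n w)%:E @[n --> \oo] --> l%:E by apply: cvg_EFin => //; exact: nearW.
  by rewrite /s !(cvg_limn_einf_sup h) -EFinB subrr.
have -> : (fun w => limn (fun n => u n w)) =
    fun w => if (s w + i w == 0)%E then fine (s w) else point.
  apply/funext => w; case: ifPn => [/eqP /cvgE c|/eqP nc].
    apply: (@cvg_lim _ _ _) => //.
    have h : (u n w)%:E @[n --> \oo] --> (limn (fun n => u n w))%:E.
      by apply: cvg_EFin => //; exact: nearW.
    by rewrite /s (cvg_limn_einf_sup h).2.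
  by apply: dvgP => c; apply: nc; exact/cvgE.
apply: measurable_fun_ifT => //.
- apply: (measurable_fun_bool true); rewrite setTI.
  rewrite (_ : _ @^-1` _ = (fun w => s w + i w)%E @^-1` [set 0%E]).
    rewrite -[X in measurable X]setTI.
    exact: (emeasurable_funD ms mi measurableT (emeasurable_set1 0%E)).
  by apply/seteqP; split => w /= /eqP.
- by apply: measurableT_comp => //; exact: measurable_fine.
Qed.
End limits_and_shifts.

Section shift_invariance.
Set Implicit Arguments.
Unset Strict Implicit.
Context {d : measure_display} {T : measurableType d} {R : realType}.
Context {P : probability T R}.
Variable eps : int -> {RV P >-> R}.
Hypothesis eps_iid : iid eps.

Definition path_cylinders : set (set (int -> R)) :=
  [set A | exists (F : {fset int}) (B : int -> set R),
    (forall k, measurable (B k)) /\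
    A = \bigcap_(k in [set` F]) [set e | B k (e k)]].

Local Notation paths := (g_sigma_algebraType path_cylinders).

(** The noise seen from time [h], as a random point of the path space with the
    product sigma-algebra. *)
Definition path_from (h : int) (w : T) : paths := fun l => eps (l + h) w.

Lemma path_cylinders_setI : setI_closed path_cylinders.
Proof.
move=> _ _ [F1 [B1 [m1 ->]]] [F2 [B2 [m2 ->]]].
exists (F1 `|` F2)%fset, (fun k => (if k \in F1 then B1 k else setT) `&`
  (if k \in F2 then B2 k else setT)); split.
  by move=> k; apply: measurableI; case: ifPn.
apply/seteqP; split => w /=.
  move=> [h1 h2] k /=; rewrite in_fsetU => _; split; case: ifPn => // kF.
    exact: h1.
  exact: h2.
move=> h; split => k /= kF; have := h k; rewrite /= in_fsetU kF ?orbT.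
  by move=> /(_ isT)[].
by move=> /(_ isT)[].
Qed.

Lemma measurable_coord k : measurable_fun [set: paths] (fun e : paths => e k).
Proof.
move=> _ B mB; rewrite setTI; apply: sub_sigma_algebra.
exists [fset k]%fset, (fun=> B); split => //.
apply/seteqP; split => w /= h; last by apply: h => /=; rewrite in_fset1.
by move=> k' /=; rewrite in_fset1 => /eqP ->.
Qed.

Lemma shift_cylinder h (F : {fset int}) (B : int -> set R) :
  path_from h @^-1` (\bigcap_(k in [set` F]) [set e | B k (e k)]) =
  \bigcap_(l in [set` [fset (k + h)%R | k in F]%fset]) eps l @^-1` B (l - h).
Proof.
apply/seteqP; split => w /= hw.
  by move=> l /= /imfsetP[k /= kF ->]; rewrite addrK; exact: hw.
move=> k /= kF; have := hw (k + h); rewrite /= addrK; apply.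
by apply/imfsetP; exists k.
Qed.

Lemma measurable_eps_preimage k (B : set R) : measurable B ->
  measurable (eps k @^-1` B).
Proof.
by move=> mB; rewrite -[X in measurable X]setTI; exact: (@measurable_funP _ _ _ _ _ (eps k)).
Qed.

Lemma measurable_shift h : measurable_fun [set: T] (path_from h).
Proof.
apply: (@measurability _ _ _ paths _ _ path_cylinders) => //.
move=> _ [_ [F [B [mB ->]]] <-]; rewrite setTI shift_cylinder.
apply: fin_bigcap_measurable; first exact: finite_fset.
by move=> k _; exact: measurable_eps_preimage.
Qed.

(** The probability of a cylinder is the product of those of its sides, which does
    not depend on [h]. *)
Lemma shift_law h (A : set paths) : measurable A ->
  P (path_from h @^-1` A) = P (path_from 0 @^-1` A).
Proof.
have cylE k : forall (F : {fset int}) (B : int -> set R), (forall k, measurable (B k)) ->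
    P (path_from k @^-1` (\bigcap_(k in [set` F]) [set e | B k (e k)])) =
    (\prod_(l <- F) P (eps 0 @^-1` B l))%E.
  move=> F B mB; rewrite shift_cylinder eps_iid.1; last by move=> *; exact: mB.
  rewrite big_imfset/=; last by move=> x y _ _ /addIr.
  by apply: eq_bigr => l _; rewrite addrK; exact: (eps_iid.2 _ _ (mB l)).
move=> mA.
apply: (@g_sigma_algebra_measure_unique _ _ paths path_cylinders _
  (fun=> setT) _ _ (pushforward P (path_from h)) (pushforward P (path_from 0))).
- exact: sub_sigma_algebra.
- move=> _; exists fset0, (fun=> setT); split => //.
  by apply/seteqP; split => // w _ k /=; rewrite in_fset0.
- by rewrite bigcup_const.
- exact: measurable_shift.
- exact: measurable_shift.
- exact: path_cylinders_setI.
- move=> h1 h2 X [F [B [mB ->]]]; rewrite /pushforward; exact: etrans (cylE _ _ _ mB) (esym (cylE _ _ _ mB)).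
- by move=> h1 k; exact: (le_lt_trans (probability_le1 P measurableT) (ltry 1)).
- exact: mA.
Qed.

Lemma integral_shift h (F : paths -> \bar R) : measurable_fun [set: paths] F ->
  (\int[P]_w F (path_from h w) = \int[P]_w F (path_from 0 w))%E.
Proof.
move=> mF.
have pos (G : paths -> \bar R) : measurable_fun [set: paths] G ->
    (forall e, 0 <= G e)%E ->
    (\int[P]_w G (path_from h w) = \int[P]_w G (path_from 0 w))%E.
  move=> mG G0.
  have ePf k : (\int[P]_w G (path_from k w) = \int[pushforward P (path_from k)]_e G e)%E.
    by rewrite ge0_integral_pushforward ?preimage_setT//; exact: measurable_shift.
  rewrite !ePf; apply: eq_measure_integral; [exact: measurable_shift|exact: measurable_shift|move=> h1 h2 A mA sA; exact: shift_law].
rewrite [LHS]integralE [RHS]integralE; congr (_ - _)%E.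
  rewrite (funepos_comp F (path_from h)) (funepos_comp F (path_from 0)).
  exact: (pos (F^\+)%E (measurable_funepos mF) (funepos_ge0 _)).
rewrite (funeneg_comp F (path_from h)) (funeneg_comp F (path_from 0)).
exact: (pos (F^\-)%E (measurable_funeneg mF) (funeneg_ge0 _)).
Qed.

Lemma ae_eps k (A : set R) : measurable A ->
  {ae P, forall w, A (eps 0 w)} -> {ae P, forall w, A (eps k w)}.
Proof.
move=> mA [N [mN PN NA]].
exists (eps k @^-1` (~` A)); split => //.
  exact: (measurable_eps_preimage k (measurableC mA)).
have := eps_iid.2 k _ (measurableC mA); rewrite /distribution /pushforward /= => ->.
apply: (subset_measure0 _ mN NA PN).
exact: (measurable_eps_preimage 0 (measurableC mA)).
Qed.

End shift_invariance.

(** * The logarithmic volatility as a function of the noise *)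

Section garch_paths.
Set Implicit Arguments.
Unset Strict Implicit.
Context {R : realType}.
Variables (c g : R -> R).

(** Indices starting at 0, for induction. *)
Lemma garch_partialE {T : Type} (e : int -> T -> R) k w n :
  garch_partial c g e k w n =
  \sum_(0 <= i < n) g (e (k - i.+1%:Z) w) *
    \prod_(0 <= j < i) c (e (k - j.+1%:Z) w).
Proof.
rewrite /garch_partial big_add1 /=; apply: eq_bigr => i _.
by rewrite big_add1.
Qed.

(** The series at time [k + h] is the series at time [k] of the shifted path, which
    is how stationarity of the noise passes to the process. *)
Lemma garch_partial_shift {T : Type} (e : int -> T -> R) k h w n :
  garch_partial c g e (k + h) w n =
  garch_partial c g (fun l (p : int -> R) => p l) k (fun l => e (l + h) w) n.
Proof.
rewrite !garch_partialE; apply: eq_bigr => i _.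
rewrite addrAC; congr (_ * _); apply: eq_bigr => j _.
by rewrite addrAC.
Qed.

Hypothesis c_meas : measurable_fun [set: R] c.
Hypothesis g_meas : measurable_fun [set: R] g.

Lemma measurable_garch_partial {d} {T : measurableType d} (e : int -> T -> R)
    k n : (forall l, k - n%:Z <= l -> l < k -> measurable_fun [set: T] (e l)) ->
  measurable_fun [set: T] (fun w => garch_partial c g e k w n).
Proof.
move=> me.
have -> : (fun w => garch_partial c g e k w n) = fun w =>
    \sum_(i < n) g (e (k - i.+1%:Z) w) * \prod_(0 <= j < i) c (e (k - j.+1%:Z) w).
  by apply/funext => w; rewrite garch_partialE big_mkord.
apply: measurable_sum => i.
have mei j : (j <= i)%N -> measurable_fun [set: T] (e (k - j.+1%:Z)).
  move=> ji; have := ltn_ord i => iN; apply: me; clear -ji iN; lia.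
apply: measurable_funM; first exact: measurableT_comp (mei _ _).
have h : forall j, (j <= i)%N ->
    measurable_fun [set: T] (fun w => \prod_(0 <= l < j) c (e (k - l.+1%:Z) w)).
  elim=> [_|j IH ji].
    rewrite (_ : (fun w => _) = fun=> 1); first exact: measurable_cst.
    by apply/funext => w; rewrite big_geq.
  rewrite (_ : (fun w => _) = fun w =>
      \prod_(0 <= l < j) c (e (k - l.+1%:Z) w) * c (e (k - j.+1%:Z) w)).
    apply: measurable_funM; first exact: IH (ltnW ji).
    by apply: measurableT_comp => //; exact: mei (ltnW ji).
  by apply/funext => w; rewrite big_nat_recr.
exact: h.
Qed.

Lemma measurable_garch_X {d} {T : measurableType d} (e : int -> T -> R) k :
  (forall l, l < k -> measurable_fun [set: T] (e l)) ->
  measurable_fun [set: T] (garch_X c g e k).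
Proof.
move=> me; apply: (measurable_limn (u := fun n w => garch_partial c g e k w n)) => n.
by apply: measurable_garch_partial => l _; exact: me.
Qed.

End garch_paths.

(** * Exponential inequalities *)

Section exp_inequalities.
Set Implicit Arguments.
Context {R : realType}.
Implicit Types a b t u : R.

(** Convexity between 0 and [u], from the tangent at [t * u]. *)
Lemma expR_convex0 t u : 0 <= t <= 1 -> expR (t * u) <= 1 + t * (expR u - 1).
Proof.
move=> /andP[t0 t1].
have h1 : expR (t * u) * (1 + (u - t * u)) <= expR u.
  have -> : expR u = expR (t * u) * expR (u - t * u).
    by rewrite -expRD addrC subrK.
  by apply: ler_wpM2l; [exact: expR_ge0|exact: expR_ge1Dx].
have h2 : expR (t * u) * (1 - t * u) <= 1.
  have {2}-> : 1 = expR (t * u) * expR (- (t * u)) :> R.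
    by rewrite -expRD subrr expR0.
  by apply: ler_wpM2l; [exact: expR_ge0|exact: expR_ge1Dx].
have := lerD (ler_wpM2l t0 h1) (ler_wpM2l (_ : 0 <= 1 - t) h2).
by rewrite subr_ge0 => /(_ t1); move: (expR (t * u)) (expR u) => x y; nra.
Qed.

Lemma expR_dist_le a b M : `|a| <= M -> `|b| <= M ->
  `|expR a - expR b| <= `|a - b| * expR M.
Proof.
have half x y : x <= M -> y <= M -> expR x - expR y <= `|x - y| * expR M.
  move=> xM yM.
  have h : expR x - expR y <= (x - y) * expR x.
    have := ler_wpM2l (expR_ge0 x) (expR_ge1Dx (y - x)).
    by rewrite -expRD (addrC x) subrK; move: (expR x) (expR y) => p q; nra.
  apply: le_trans h _; apply: le_trans (ler_norm _) _.
  by rewrite normrM ler_wpM2l// ger0_norm ?expR_ge0// ler_expR.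
move=> /ler_normlW aM /ler_normlW bM.
by rewrite ler_norml half// andbT lerNl opprB distrC half.
Qed.

Lemma sqr_le_expR t a : 0 < t -> 0 <= a -> a ^+ 2 <= 4 / t ^+ 2 * expR (t * a).
Proof.
move=> t0 a0.
have h : (t * a / 2) ^+ 2 <= expR (t * a).
  have -> : expR (t * a) = expR (t * a / 2) ^+ 2.
    by rewrite -expRM_natl; congr expR; field.
  have ta : 0 <= t * a / 2 by rewrite divr_ge0// mulr_ge0// ltW.
  rewrite ler_pXn2r ?nnegrE ?expR_ge0//.
  by apply: le_trans (expR_ge1Dx _); rewrite lerDr.
have -> : a ^+ 2 = 4 / t ^+ 2 * (t * a / 2) ^+ 2.
  by field; rewrite gt_eqF.
by apply: ler_wpM2l => //; rewrite divr_ge0// sqr_ge0.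
Qed.

Lemma expR_mix t s a b : 0 <= t -> 0 <= s ->
  expR (t * a + s * b) <= expR ((t + s) * a) + expR ((t + s) * b).
Proof.
move=> t0 s0; rewrite !mulrDl; have [ab|/ltW ba] := leP a b.
  rewrite -[leLHS]add0r; apply: lerD; first exact: expR_ge0.
  by rewrite ler_expR lerD2r ler_wpM2l.
rewrite -[leLHS]addr0; apply: lerD; last exact: expR_ge0.
by rewrite ler_expR lerD2l ler_wpM2l.
Qed.

End exp_inequalities.

(** * Moments under shifts and limits *)

Section same_law.
Set Implicit Arguments.
Unset Strict Implicit.
Context {d : measure_display} {T : measurableType d} {R : realType}.
Context {P : probability T R}.
Variable eps : int -> {RV P >-> R}.
Hypothesis eps_iid : iid eps.

Lemma integral_eps k (h : R -> \bar R) : measurable_fun [set: R] h ->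
  (\int[P]_w h (eps k w) = \int[P]_w h (eps 0 w))%E.
Proof.
move=> mh.
have E j : (\int[P]_w h (eps j w) = \int[P]_w h (path_from eps j w 0%R))%E.
  by apply: eq_integral => w _; rewrite /path_from add0r.
have mF := measurableT_comp mh (@measurable_coord R 0).
by rewrite (E k) (E 0); exact: (integral_shift eps_iid k mF).
Qed.

Lemma L1_eps k (h : R -> R) : measurable_fun [set: R] h ->
  L1 P (fun w => h (eps 0 w)) -> L1 P (fun w => h (eps k w)).
Proof.
move=> mh /integrableP[_ i0]; apply/integrableP; split.
  by apply/measurable_EFinP; exact: measurableT_comp.
have mA : measurable_fun [set: R] (fun x => `|(h x)%:E|%E).
  by apply: measurableT_comp => //; exact/measurable_EFinP.
by rewrite (integral_eps k mA).
Qed.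

Lemma Ex_eps k (h : R -> R) : measurable_fun [set: R] h ->
  Ex P (fun w => h (eps k w)) = Ex P (fun w => h (eps 0 w)).
Proof.
move=> mh; rewrite /Ex unlock; congr fine.
have mE : measurable_fun [set: R] (fun x => (h x)%:E) by exact/measurable_EFinP.
exact: (integral_eps k mE).
Qed.

Lemma Ex_shift h (F : (int -> R) -> R) :
  measurable_fun [set: g_sigma_algebraType (@path_cylinders R)] F ->
  Ex P (fun w => F (path_from eps h w)) = Ex P (fun w => F (path_from eps 0 w)).
Proof.
move=> mF; rewrite /Ex unlock; congr fine.
have mE : measurable_fun [set: g_sigma_algebraType (@path_cylinders R)]
    (fun e => (F e)%:E) by exact/measurable_EFinP.
exact: (integral_shift eps_iid h mE).
Qed.

End same_law.

Section fatou.
Set Implicit Arguments.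
Unset Strict Implicit.
Context {d : measure_display} {T : measurableType d} {R : realType}.
Context {P : probability T R}.

(** Fatou's lemma, for a sequence that converges almost everywhere only. *)
Lemma fatou_Ex (U : nat -> T -> R) (V : T -> R) B :
  (forall n, L1 P (U n)) -> (forall n w, 0 <= U n w) ->
  (forall n, Ex P (U n) <= B) -> measurable_fun [set: T] V ->
  (forall w, 0 <= V w) ->
  {ae P, forall w, U n w @[n --> \oo] --> V w} ->
  L1 P V /\ Ex P V <= B.
Proof.
move=> iU U0 UB mV V0 UV.
have le : (\int[P]_w (V w)%:E <= B%:E)%E.
  have -> : (\int[P]_w (V w)%:E =
      \int[P]_w limn_einf (fun n => (U n w)%:E))%E.
    apply: ge0_ae_eq_integral => //.
    - exact/measurable_EFinP.
    - have -> : (fun w => limn_einf (fun n => (U n w)%:E)) =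
          fun w => (- limn_esup (fun n => (- U n w)%:E))%E.
        apply/funext => w; rewrite -[LHS]oppeK -limn_esupN; congr (- limn_esup _)%E.
      apply: measurableT_comp => //.
      apply: (@measurable_fun_limn_esup _ _ _ _ (fun n w => (- U n w)%:E)) => n.
      by apply/measurable_EFinP; apply: measurableT_comp => //; exact: L1_meas.
    - by move=> w _; rewrite lee_fin.
    - move=> w _; rewrite limn_einf_lim; apply: lime_ge.
        exact: is_cvg_einfs.
      apply: nearW => n; apply: le_ereal_inf_tmp => _ [m _ <-].
      by rewrite lee_fin.
    - apply: filterS UV => w h _; apply: esym.
      have h' : (U n w)%:E @[n --> \oo] --> (V w)%:E.
        by apply: cvg_EFin => //; exact: nearW.
      by rewrite (cvg_limn_einf_sup h').1.
  apply: le_trans (fatou P measurableT _ _) _.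
  - by move=> n; apply/measurable_EFinP; exact: L1_meas.
  - by move=> n w _; rewrite lee_fin.
  have -> : (fun n => \int[P]_w (U n w)%:E)%E = fun n => (Ex P (U n))%:E.
    by apply/funext => n; rewrite EFin_Ex.
  rewrite limn_einf_lim; apply: lime_le; first exact: is_cvg_einfs.
  apply: nearW => n; apply: ge_ereal_inf.
  by exists (Ex P (U n))%:E; [exists n => //=|rewrite lee_fin].
have iV : L1 P V.
  apply/integrableP; split; first exact/measurable_EFinP.
  apply: le_lt_trans (ltry B).
  by under eq_integral => w _ do rewrite /= ger0_norm//.
by split => //; rewrite -lee_fin EFin_Ex.
Qed.

End fatou.

(** * Truncation of the volatility series *)

Section garch_truncation.
Set Implicit Arguments.
Unset Strict Implicit.
Context {d : measure_display} {T : measurableType d} {R : realType}.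
Context {P : probability T R}.
Variable eps : int -> {RV P >-> R}.
Variables (c g f : R -> R) (rho mu nu : R).
Hypothesis eps_iid : iid eps.
Hypothesis c_meas : measurable_fun [set: R] c.
Hypothesis g_meas : measurable_fun [set: R] g.
Hypothesis f_meas : measurable_fun [set: R] f.
Hypothesis rho_gt0 : 0 < rho.
Hypothesis rho_lt1 : rho < 1.
Hypothesis nu_gt0 : 0 < nu.
Hypothesis mu_nu : 3 * nu / 2 < mu.
Hypothesis c_bounded : {ae P, forall w, `|c (eps 0 w)| <= rho}.
Hypothesis g_moment : L1 P (fun w => expR (mu * `|g (eps 0 w)|)).
Hypothesis f_moment : L1 P (fun w => `|f (eps 0 w)| ^+ 3).
Hypothesis f_scale : forall x e : R,
  f (Num.sqrt (expR x) * e) = expR (nu / 2 * x) * f e.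
Hypothesis X_cvg : forall k : int,
  {ae P, forall w, cvgn (garch_partial c g eps k w)}.

Local Notation E := (Ex P).
Local Notation L1 := (L1 P).

(** The bound on [c] holds almost surely only.  With [clip] in place of [c] the
    estimates on truncated series hold everywhere, and almost surely nothing
    changes ([fy_m_cvg]). *)
Definition clip (x : R) : R := if `|c x| <= rho then c x else 0.

Definition log_var (m : nat) (k : int) (w : T) : R :=
  garch_partial clip g eps k w m.

Definition scale_m (m : nat) (k : int) (w : T) : R :=
  expR (nu / 2 * log_var m k w).

(** [f] applied to the process in which the series is truncated after [m] terms,
    written in the form given by [f_scale]. *)
Definition fy_m (m : nat) (k : int) (w : T) : R := f (eps k w) * scale_m m k w.

(** Bounds all partial sums of the series ([log_var_le]) and, up to the factor
    [rho ^+ m], its remainders after [m] terms ([log_var_dist]). *)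
Definition envelope (m : nat) (k : int) (w : T) : R :=
  \sum_(0 <= i < m) rho ^+ i * `|g (eps (k - i.+1%:Z) w)|.

Definition gexp : R := E (fun w => expR (mu * `|g (eps 0 w)|)).

Definition env_moment : R := expR ((gexp - 1) / (1 - rho)).

Let mu_gt0 : 0 < mu.
Proof. by apply: lt_trans mu_nu; rewrite divr_gt0// mulr_gt0. Qed.

Let mu_ge0 : 0 <= mu. Proof. exact: ltW. Qed.

Let rho_ge0 : 0 <= rho. Proof. exact: ltW. Qed.

Lemma clip_le x : `|clip x| <= rho.
Proof. by rewrite /clip; case: ifP => // _; rewrite normr0. Qed.

Lemma clip_meas : measurable_fun [set: R] clip.
Proof.
rewrite /clip; apply: measurable_fun_ifT => //.
by apply: measurable_fun_ler => //; exact: measurableT_comp.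
Qed.

Lemma prod_clip_le k w i :
  `|\prod_(0 <= j < i) clip (eps (k - j.+1%:Z) w)| <= rho ^+ i.
Proof.
elim: i => [|i IH]; first by rewrite big_geq// normr1.
rewrite big_nat_recr//= normrM exprSr.
by apply: ler_pM => //; exact: clip_le.
Qed.

Lemma log_varE m k w : log_var m k w =
  \sum_(0 <= i < m) g (eps (k - i.+1%:Z) w) *
    \prod_(0 <= j < i) clip (eps (k - j.+1%:Z) w).
Proof. exact: garch_partialE. Qed.

Lemma log_var_le m k w : `|log_var m k w| <= envelope m k w.
Proof.
rewrite log_varE; apply: le_trans (ler_norm_sum _ _ _) _.
by apply: ler_sum => i _; rewrite normrM mulrC ler_wpM2r// prod_clip_le.
Qed.

Lemma log_var_dist m n k w : `|log_var (m + n) k w - log_var m k w| <=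
  rho ^+ m * envelope n (k - m%:Z) w.
Proof.
rewrite !log_varE (big_cat_nat (n := m))//= ?leq_addr// addrAC subrr add0r.
rewrite -{1}[m]add0n big_addn addnC addnK mulr_sumr.
apply: le_trans (ler_norm_sum _ _ _) _.
apply: ler_sum => i _; rewrite normrM mulrC mulrA -exprD.
have -> : k - (i + m).+1%:Z = k - m%:Z - i.+1%:Z by clear; lia.
by rewrite [X in rho ^+ X]addnC ler_wpM2r// prod_clip_le.
Qed.

Lemma envelope_ge0 m k w : 0 <= envelope m k w.
Proof. by apply: sumr_ge0 => i _; rewrite mulr_ge0// exprn_ge0. Qed.

Lemma envelope_mono m n k w : envelope m k w <= envelope (m + n) k w.
Proof.
rewrite {2}/envelope (big_cat_nat (n := m))//= ?leq_addr// lerDl.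
by apply: sumr_ge0 => i _; rewrite mulr_ge0// exprn_ge0.
Qed.

Lemma adapted_g k : adapted eps [set k] (fun w => `|g (eps k w)|).
Proof. by apply: adapted_abs; apply: adapted_comp => //; exact: adapted_eps. Qed.

Lemma envelope_adapted m k :
  adapted eps [set l | k - m%:Z <= l < k] (envelope m k).
Proof.
have -> : envelope m k =
    fun w => \sum_(i < m) rho ^+ i * `|g (eps (k - i.+1%:Z) w)|.
  by apply/funext => w; rewrite /envelope big_mkord.
apply: adapted_sum => i _; apply: adaptedM; first exact: adapted_cst.
apply: (adaptedS _ (@adapted_g (k - i.+1%:Z))) => _ /= ->.
have := ltn_ord i; clear; lia.
Qed.

Lemma gexp_ge1 : 1 <= gexp.
Proof.
rewrite -(Ex_cst P 1); apply: Ex_le => //; first exact: L1_cst.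
by move=> w; rewrite -expR0 ler_expR mulr_ge0.
Qed.

Lemma L1_exp_g k : L1 (fun w => expR (mu * `|g (eps k w)|)).
Proof.
apply: (L1_eps eps_iid k (h := fun x => expR (mu * `|g x|))) => //.
by apply: measurableT_comp => //; apply: measurable_funM => //; exact: measurableT_comp.
Qed.

(** Convexity of the exponential turns the factor [rho ^+ i] in the exponent into the
    same factor in front of [gexp - 1]. *)
Lemma exp_g_geometric i k : L1 (fun w => expR (mu * (rho ^+ i * `|g (eps k w)|))) /\
  E (fun w => expR (mu * (rho ^+ i * `|g (eps k w)|))) <=
    expR (rho ^+ i * (gexp - 1)).
Proof.
have r01 : 0 <= rho ^+ i <= 1 by rewrite exprn_ge0//= exprn_ile1// ltW.
have bnd w : expR (mu * (rho ^+ i * `|g (eps k w)|)) <=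
    1 + rho ^+ i * (expR (mu * `|g (eps k w)|) - 1).
  by rewrite mulrCA; exact: expR_convex0.
have iR : L1 (fun w => 1 + rho ^+ i * (expR (mu * `|g (eps k w)|) - 1)).
  apply: L1D; first exact: L1_cst.
  by apply: L1Z; apply: L1B; [exact: L1_exp_g|exact: L1_cst].
have iL : L1 (fun w => expR (mu * (rho ^+ i * `|g (eps k w)|))).
  apply: L1_le iR.
    apply: measurableT_comp => //; apply: measurable_funM => //.
    by apply: measurable_funM => //; apply: measurableT_comp => //; exact: measurableT_comp.
  by move=> w; rewrite ger0_norm ?expR_ge0.
split => //; apply: le_trans (Ex_le iL iR bnd) _.
rewrite ExD; [|exact: L1_cst|by apply: L1Z; apply: L1B; [exact: L1_exp_g|exact: L1_cst]].
rewrite ExZ; last by apply: L1B; [exact: L1_exp_g|exact: L1_cst].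
rewrite ExB; [|exact: L1_exp_g|exact: L1_cst].
rewrite !Ex_cst.
have -> : E (fun w => expR (mu * `|g (eps k w)|)) = gexp.
  apply: (Ex_eps eps_iid k (h := fun x => expR (mu * `|g x|))).
  by apply: measurableT_comp => //; apply: measurable_funM => //; exact: measurableT_comp.
exact: expR_ge1Dx.
Qed.

(** The exponential of the sum is a product of independent factors, whose means are
    at most [expR (rho ^+ i * (gexp - 1))]. *)
Lemma exp_envelope m k : L1 (fun w => expR (mu * envelope m k w)) /\
  E (fun w => expR (mu * envelope m k w)) <= env_moment.
Proof.
suff h : L1 (fun w => expR (mu * envelope m k w)) /\
    E (fun w => expR (mu * envelope m k w)) <=
    expR ((gexp - 1) * \sum_(0 <= i < m) rho ^+ i).
  split; first exact: h.1.
  apply: le_trans h.2 _; rewrite ler_expR; apply: ler_wpM2l.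
    by rewrite subr_ge0 gexp_ge1.
  rewrite -[leRHS]mul1r ler_pdivlMr ?subr_gt0//.
  have -> : (\sum_(0 <= i < m) rho ^+ i) * (1 - rho) = 1 - rho ^+ m.
    elim: m {h} => [|m IH]; first by rewrite big_geq// mul0r expr0 subrr.
    by rewrite big_nat_recr//= mulrDl IH exprSr mulrBr mulr1 addrA subrK.
  by rewrite gerBl exprn_ge0.
elim: m => [|m [IH1 IH2]].
  have -> : (fun w => expR (mu * envelope 0 k w)) = fun=> 1.
    by apply/funext => w; rewrite /envelope big_geq// mulr0 expR0.
  by rewrite big_geq// mulr0 expR0 Ex_cst; split => //; exact: L1_cst.
have -> : (fun w => expR (mu * envelope m.+1 k w)) =
    fun w => expR (mu * envelope m k w) *
      expR (mu * (rho ^+ m * `|g (eps (k - m.+1%:Z) w)|)).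
  apply/funext => w; rewrite -expRD -mulrDr; congr (expR (mu * _)).
  by rewrite /envelope big_nat_recr.
have [i1 i2] := exp_g_geometric m (k - m.+1%:Z).
have dis : [set l | k - m%:Z <= l < k] `&` [set k - m.+1%:Z] = set0.
  by apply/seteqP; split => // l /= []; clear; lia.
have a1 : adapted eps [set l | k - m%:Z <= l < k]
    (fun w => expR (mu * envelope m k w)).
  apply: (adapted_comp (h := fun x => expR (mu * x))); last exact: (@envelope_adapted m k).
  by apply: measurableT_comp => //; exact: measurable_funM.
have a2 : adapted eps [set k - m.+1%:Z]
    (fun w => expR (mu * (rho ^+ m * `|g (eps (k - m.+1%:Z) w)|))).
  apply: (adapted_comp (h := fun x => expR (mu * (rho ^+ m * x)))); last exact: (@adapted_g (k - m.+1%:Z)).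
  by apply: measurableT_comp => //; apply: measurable_funM => //; exact: measurable_funM.
split; first exact: (L1_indepM eps_iid.1 dis a1 a2 IH1 i1).
rewrite (Ex_indepM eps_iid.1 dis a1 a2 IH1 i1) big_nat_recr//= mulrDr expRD.
apply: ler_pM => //; last by rewrite mulrC.
- by apply: Ex_ge0 => w; exact: expR_ge0.
- by apply: Ex_ge0 => w; exact: expR_ge0.
Qed.

Lemma log_var_adapted m k :
  adapted eps [set l | k - m%:Z <= l < k] (log_var m k).
Proof.
apply: (measurable_garch_partial clip_meas g_meas) => l lk kl.
by apply: adapted_eps; rewrite /= lk kl.
Qed.

Lemma scale_m_adapted m k :
  adapted eps [set l | k - m%:Z <= l < k] (scale_m m k).
Proof.
apply: (adapted_comp (h := fun x => expR (nu / 2 * x))); last exact: (@log_var_adapted m k).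
by apply: measurableT_comp => //; exact: measurable_funM.
Qed.

Lemma f_eps_adapted k : adapted eps [set k] (fun w => f (eps k w)).
Proof. by apply: adapted_comp => //; exact: adapted_eps. Qed.

Lemma fy_m_adapted m k : adapted eps [set l | k - m%:Z <= l <= k] (fy_m m k).
Proof.
apply: adaptedM.
  by apply: (adaptedS _ (@f_eps_adapted k)) => _ /= ->; clear; lia.
by apply: (adaptedS _ (@scale_m_adapted m k)) => l /=; clear; lia.
Qed.

Definition scale_rate : R := nu ^+ 2 / (mu - nu) ^+ 2.

Let nu_lt_mu : 0 < mu - nu.
Proof. by move: mu_nu nu_gt0 => h1 h2; lra. Qed.

(** The exponential is Lipschitz with constant [expR (nu / 2 * b)] on the range in
    question.  After squaring, [a ^+ 2 * expR (nu * b)] is bounded by exponential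
    moments of order [mu], since [a ^+ 2] is at most a multiple of
    [expR ((mu - nu) * a)]. *)
Lemma scale_m_dist m n k w :
  (scale_m (m + n) k w - scale_m m k w) ^+ 2 <=
  scale_rate * (rho ^+ m) ^+ 2 *
  (expR (mu * envelope n (k - m%:Z) w) + expR (mu * envelope (m + n) k w)).
Proof.
set a := envelope n _ w; set b := envelope (m + n) k w.
have a0 : 0 <= a by exact: envelope_ge0.
have b0 : 0 <= b by exact: envelope_ge0.
have nu20 : 0 <= nu / 2 by rewrite divr_ge0// ltW.
have h : `|scale_m (m + n) k w - scale_m m k w| <=
    nu / 2 * (rho ^+ m * a) * expR (nu / 2 * b).
  apply: le_trans (expR_dist_le (M := nu / 2 * b) _ _) _.
  - by rewrite normrM ger0_norm// ler_wpM2l// log_var_le.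
  - rewrite normrM ger0_norm// ler_wpM2l//.
    exact: le_trans (log_var_le _ _ _) (envelope_mono _ _ _ _).
  apply: ler_wpM2r; first exact: expR_ge0.
  by rewrite -mulrBr normrM ger0_norm// ler_wpM2l// log_var_dist.
have s0 : 0 <= nu / 2 * (rho ^+ m * a) * expR (nu / 2 * b).
  exact: mulr_ge0 (mulr_ge0 nu20 (mulr_ge0 (exprn_ge0 _ rho_ge0) a0)) (expR_ge0 _).
rewrite -real_normK ?num_real//.
apply: le_trans (_ : (nu / 2 * (rho ^+ m * a) * expR (nu / 2 * b)) ^+ 2 <= _).
  by rewrite ler_pXn2r ?nnegrE.
have -> : (nu / 2 * (rho ^+ m * a) * expR (nu / 2 * b)) ^+ 2 =
    nu ^+ 2 / 4 * (rho ^+ m) ^+ 2 * (a ^+ 2 * expR (nu * b)).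
  have -> : expR (nu * b) = expR (nu / 2 * b) ^+ 2.
    by rewrite -expRM_natl; congr expR; field.
  by move: (expR _) (rho ^+ m) => x y; field.
have -> : scale_rate * (rho ^+ m) ^+ 2 = nu ^+ 2 / 4 * (rho ^+ m) ^+ 2 *
    (4 / (mu - nu) ^+ 2).
  by rewrite /scale_rate; move: (rho ^+ m) => y; field; rewrite gt_eqF.
rewrite -[leRHS]mulrA; apply: ler_wpM2l.
  by rewrite mulr_ge0 ?sqr_ge0// divr_ge0 ?sqr_ge0.
apply: le_trans (ler_wpM2r (expR_ge0 _) (sqr_le_expR nu_lt_mu a0)) _.
rewrite -[leLHS]mulrA -expRD; apply: ler_wpM2l; first by rewrite divr_ge0// sqr_ge0.
apply: le_trans (expR_mix _ _ (ltW nu_lt_mu) (ltW nu_gt0)) _.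
by rewrite subrK.
Qed.

Lemma L1_f_eps_sqr : L1 (fun w => f (eps 0 w) ^+ 2).
Proof.
apply: (@L1_le _ _ _ _ _ (fun w => 1 + `|f (eps 0 w)| ^+ 3)).
- by apply: measurable_funX; exact: measurableT_comp.
- move=> w; rewrite ger0_norm ?sqr_ge0// -real_normK ?num_real//.
  move: `|_| (normr_ge0 (f (eps 0 w))) => x x0; rewrite -subr_ge0.
  have -> : 1 + x ^+ 3 - x ^+ 2 = (x + 1) * (x - 1) ^+ 2 + x by ring.
  by rewrite addr_ge0// mulr_ge0 ?sqr_ge0// addr_ge0.
- by apply: L1D => //; exact: L1_cst.
Qed.

Definition f_sqr : R := E (fun w => f (eps 0 w) ^+ 2).

Definition close_const : R :=
  Num.sqrt (f_sqr * (scale_rate * (env_moment + env_moment))).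

(** [f (eps k)] is independent of the volatility, which only involves the past. *)
Lemma fy_m_dist m n k :
  L1 (fun w => (fy_m (m + n) k w - fy_m m k w) ^+ 2) /\
  E (fun w => (fy_m (m + n) k w - fy_m m k w) ^+ 2) <=
    (close_const * rho ^+ m) ^+ 2.
Proof.
have -> : (fun w => (fy_m (m + n) k w - fy_m m k w) ^+ 2) =
    fun w => f (eps k w) ^+ 2 * (scale_m (m + n) k w - scale_m m k w) ^+ 2.
  by apply/funext => w; rewrite -exprMn -mulrBr.
have mf2 : measurable_fun [set: R] (fun x => f x ^+ 2) by exact: measurable_funX.
have if2 : L1 (fun w => f (eps k w) ^+ 2).
  exact: (L1_eps eps_iid k mf2 L1_f_eps_sqr).
have [i1 e1] := exp_envelope n (k - m%:Z).
have [i2 e2] := exp_envelope (m + n) k.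
have aS : adapted eps [set l | l < k]
    (fun w => (scale_m (m + n) k w - scale_m m k w) ^+ 2).
  apply: (adapted_comp (h := fun x => x ^+ 2)); first exact: measurable_funX.
  apply: adaptedB.
    by apply: (adaptedS _ (@scale_m_adapted (m + n) k)) => l /= /andP[].
  by apply: (adaptedS _ (@scale_m_adapted m k)) => l /= /andP[].
have iB : L1 (fun w => scale_rate * (rho ^+ m) ^+ 2 *
    (expR (mu * envelope n (k - m%:Z) w) + expR (mu * envelope (m + n) k w))).
  by apply: L1Z; exact: L1D.
have iS : L1 (fun w => (scale_m (m + n) k w - scale_m m k w) ^+ 2).
  apply: L1_le iB; first exact: (adapted_measurable aS).
  by move=> w; rewrite ger0_norm ?sqr_ge0// scale_m_dist.
have af : adapted eps [set k] (fun w => f (eps k w) ^+ 2).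
  by apply: (adapted_comp mf2); exact: adapted_eps.
have dis : [set k] `&` [set l | l < k] = set0.
  by apply/seteqP; split => // l /= [->]; rewrite ltxx.
split; first exact: (L1_indepM eps_iid.1 dis af aS if2 iS).
rewrite (Ex_indepM eps_iid.1 dis af aS if2 iS).
have -> : E (fun w => f (eps k w) ^+ 2) = f_sqr by exact: (Ex_eps eps_iid k mf2).
have f0 : 0 <= f_sqr by apply: Ex_ge0 => w; exact: sqr_ge0.
have sr0 : 0 <= scale_rate by rewrite divr_ge0 ?sqr_ge0.
have em0 : 0 <= env_moment by exact: expR_ge0.
rewrite exprMn sqr_sqrtr; last exact: mulr_ge0 f0 (mulr_ge0 sr0 (addr_ge0 em0 em0)).
rewrite -[leRHS]mulrA; apply: ler_wpM2l => //.
apply: le_trans (Ex_le iS iB (fun w => scale_m_dist m n k w)) _.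
rewrite ExZ; last exact: L1D.
rewrite ExD// mulrAC; apply: ler_wpM2r; first exact: sqr_ge0.
by apply: ler_wpM2l => //; exact: lerD.
Qed.

Definition third_const : R := E (fun w => `|f (eps 0 w)| ^+ 3) * env_moment.

(** The cube of the volatility factor is at most [expR (3 * nu / 2 * envelope)], and
    [3 * nu / 2 < mu]. *)
Lemma fy_m_third m k : L1 (fun w => `|fy_m m k w| ^+ 3) /\
  E (fun w => `|fy_m m k w| ^+ 3) <= third_const.
Proof.
have -> : (fun w => `|fy_m m k w| ^+ 3) =
    fun w => `|f (eps k w)| ^+ 3 * scale_m m k w ^+ 3.
  by apply/funext => w; rewrite normrM exprMn (ger0_norm (expR_ge0 _)).
have mf3 : measurable_fun [set: R] (fun x => `|f x| ^+ 3).
  by apply: measurable_funX; exact: measurableT_comp.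
have [i1 e1] := exp_envelope m k.
have if3 : L1 (fun w => `|f (eps k w)| ^+ 3) by exact: (L1_eps eps_iid k mf3).
have aS : adapted eps [set l | l < k] (fun w => scale_m m k w ^+ 3).
  apply: (adapted_comp (h := fun x => x ^+ 3)); first exact: measurable_funX.
  by apply: (adaptedS _ (@scale_m_adapted m k)) => l /= /andP[].
have sb w : scale_m m k w ^+ 3 <= expR (mu * envelope m k w).
  rewrite /scale_m -expRM_natl ler_expR.
  have h1 := le_trans (ler_norm _) (log_var_le m k w).
  have h2 := envelope_ge0 m k w.
  by move: mu_nu nu_gt0 h1 h2; move: (log_var m k w) (envelope m k w) => x y; nra.
have iS : L1 (fun w => scale_m m k w ^+ 3).
  apply: L1_le i1; first exact: (adapted_measurable aS).
  by move=> w; rewrite ger0_norm// exprn_ge0// expR_ge0.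
have af : adapted eps [set k] (fun w => `|f (eps k w)| ^+ 3).
  by apply: (adapted_comp mf3); exact: adapted_eps.
have dis : [set k] `&` [set l | l < k] = set0.
  by apply/seteqP; split => // l /= [->]; rewrite ltxx.
split; first exact: (L1_indepM eps_iid.1 dis af aS if3 iS).
rewrite (Ex_indepM eps_iid.1 dis af aS if3 iS).
have -> : E (fun w => `|f (eps k w)| ^+ 3) = E (fun w => `|f (eps 0 w)| ^+ 3).
  exact: (Ex_eps eps_iid k mf3).
apply: ler_wpM2l; first by apply: Ex_ge0 => w; rewrite exprn_ge0.
exact: le_trans (Ex_le iS i1 sb) e1.
Qed.

Definition fy (k : int) (w : T) : R := f (garch_y c g eps k w).

Lemma fyE k w : fy k w = expR (nu / 2 * garch_X c g eps k w) * f (eps k w).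
Proof. exact: f_scale. Qed.

Lemma fy_adapted k : adapted eps [set l | l <= k] (fy k).
Proof.
have -> : fy k = fun w => expR (nu / 2 * garch_X c g eps k w) * f (eps k w).
  by apply/funext => w; exact: fyE.
apply: adaptedM.
  apply: (adapted_comp (h := fun x => expR (nu / 2 * x))).
    by apply: measurableT_comp => //; exact: measurable_funM.
  apply: (measurable_garch_X c_meas g_meas) => l lk.
  by apply: adapted_eps; rewrite /= ltW.
by apply: (adaptedS _ (@f_eps_adapted k)) => _ /= ->.
Qed.

Lemma fy_m_cvg m k :
  {ae P, forall w, fy_m (m + n) k w @[n --> \oo] --> fy k w}.
Proof.
have mA : measurable [set x | `|c x| <= rho].
  have ma : measurable_fun [set: R] (fun x => `|c x|) by exact: measurableT_comp.
  have := ma measurableT _ (measurable_itv `]-oo, rho]); rewrite setTI.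
  by congr (measurable _); apply/seteqP; split => x; rewrite /= in_itv.
have cb : {ae P, forall w (i : nat), `|c (eps (k - i.+1%:Z) w)| <= rho}.
  apply/ae_foralln => i; exact: (ae_eps eps_iid _ mA c_bounded).
apply: filterS2 cb (X_cvg k) => w cw xw.
have E n : log_var n k w = garch_partial c g eps k w n.
  rewrite log_varE garch_partialE; apply: eq_bigr => i _; congr (_ * _).
  by apply: eq_bigr => j _; rewrite /clip cw.
rewrite fyE mulrC; apply: cvgM; first exact: cvg_cst.
apply: (@cvg_comp _ _ _ _ expR); last exact: continuous_expR.
apply: cvgM; first exact: cvg_cst.
have -> : (fun n => log_var (m + n) k w) = fun n => garch_partial c g eps k w (n + m).
  by apply/funext => n; rewrite E addnC.
by rewrite (cvg_shiftn m (garch_partial c g eps k w)); exact: xw.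
Qed.

(** Fatou's lemma in [n] for the estimate [fy_m_dist], which is uniform in [n]. *)
Lemma fy_close m k : L1 (fun w => (fy k w - fy_m m k w) ^+ 2) /\
  E (fun w => (fy k w - fy_m m k w) ^+ 2) <= (close_const * rho ^+ m) ^+ 2.
Proof.
apply: (fatou_Ex (U := fun n w => (fy_m (m + n) k w - fy_m m k w) ^+ 2)).
- by move=> n; exact: (fy_m_dist m n k).1.
- by move=> n w; exact: sqr_ge0.
- by move=> n; exact: (fy_m_dist m n k).2.
- apply: measurable_funX; apply: measurable_funB.
    exact: (adapted_measurable (@fy_adapted k)).
  exact: (adapted_measurable (@fy_m_adapted m k)).
- by move=> w; exact: sqr_ge0.
- apply: filterS (fy_m_cvg m k) => w h; rewrite !expr2.
  by apply: cvgM; apply: cvgB => //; exact: cvg_cst.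
Qed.

Lemma fy_stationary h k w :
  fy (k + h) w = f (garch_y c g (fun l (p : int -> R) => p l) k (path_from eps h w)).
Proof.
rewrite /fy /garch_y /garch_sigma /garch_X; congr (f (Num.sqrt (expR _) * _)).
set u := garch_partial _ _ _ _ _; set v := garch_partial _ _ _ _ _.
have -> // : u = v by apply/funext => n; exact: garch_partial_shift.
Qed.

Lemma measurable_path_fy k :
  measurable_fun [set: g_sigma_algebraType (@path_cylinders R)]
    (fun p => f (garch_y c g (fun l (p : int -> R) => p l) k p)).
Proof.
have -> : (fun p => f (garch_y c g (fun l (p : int -> R) => p l) k p)) = fun p =>
    expR (nu / 2 * garch_X c g (fun l (p : int -> R) => p l) k p) * f (p k).
  by apply/funext => p; exact: f_scale.
apply: measurable_funM; last exact: (measurableT_comp f_meas (measurable_coord k)).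
apply: measurableT_comp => //; apply: measurable_funM => //.
by apply: (measurable_garch_X c_meas g_meas) => l _; exact: (measurable_coord l).
Qed.

Lemma Ex_fy k : E (fy k) = E (fy 1).
Proof.
have E0 j : E (fy j) = E (fy 0).
  have -> : fy j = fun w => f (garch_y c g (fun l (p : int -> R) => p l) 0
      (path_from eps j w)).
    by apply/funext => w; rewrite -[j]add0r fy_stationary add0r.
  rewrite (Ex_shift eps_iid j (measurable_path_fy 0)); congr Ex.
  by apply/funext => w; rewrite -[0]addr0 fy_stationary.
by rewrite E0 [RHS]E0.
Qed.

Definition fy_centered (k : int) (w : T) : R := fy k w - E (fy 1).

Definition fy_m_centered (m : nat) (k : int) (w : T) : R :=
  fy_m m k w - E (fy_m m k).

Lemma fy_centered_stat h i j :
  E (fun w => fy_centered (i + h) w * fy_centered (j + h) w) =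
  E (fun w => fy_centered i w * fy_centered j w).
Proof.
pose F (p : int -> R) :=
  (f (garch_y c g (fun l (q : int -> R) => q l) i p) - E (fy 1)) *
  (f (garch_y c g (fun l (q : int -> R) => q l) j p) - E (fy 1)).
have mF : measurable_fun [set: g_sigma_algebraType (@path_cylinders R)] F.
  by apply: measurable_funM; apply: measurable_funB => //; exact: measurable_path_fy.
have EF k : E (fun w => fy_centered (i + k) w * fy_centered (j + k) w) =
    E (fun w => F (path_from eps k w)).
  by congr Ex; apply/funext => w; rewrite /fy_centered !fy_stationary.
by rewrite EF (Ex_shift eps_iid h mF) -EF !addr0.
Qed.

Let mfy k : measurable_fun [set: T] (fy k).
Proof. exact: (adapted_measurable (@fy_adapted k)). Qed.

Let mfy_m m k : measurable_fun [set: T] (fy_m m k).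
Proof. exact: (adapted_measurable (@fy_m_adapted m k)). Qed.

Lemma L1_fy_m m k : L1 (fy_m m k).
Proof.
apply: (@L1_le _ _ _ _ _ (fun w => 1 + `|fy_m m k w| ^+ 3)) => //.
- move=> w; move: `|_| (normr_ge0 (fy_m m k w)) => x x0.
  have [x1|/ltW x1] := leP x 1; first by rewrite ler_wpDr// exprn_ge0.
  by rewrite ler_wpDl// -[leLHS]expr1 ler_weXn2l.
- by apply: L1D; [exact: L1_cst|exact: (fy_m_third m k).1].
Qed.

Lemma L1_fy_m_sqr m k : L1 (fun w => fy_m m k w ^+ 2).
Proof.
apply: (@L1_le _ _ _ _ _ (fun w => 1 + `|fy_m m k w| ^+ 3)) => //.
- exact: measurable_funX.
- move=> w; rewrite ger0_norm ?sqr_ge0// -real_normK ?num_real//.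
  move: `|_| (normr_ge0 (fy_m m k w)) => x x0.
  have [x1|/ltW x1] := leP x 1.
    by rewrite ler_wpDr ?exprn_ge0// exprn_ile1.
  by rewrite ler_wpDl// ler_weXn2l.
- by apply: L1D; [exact: L1_cst|exact: (fy_m_third m k).1].
Qed.

Lemma L1_fy_sqr k : L1 (fun w => fy k w ^+ 2).
Proof.
apply: (@L1_le _ _ _ _ _ (fun w => 2 * (fy k w - fy_m 0 k w) ^+ 2 + 2 * fy_m 0 k w ^+ 2)).
- exact: measurable_funX.
- move=> w; rewrite ger0_norm ?sqr_ge0// -subr_ge0.
  rewrite (_ : _ - _ = (fy k w - 2 * fy_m 0 k w) ^+ 2) ?sqr_ge0//; ring.
- by apply: L1D; apply: L1Z; [exact: (fy_close 0 k).1|exact: L1_fy_m_sqr].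
Qed.

Lemma L1_fy k : L1 (fy k).
Proof. exact: L1_of_sqr (L1_fy_sqr k). Qed.

Lemma L1_fy_centered_sqr k : L1 (fun w => fy_centered k w ^+ 2).
Proof.
have -> : (fun w => fy_centered k w ^+ 2) = fun w =>
    fy k w ^+ 2 - 2 * E (fy 1) * fy k w + E (fy 1) ^+ 2.
  by apply/funext => w; rewrite /fy_centered; ring.
apply: L1D; last exact: L1_cst.
by apply: L1B; [exact: L1_fy_sqr|apply: L1Z; exact: L1_fy].
Qed.

Lemma fy_m_centered_mean m k : E (fy_m_centered m k) = 0.
Proof.
by rewrite ExB ?Ex_cst ?subrr//; [exact: L1_fy_m|exact: L1_cst].
Qed.

(** [fy_centered k - fy_m_centered m k] is [D] minus its mean, which does not increase
    the second moment. *)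
Lemma fy_centered_close m k :
  E (fun w => (fy_centered k w - fy_m_centered m k w) ^+ 2) <=
  (close_const * rho ^+ m) ^+ 2.
Proof.
pose D w := fy k w - fy_m m k w.
have iD : L1 D by apply: L1B; [exact: L1_fy|exact: L1_fy_m].
have [iD2 D2] := fy_close m k.
apply: le_trans D2.
have ED : E D = E (fy 1) - E (fy_m m k).
  by rewrite ExB ?Ex_fy//; [exact: L1_fy|exact: L1_fy_m].
have -> : (fun w => (fy_centered k w - fy_m_centered m k w) ^+ 2) = fun w =>
    D w ^+ 2 - (2 * E D * D w - E D ^+ 2).
  by apply/funext => w; rewrite /fy_centered /fy_m_centered /D ED; ring.
have i2 : L1 (fun w => 2 * E D * D w - E D ^+ 2).
  by apply: L1B; [exact: L1Z|exact: L1_cst].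
rewrite ExB// gerBl ExB; [|exact: L1Z|exact: L1_cst].
rewrite ExZ// Ex_cst (_ : _ - _ = E D ^+ 2) ?sqr_ge0//; ring.
Qed.

Definition centered_third_const : R :=
  4 * third_const + 4 * (1 + third_const) ^+ 3 + 1.

Lemma third_const_ge0 : 0 <= third_const.
Proof.
by rewrite mulr_ge0 ?expR_ge0//; apply: Ex_ge0 => w; rewrite exprn_ge0.
Qed.

Lemma Ex_fy_m_le m k : `|E (fy_m m k)| <= 1 + third_const.
Proof.
have [i3 e3] := fy_m_third m k.
apply: le_trans (_ : E (fun w => 1 + `|fy_m m k w| ^+ 3) <= _).
  apply: Ex_abs_le; [exact: L1_fy_m|by apply: L1D => //; exact: L1_cst|].
  move=> w; move: `|_| (normr_ge0 (fy_m m k w)) => x x0.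
  have [x1|/ltW x1] := leP x 1; first by rewrite ler_wpDr// exprn_ge0.
  by rewrite ler_wpDl// -[leLHS]expr1 ler_weXn2l.
by rewrite ExD ?Ex_cst ?lerD2l//; exact: L1_cst.
Qed.

Lemma fy_m_centered_third m k : L1 (fun w => `|fy_m_centered m k w| ^+ 3) /\
  E (fun w => `|fy_m_centered m k w| ^+ 3) <= centered_third_const.
Proof.
have [i3 e3] := fy_m_third m k.
have bnd w : `|fy_m_centered m k w| ^+ 3 <=
    4 * `|fy_m m k w| ^+ 3 + 4 * (1 + third_const) ^+ 3.
  have h : `|fy_m_centered m k w| <= `|fy_m m k w| + (1 + third_const).
    by apply: le_trans (ler_normB _ _) _; rewrite lerD2l Ex_fy_m_le.
  have b0 : 0 <= 1 + third_const by rewrite addr_ge0// third_const_ge0.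
  move: (normr_ge0 (fy_m m k w)) h b0.
  move: `|fy_m m k w| (1 + third_const) => x y x0 h y0.
  apply: le_trans (_ : (x + y) ^+ 3 <= _).
    by rewrite ler_pXn2r ?nnegrE ?addr_ge0.
  rewrite -subr_ge0.
  have -> : 4 * x ^+ 3 + 4 * y ^+ 3 - (x + y) ^+ 3 = 3 * ((x + y) * (x - y) ^+ 2).
    ring.
  by rewrite mulr_ge0// mulr_ge0 ?sqr_ge0// addr_ge0.
have iB : L1 (fun w => 4 * `|fy_m m k w| ^+ 3 + 4 * (1 + third_const) ^+ 3).
  by apply: L1D; [exact: L1Z|exact: L1_cst].
have iL : L1 (fun w => `|fy_m_centered m k w| ^+ 3).
  apply: L1_le iB; last by move=> w; rewrite ger0_norm// exprn_ge0.
  by apply: measurable_funX; apply: measurableT_comp => //; exact: measurable_funB.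
split => //; apply: le_trans (Ex_le iL iB bnd) _.
rewrite ExD; [|exact: L1Z|exact: L1_cst].
rewrite (ExZ 4 i3) Ex_cst /centered_third_const.
by move: e3; move: (E _) third_const => x y e3; lra.
Qed.

Lemma centered_third_const_ge1 : 1 <= centered_third_const.
Proof.
have h := third_const_ge0.
rewrite /centered_third_const lerDr.
exact: addr_ge0 (mulr_ge0 (ler0n _ 4) h)
  (mulr_ge0 (ler0n _ 4) (exprn_ge0 _ (addr_ge0 ler01 h))).
Qed.

Lemma centered_sumE n w :
  centered_sum P f (garch_y c g eps) n w = part fy_centered 0 n w.
Proof.
rewrite /centered_sum /part add0n big_add1 /= sumrB; congr (_ - _).
by rewrite sumr_const_nat subn0 mulr_natl.
Qed.

Lemma L1_fy_centered k : L1 (fy_centered k).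
Proof. by apply: L1B; [exact: L1_fy|exact: L1_cst]. Qed.

Lemma sum_sdE n : sum_sd P f (garch_y c g eps) n =
  Num.sqrt (var_sum (P := P) fy_centered n).
Proof.
rewrite /sum_sd.
have -> : centered_sum P f (garch_y c g eps) n = part fy_centered 0 n.
  by apply/funext => w; exact: centered_sumE.
have S0 : fine 'E_P[part fy_centered 0 n] = 0.
  rewrite -/(E (part fy_centered 0 n)).
  rewrite Ex_sum; last by move=> j _; exact: L1_fy_centered.
  rewrite big1// => j _; rewrite ExB; [|exact: L1_fy|exact: L1_cst].
  by rewrite Ex_cst Ex_fy subrr.
rewrite /variance covariance.unlock S0; congr Num.sqrt.
congr Ex; apply/funext => w.
transitivity ((part fy_centered 0 n w - 0) * (part fy_centered 0 n w - 0)) => //.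
by rewrite subr0 expr2.
Qed.

Theorem garch_berry_esseen :
  let B := sum_sd P f (garch_y c g eps) in
  cvgn (normalized_sd P f (garch_y c g eps)) /\
  (0 < limn (normalized_sd P f (garch_y c g eps)) ->
   exists2 C : R, 0 < C & forall (n : nat) (x : R), (2 <= n)%N ->
     `|fine (P [set w | centered_sum P f (garch_y c g eps) n w < x * B n]) - Phi x| <=
     C * (ln n%:R ^+ 2 / Num.sqrt n%:R)).
Proof.
have sdE : normalized_sd P f (garch_y c g eps) = mean_sd (P := P) fy_centered.
  apply/funext => n; rewrite /normalized_sd sum_sdE sqr_sqrtr//.
  by apply: Ex_ge0 => w; exact: sqr_ge0.
have [] := @berry_esseen_process _ _ _ P eps eps_iid.1 fy_centered fy_m_centered
  rho close_const centered_third_const rho_gt0 rho_lt1.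
- by move=> k; apply: adaptedB; [exact: (@fy_adapted k)|exact: adapted_cst].
- by move=> m k; apply: adaptedB; [exact: (@fy_m_adapted m k)|exact: adapted_cst].
- exact: L1_fy_centered_sqr.
- exact: fy_m_centered_mean.
- exact: centered_third_const_ge1.
- by move=> m k; exact: (fy_m_centered_third m k).1.
- by move=> m k; exact: (fy_m_centered_third m k).2.
- exact: fy_centered_close.
- exact: fy_centered_stat.
move=> cv be B; rewrite sdE; split => // /be[C C0 h]; exists C => // n x n2.
rewrite /B sum_sdE (_ : [set w | _] =
  [set w | part fy_centered 0 n w < x * Num.sqrt (var_sum (P := P) fy_centered n)]).
  exact: h.
by apply/seteqP; split => w /=; rewrite centered_sumE.
Qed.

End garch_truncation.

(** * Power functions and the moment of the noise *)

Section power_functions.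
Set Implicit Arguments.
Unset Strict Implicit.
Context {R : realType}.
Variable nu : R.
Hypothesis nu_gt0 : 0 < nu.

Lemma powR_sqrt_expR (x : R) : Num.sqrt (expR x) `^ nu = expR (nu / 2 * x).
Proof.
have -> : Num.sqrt (expR x) = expR (x / 2).
  rewrite -[RHS]ger0_norm ?expR_ge0// -sqrtr_sqr; congr Num.sqrt.
  by rewrite -expRM_natl; congr expR; field.
by rewrite /powR gt_eqF ?expR_gt0// expRK; congr expR; field.
Qed.

Lemma abs_power_scale (x e : R) :
  abs_power nu (Num.sqrt (expR x) * e) = expR (nu / 2 * x) * abs_power nu e.
Proof.
by rewrite /abs_power normrM (ger0_norm (sqrtr_ge0 _)) powRM ?sqrtr_ge0//
  powR_sqrt_expR.
Qed.

Lemma signed_power_scale (x e : R) :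
  signed_power nu (Num.sqrt (expR x) * e) =
  expR (nu / 2 * x) * signed_power nu e.
Proof.
rewrite /signed_power sgrM gtr0_sg ?sqrtr_gt0 ?expR_gt0// mul1r mulrCA.
by congr (_ * _); exact: abs_power_scale.
Qed.

Lemma measurable_abs_power : measurable_fun [set: R] (abs_power nu).
Proof. by apply: (measurableT_comp (measurable_powR nu)); exact: normr_measurable. Qed.

Lemma measurable_signed_power : measurable_fun [set: R] (signed_power nu).
Proof.
apply: measurable_funM; last exact: measurable_abs_power.
have -> : (@Num.sg R) = fun x => if x == 0 then 0 else if x < 0 then -1 else 1.
  apply/funext => x; case: (ltrgt0P x) => [x0|x0|->]; last exact: sgr0.
    by rewrite gtr0_sg.
  by rewrite ltr0_sg.
apply: measurable_fun_ifT; [|exact: measurable_cst|].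
  apply: (measurable_fun_bool true); rewrite setTI.
  by rewrite (_ : _ @^-1` _ = [set 0])//; apply/seteqP; split => x /= /eqP.
apply: measurable_fun_ifT; [|exact: measurable_cst|exact: measurable_cst].
exact: measurable_fun_ltr.
Qed.

End power_functions.

Section noise_moment.
Set Implicit Arguments.
Unset Strict Implicit.
Context {d : measure_display} {T : measurableType d} {R : realType}.
Context {P : probability T R}.
Variable eps : int -> {RV P >-> R}.

(** The integral of the product is the product of the integrals.  That of [W] is not
    0, as [W] is positive, so that of [U] cannot be infinite. *)
Lemma L1_of_indep_product (J K : set int) (U W : T -> R) :
  mutually_independent eps -> J `&` K = set0 -> adapted eps J U ->
  adapted eps K W -> (forall w, 0 <= U w) -> (forall w, 0 < W w) ->
  (\int[P]_w (U w * W w)%:E < +oo)%E -> L1 P U.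
Proof.
move=> ind JK aU aW U0 W0.
have mU := adapted_measurable aU; have mW := adapted_measurable aW.
rewrite (ge0_integral_indepM ind JK aU aW)//; last by move=> w; exact: ltW.
move=> lt; apply/integrableP; split; first exact/measurable_EFinP.
under eq_integral => w _ do rewrite /= ger0_norm//.
set a := (\int[P]_w (U w)%:E)%E in lt *.
have a0 : (0 <= a)%E by apply: integral_ge0 => w _; rewrite lee_fin.
have b0 : (0 < \int[P]_w (W w)%:E)%E.
  rewrite lt0e; apply/andP; split; last first.
    by apply: integral_ge0 => w _; rewrite lee_fin ltW.
  apply/negP => /eqP W00.
  have : (\int[P]_w `|(W w)%:E| = 0)%E.
    by rewrite -[RHS]W00; apply: eq_integral => w _; rewrite /= gtr0_norm.
  move/(ae_eq_integral_abs P measurableT).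
  have mWE : measurable_fun [set: T] (fun w => (W w)%:E) by exact/measurable_EFinP.
  move=> /(_ mWE) [N [mN PN NW]].
  have : P setT = 0%E.
    apply: (subset_measure0 _ mN _ PN) => // w _; apply: NW => /= h.
    by have := h I; case=> W0w; have := W0 w; rewrite W0w ltxx.
  by rewrite probability_setT => /eqP; rewrite onee_eq0.
rewrite ltey; apply/eqP => aoo; move: lt.
by rewrite aoo gt0_mulye ?ltxx.
Qed.

End noise_moment.

Theorem theorem7 (d : measure_display) (T : measurableType d) (R : realType)
  (P : probability T R) (eps : int -> {RV P >-> R}) (c g f : R -> R)
  (cstar mu nu : R)
  (eps_iid : iid eps)
  (c_meas : measurable_fun [set: R] c)
  (g_meas : measurable_fun [set: R] g)
  (X_cvg : forall k : int, {ae P, forall w, cvgn (garch_partial c g eps k w)})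
  (cstar_lt1 : cstar < 1)
  (mu_gt0 : 0 < mu)
  (c_bounded : {ae P, forall w, `|c (eps 0 w)| <= cstar})
  (g_exp_moment : ('E_P[fun w => (expR (mu * `|g (eps 0 w)|))%R] < +oo)%E)
  (nu_gt0 : 0 < nu)
  (mu_nu : 3 * nu / 2 < mu)
  (f_power : f = abs_power nu \/ f = signed_power nu)
  (f_moment : ('E_P[fun w => (`|f (garch_y c g eps 0 w)| ^+ 3)%R] < +oo)%E) :
  let y := garch_y c g eps in
  let S := centered_sum P f y in
  let B := sum_sd P f y in
  let beta_ := normalized_sd P f y in
  cvgn beta_ /\
  (0 < limn beta_ ->
   exists2 C : R, 0 < C &
     forall (n : nat) (x : R), (2 <= n)%N ->
       `| fine (P [set w | S n w < x * B n]) - Phi x |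
       <= C * (ln n%:R ^+ 2 / Num.sqrt n%:R)).
Proof.
have f_meas : measurable_fun [set: R] f.
  by case: f_power => ->; [exact: measurable_abs_power|exact: measurable_signed_power].
have f_scale x e : f (Num.sqrt (expR x) * e) = expR (nu / 2 * x) * f e.
  by case: f_power => ->; [exact: abs_power_scale|exact: signed_power_scale].
(* A rate of decay has to be positive, which [cstar] need not be. *)
pose rho := Num.max cstar (2^-1 : R).
have rho_gt0 : 0 < rho by rewrite lt_max invr_gt0 ltr0n orbT.
have rho_lt1 : rho < 1 by rewrite gt_max cstar_lt1 invf_lt1// ltr1n.
have c_rho : {ae P, forall w, `|c (eps 0 w)| <= rho}.
  by apply: filterS c_bounded => w h; rewrite le_max h.
have mexp : measurable_fun [set: R] (fun x => expR (mu * `|g x|)).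
  by apply: measurableT_comp => //; apply: measurable_funM => //; exact: measurableT_comp.
have g_moment : L1 P (fun w => expR (mu * `|g (eps 0 w)|)).
  apply/integrableP; split.
    by apply/measurable_EFinP; exact: (measurableT_comp mexp).
  apply: le_lt_trans g_exp_moment; rewrite unlock; rewrite le_eqVlt; apply/orP; left; apply/eqP.
  by apply: eq_integral => w _ /=; rewrite ger0_norm ?expR_ge0.
have noise_moment : L1 P (fun w => `|f (eps 0 w)| ^+ 3).
  have mf3 : measurable_fun [set: R] (fun x => `|f x| ^+ 3).
    by apply: measurable_funX; exact: measurableT_comp.
  apply: (@L1_of_indep_product _ _ _ _ eps [set 0] [set l | l < 0] _
    (fun w => expR (nu / 2 * garch_X c g eps 0 w) ^+ 3) eps_iid.1).
  - apply/seteqP; split => // l [/= ->]; by rewrite ltxx.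
  - by apply: (adapted_comp mf3); exact: adapted_eps.
  - apply: (adapted_comp (h := fun x => expR (nu / 2 * x) ^+ 3)).
      have me : measurable_fun [set: R] (fun x => expR (nu / 2 * x)).
        by apply: measurableT_comp => //; exact: measurable_funM.
      exact: measurable_funX.
    apply: (measurable_garch_X c_meas g_meas) => l l0.
    exact: adapted_eps.
  - by move=> w; rewrite exprn_ge0.
  - by move=> w; rewrite exprn_gt0// expR_gt0.
  - apply: le_lt_trans f_moment; rewrite unlock; rewrite le_eqVlt; apply/orP; left; apply/eqP.
    apply: eq_integral => w _ /=.
    by rewrite /garch_y f_scale normrM (ger0_norm (expR_ge0 _)) exprMn mulrC.
exact: (garch_berry_esseen eps_iid c_meas g_meas f_meas rho_gt0 rho_lt1 nu_gt0
  mu_nu c_rho g_moment noise_moment f_scale X_cvg).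
Qed.
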